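(* Let $(\xi^*,\zeta^* )\in\mathcal A^\circ_0(\mathbb F^1)\times\mathcal A^\circ_0(\mathbb F^2)$ be an optimal pair and let $\mathbf M^*=\{M^*(\theta),\theta\in\mathcal T_0(\mathbb F^1)\}$, $\mathbf N^*=\{N^*(\gamma),\gamma\in\mathcal T_0(\mathbb F^2)\}$ with $$M^*(\theta)=\mathsf E\Big[\int_{[0,\theta)}f_t(1-\zeta^*_t)d\xi^*_t+\int_{[0,\theta)}g_t(1-\xi^*_t)d\zeta^*_t+\sum_{t\in[0,\theta)}h_t\Delta\xi^*_t\Delta\zeta^*_t\Big|\mathcal F^1_\theta\Big]+(1-\xi^*_{\theta-})\mathsf E[1-\zeta^*_{\theta-}|\mathcal F^1_\theta]V^{*,1}(\theta),$$ $$N^*(\gamma)=\mathsf E\Big[\int_{[0,\gamma)}f_t(1-\zeta^*_t)d\xi^*_t+\int_{[0,\gamma)}g_t(1-\xi^*_t)d\zeta^*_t+\sum_{t\in[0,\gamma)}h_t\Delta\xi^*_t\Delta\zeta^*_t\Big|\mathcal F^2_\gamma\Big]+(1-\zeta^*_{\gamma-})\mathsf E[1-\xi^*_{\gamma-}|\mathcal F^2_\gamma]V^{*,2}(\gamma).$$ The family $\mathbf M^*$ is a $\mathcal T_0(\mathbb F^1)$-martingale system and the family $\mathbf N^*$ is a $\mathcal T_0(\mathbb F^2)$-martingale system. Both are of class $(D)$. Hence, they can be uniquely aggregated (up to indistinguishability) into càdlàg martingales $(M^*_t)_{t\in[0,T]}$ with respect to $(\mathbb F^1,\mathsf P)$ and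 $(N^*_t)_{t\in[0,T]}$ with respect to $(\mathbb F^2,\mathsf P)$. Moreover, $$\mathbf 1_{\Gamma^1_\theta}V^{*,1}(\theta)=\mathbf 1_{\Gamma^1_\theta}J^{\Pi^{*,1}_\theta}(\xi^{*;\theta},\zeta^{*;\theta}|\mathcal F^1_\theta),\quad\theta\in\mathcal T_0(\mathbb F^1),$$ $$\mathbf 1_{\Gamma^2_\gamma}V^{*,2}(\gamma)=\mathbf 1_{\Gamma^2_\gamma}J^{\Pi^{*,2}_\gamma}(\xi^{*;\gamma},\zeta^{*;\gamma}|\mathcal F^2_\gamma),\quad\gamma\in\mathcal T_0(\mathbb F^2),$$ where $\Gamma^1_\theta=\{\omega:(1-\xi^*_{\theta-}(\omega))\,\mathsf E[1-\zeta^*_{\theta-}|\mathcal F^1_\theta](\omega)>0\}\in\mathcal F^1_\theta$ and $\Gamma^2_\gamma=\{\omega:(1-\zeta^*_{\gamma-}(\omega))\,\mathsf E[1-\xi^*_{\gamma-}|\mathcal F^2_\gamma](\omega)>0\}\in\mathcal F^2_\gamma$.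
   Context: Let $T\in(0,\infty)$ and let $(\Omega,\mathcal F,\mathsf P)$ be a complete probability space with a right-continuous filtration $\mathbb F=(\mathcal F_t)_{t\in[0,T]}$ completed with $\mathsf P$-null sets, $\mathcal F_T\subsetneq\mathcal F$. Right-continuous filtrations $\mathbb F^i=(\mathcal F^i_t)_{t\in[0,T]}$, $i=1,2$, completed with null sets, satisfy $\mathcal F^1_t\vee\mathcal F^2_t\subseteq\mathcal F_t$. Equalities/inequalities between random variables are $\mathsf P$-a.s. $\mathcal L_b(\mathsf P)$ is the space of càdlàg $\mathcal B([0,T])\times\mathcal F$-measurable $X$ with $\mathsf E[\sup_{0\le t\le T}|X_t|]<\infty$. The payoff processes $f,g,h\in\mathcal L_b(\mathsf P)$ are $\mathbb F$-adapted with $f_t\ge h_t\ge g_t$ for all $t\in[0,T]$ a.s. For a filtration $\mathbb G\subseteq\mathbb F$ and a $\mathbb G$-stopping time $\theta\in[0,T]$: $\mathcal T_\theta(\mathbb G)$ is the set of $\mathbb G$-stopping times with values in $[\theta,T]$; $\mathcal A^\circ_\theta(\mathbb G)$ is the set of $\mathbb G$-adapted càdlàg non-decreasing $\rho$ with $\rho_{\theta-}=0$, $\rho_T=1$ (for $\theta=0$, $\rho_{0-}:=0$, so $d\rho$ may charge $\{0\}$); $\Delta\rho_t=\rho_t-\rho_{t-}$. The $\mathbb G$-randomised stopping time generated by $\rho\in\mathcal A^\circ_\theta(\mathbb G)$ is $\eta=\inf\{t\in[0,T]:\rho_t>Z\}$ with $Z\sim U([0,1])$ independent of $\mathcal F_T$;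 the class of these is $\mathcal T^R_\theta(\mathbb G)$. The randomisation devices $Z$ of the two players are independent. Game: $\mathcal P(\tau,\sigma)=f_\tau\mathbf 1_{\{\tau<\sigma\}}+h_\tau\mathbf 1_{\{\tau=\sigma\}}+g_\sigma\mathbf 1_{\{\sigma<\tau\}}$; Player 1 picks $\tau\in\mathcal T^R_0(\mathbb F^1)$ to minimise, Player 2 picks $\sigma\in\mathcal T^R_0(\mathbb F^2)$ to maximise $\mathsf E[\mathcal P(\tau,\sigma)]$. A pair $(\xi^*,\zeta^* )\in\mathcal A^\circ_0(\mathbb F^1)\times\mathcal A^\circ_0(\mathbb F^2)$ is optimal if it generates a saddle point $(\tau_*,\sigma_* )$: $\mathsf E[\mathcal P(\tau_*,\sigma)]\le\mathsf E[\mathcal P(\tau_*,\sigma_* )]\le\mathsf E[\mathcal P(\tau,\sigma_* )]$ for all $(\tau,\sigma)\in\mathcal T^R_0(\mathbb F^1)\times\mathcal T^R_0(\mathbb F^2)$. Truncated controls: for a stopping time $\eta$, $\xi^{*;\eta}_t=\frac{\xi^*_t-\xi^*_{\eta-}}{1-\xi^*_{\eta-}}\mathbf 1_{\{t\ge\eta\}}$, $\zeta^{*;\eta}_t=\frac{\zeta^*_t-\zeta^*_{\eta-}}{1-\zeta^*_{\eta-}}\mathbf 1_{\{t\ge\eta\}}$, with $0/0=1$ and $\xi^{*;\eta}_{\eta-}=\zeta^{*;\eta}_{\eta-}=0$. Set $\Pi^{*,1}_\theta=\frac{1-\zeta^*_{\theta-}}{\mathsf E[1-\zeta^*_{\theta-}|\mathcal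 F^1_\theta]}$, $\Pi^{*,2}_\gamma=\frac{1-\xi^*_{\gamma-}}{\mathsf E[1-\xi^*_{\gamma-}|\mathcal F^2_\gamma]}$, ratios being $1$ where the denominator is $0$. For a random variable $\Pi\ge0$, a $\sigma$-algebra $\mathcal G$, and $\xi,\zeta$ started at $\theta$, $$J^\Pi(\xi,\zeta|\mathcal G)=\mathsf E\Big[\Pi\Big(\int_{[\theta,T)}f_t(1-\zeta_t)d\xi_t+\int_{[\theta,T)}g_t(1-\xi_t)d\zeta_t+\sum_{t\in[\theta,T]}h_t\Delta\zeta_t\Delta\xi_t\Big)\Big|\mathcal G\Big].$$ Equilibrium values: $V^{*,1}(\theta)=\operatorname*{ess\,inf}_{\xi\in\mathcal A^\circ_\theta(\mathbb F^1)}J^{\Pi^{*,1}_\theta}(\xi,\zeta^{*;\theta}|\mathcal F^1_\theta)$ for $\theta\in\mathcal T_0(\mathbb F^1)$, $V^{*,2}(\gamma)=\operatorname*{ess\,sup}_{\zeta\in\mathcal A^\circ_\gamma(\mathbb F^2)}J^{\Pi^{*,2}_\gamma}(\xi^{*;\gamma},\zeta|\mathcal F^2_\gamma)$ for $\gamma\in\mathcal T_0(\mathbb F^2)$. A family $\{X(\theta),\theta\in\mathcal T_0(\mathbb G)\}$ is a $\mathcal T_0(\mathbb G)$-system if $X(\theta)$ is $\mathcal G_\theta$-measurable and $X(\theta_1)=X(\theta_2)$ on $\{\theta_1=\theta_2\}$; it is a martingale system if moreover $\mathsf E|X(\theta)|<\infty$ and $\mathsf E[X(\theta_2)|\mathcal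 G_{\theta_1}]=X(\theta_1)$ whenever $\theta_1\le\theta_2$; of class $(D)$ if it is uniformly integrable. A $\mathbb G$-optional process $(X_t)$ aggregates it if $\mathsf P(X(\theta)=X_\theta)=1$ for every $\theta\in\mathcal T_0(\mathbb G)$. *)

(* Defs.v *)
From HB Require Import structures.
From mathcomp Require Import all_boot all_order all_algebra.
From mathcomp Require Import all_classical all_reals all_analysis.
From mathcomp Require Import measurable_realfun.

Set Implicit Arguments.
Unset Strict Implicit.
Unset Printing Implicit Defensive.

Import Order.TTheory GRing.Theory Num.Theory.
Import numFieldNormedType.Exports.

Local Open Scope classical_set_scope.
Local Open Scope ring_scope.

(* Processes are functions [R -> Omega -> R] and filtrations are functions
   [R -> set (set Omega)]; only their values at times in [0, T] matter. *)

Section conditional_expectation.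
Context {d : measure_display} {Omega : measurableType d} {R : realType}.
Variable P : probability Omega R.
Implicit Types (G : set (set Omega)) (X Y : Omega -> \bar R).

Definition measurable_wrt {d'} {U : measurableType d'} G (X : Omega -> U) :=
  forall B, measurable B -> G (X @^-1` B).

Definition is_condexp_ge0 G X Y :=
  [/\ measurable_wrt G Y, forall w, (0 <= Y w)%E
    & forall A, G A -> (\int[P]_(w in A) Y w = \int[P]_(w in A) X w)%E].

Definition condexp_ge0 G X : Omega -> \bar R :=
  xget (cst 0%E : {classic Omega -> \bar R}) [set Y | is_condexp_ge0 G X Y].

(* A version of E[X | G] in the generalised sense E[X^+ | G] - E[X^- | G].
   The generalised sense is needed for J below: the weight is not bounded, so
   that the variable under the conditional expectation need not be integrable,
   although its conditional expectation is almost surely finite. *)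
Definition condexp G X : Omega -> \bar R :=
  fun w => (condexp_ge0 G X^\+ w - condexp_ge0 G X^\- w)%E.

(* Essential infimum and supremum of a set of random variables. *)
Definition is_ess_infimum (S : set (Omega -> \bar R)) Y :=
  [/\ measurable_fun setT Y,
      forall X, S X -> {ae P, forall w, (Y w <= X w)%E}
    & forall Z, measurable_fun setT Z ->
        (forall X, S X -> {ae P, forall w, (Z w <= X w)%E}) ->
        {ae P, forall w, (Z w <= Y w)%E}].

Definition is_ess_supremum (S : set (Omega -> \bar R)) Y :=
  [/\ measurable_fun setT Y,
      forall X, S X -> {ae P, forall w, (X w <= Y w)%E}
    & forall Z, measurable_fun setT Z ->
        (forall X, S X -> {ae P, forall w, (X w <= Z w)%E}) ->
        {ae P, forall w, (Y w <= Z w)%E}].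

Definition ess_infimum S : Omega -> \bar R :=
  xget (cst 0%E : {classic Omega -> \bar R}) [set Y | is_ess_infimum S Y].

Definition ess_supremum S : Omega -> \bar R :=
  xget (cst 0%E : {classic Omega -> \bar R}) [set Y | is_ess_supremum S Y].

End conditional_expectation.

Section processes.
Context {d : measure_display} {Omega : measurableType d} {R : realType}.
Variables (P : probability Omega R) (T : R).
Implicit Types (G : R -> set (set Omega)) (x y : R -> Omega -> R).
Implicit Types (theta : Omega -> R).

Definition filtration G :=
  [/\ forall t, 0 <= t <= T -> sigma_algebra setT (G t) /\ G t `<=` measurable,
      forall s t, 0 <= s -> s <= t -> t <= T -> G s `<=` G t,
      forall t, 0 <= t < T -> \bigcap_(s in `]t, T]) G s `<=` G t
    & forall t, 0 <= t <= T -> P.-negligible `<=` G t].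

Definition stopping_time G theta :=
  (forall w, 0 <= theta w <= T) /\
  (forall t, 0 <= t <= T -> G t [set w | theta w <= t]).

(* As theta <= T, the condition at t = T says that A belongs to G T. *)
Definition sigma_at G theta : set (set Omega) :=
  [set A | forall t, 0 <= t <= T -> G t (A `&` [set w | theta w <= t])].

Definition adapted G x := forall t, 0 <= t <= T -> measurable_wrt (G t) (x t).

Definition cadlag x := forall w,
  (forall t, 0 <= t < T -> x s w @[s --> t^'+] --> x t w) /\
  (forall t, 0 < t <= T -> exists l : R, x s w @[s --> t^'-] --> l).

Definition sup_abs x w : \bar R := ereal_sup [set `|x t w|%:E | t in `[0, T]].

Definition Lb x :=
  [/\ cadlag x,
      measurable_fun (`[0, T] `*` setT) (fun z : R * Omega => x z.1 z.2)
    & (\int[P]_w sup_abs x w < +oo)%E].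

(* The sigma-algebra on [0, T] x Omega generated by the adapted cadlag
   processes. *)
Definition optional_sigma G : set (set (R * Omega)) :=
  <<s `[0, T] `*` setT,
      [set D | exists2 y, adapted G y /\ cadlag y &
        exists2 B : set R, measurable B &
          D = (`[0, T] `*` setT) `&` [set z | B (y z.1 z.2)]] >>.

Definition optional G x := forall B : set R, measurable B ->
  optional_sigma G ((`[0, T] `*` setT) `&` [set z | B (x z.1 z.2)]).

Definition indistinguishable x y :=
  {ae P, forall w, forall t, 0 <= t <= T -> x t w = y t w}.

Definition martingale G x :=
  [/\ adapted G x,
      forall t, 0 <= t <= T -> P.-integrable setT (EFin \o x t)
    & forall s t, 0 <= s -> s <= t -> t <= T ->
        {ae P, forall w, condexp P (G s) (EFin \o x t) w = (x s w)%:E}].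

(* Families of random variables indexed by stopping times. *)

Implicit Types (X : (Omega -> R) -> Omega -> \bar R).

Definition stopping_system G X :=
  (forall theta, stopping_time G theta ->
     measurable_wrt (sigma_at G theta) (X theta)) /\
  (forall theta1 theta2, stopping_time G theta1 -> stopping_time G theta2 ->
     {ae P, forall w, theta1 w = theta2 w -> X theta1 w = X theta2 w}).

Definition martingale_system G X :=
  [/\ stopping_system G X,
      forall theta, stopping_time G theta -> P.-integrable setT (X theta)
    & forall theta1 theta2, stopping_time G theta1 -> stopping_time G theta2 ->
        {ae P, forall w, theta1 w <= theta2 w} ->
        {ae P, forall w,
          condexp P (sigma_at G theta1) (X theta2) w = X theta1 w}].

Definition class_D G X := forall eps : R, 0 < eps -> exists c : R,
  forall theta, stopping_time G theta ->
  (\int[P]_(w in [set w | c%:E < `|X theta w|]) `|X theta w| <= eps%:E)%E.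

Definition aggregates G X x := optional G x /\
  forall theta, stopping_time G theta ->
    {ae P, forall w, X theta w = (x (theta w) w)%:E}.

Definition uniquely_aggregated_cadlag_martingale G X :=
  exists x, [/\ cadlag x, martingale G x, aggregates G X x
    & forall y, cadlag y -> martingale G y -> aggregates G X y ->
        indistinguishable x y].

(* The path of x extended by 0 before time 0, which encodes the convention
   x_{0-} = 0, and by its terminal value after time T. *)
Definition path x w : R -> R :=
  fun t => if t < 0 then 0 else x (Num.min t T) w.

Definition left_val x (t : R) w : R := lim (path x w s @[s --> t^'-]).

Definition jump x (t : R) w : R := x t w - left_val x t w.

(* The controls in A°_theta(G). The requirement 0 <= x_0 is monotonicity at
   time 0, where x_{0-} = 0; together with x_{theta-} = 0 it makes x vanish
   on [0, theta). *)
Definition control G theta x :=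
  [/\ adapted G x, cadlag x,
      forall w, 0 <= x 0 w /\
        (forall s t, 0 <= s -> s <= t -> t <= T -> x s w <= x t w),
      forall w, left_val x (theta w) w = 0
    & forall w, x T w = 1].

(* Quotient with the convention a / 0 = 1. *)
Definition ratio (a b : R) : R := if b == 0 then 1 else a / b.

Definition truncated x theta : R -> Omega -> R := fun t w =>
  if theta w <= t then
    ratio (x t w - left_val x (theta w) w) (1 - left_val x (theta w) w)
  else 0.

(* The bundled version of a nondecreasing right-continuous function, and a junk
   value for other functions. *)
Definition to_cumulative (p : R -> R) : cumulative R R :=
  if pselect (exists F : cumulative R R, F = p :> (R -> R)) is left e
  then projT1 (cid e) else idfun.

(* The Lebesgue-Stieltjes measure of a path; it has mass x_0 at 0. *)
Definition dpath x w := lebesgue_stieltjes_measure (to_cumulative (path x w)).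

(* Sum over an uncountable index set. *)
Definition real_sum (D : set R) (a : R -> R) : R :=
  fine (\esum_(t in D) ((EFin \o a)^\+)%E t)
  - fine (\esum_(t in D) ((EFin \o a)^\-)%E t).

(* The integrals are over A, the sum is over B. *)
Definition payoff_functional (f g h xi zeta : R -> Omega -> R)
    (A B : Omega -> set R) (w : Omega) : R :=
  \int[dpath xi w]_(t in A w) (f t w * (1 - zeta t w))
  + \int[dpath zeta w]_(t in A w) (g t w * (1 - xi t w))
  + real_sum (B w) (fun t => h t w * jump zeta t w * jump xi t w).

End processes.

Section game.
Context {d : measure_display} {Omega : measurableType d} {R : realType}.
Variables (P : probability Omega R) (T : R).
Variables (F F1 F2 : R -> set (set Omega)) (f g h : R -> Omega -> R).
Implicit Types (G : R -> set (set Omega)) (xi zeta rho : R -> Omega -> R).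
Implicit Types (theta gamma tau sigma : Omega -> R).

(* inf {t in [0, T] | rho_t > Z}, with value T when there is no such t. *)
Definition generated_time rho (Z : Omega -> R) : Omega -> R :=
  fun w => inf ([set t | 0 <= t <= T /\ Z w < rho t w] `|` [set T]).

Definition randomised_stopping_time G theta (Z : Omega -> R) tau :=
  exists2 rho, control T G theta rho & tau = generated_time rho Z.

(* Z1 and Z2 are uniform on [0, 1], and Z1, Z2, F_T are mutually independent. *)
Definition randomisation_devices (Z1 Z2 : {RV P >-> R}) :=
  [/\ forall B, measurable B -> distribution P Z1 B = uniform_prob ltr01 B,
      forall B, measurable B -> distribution P Z2 B = uniform_prob ltr01 B
    & forall A B1 B2, F T A -> measurable B1 -> measurable B2 ->
        P (A `&` (Z1 @^-1` B1) `&` (Z2 @^-1` B2)) =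
        (P A * P (Z1 @^-1` B1) * P (Z2 @^-1` B2))%E].

Definition payoff tau sigma : Omega -> R := fun w =>
  if tau w < sigma w then f (tau w) w
  else if tau w == sigma w then h (tau w) w
  else g (sigma w) w.

Definition optimal_pair xi zeta :=
  [/\ control T F1 (cst 0) xi, control T F2 (cst 0) zeta
    & exists Z1 Z2 : {RV P >-> R},
        let tau_opt := generated_time xi Z1 in
        let sigma_opt := generated_time zeta Z2 in
        [/\ randomisation_devices Z1 Z2,
            forall (Z : {RV P >-> R}) sigma, randomisation_devices Z1 Z ->
              randomised_stopping_time F2 (cst 0) Z sigma ->
              ('E_P[payoff tau_opt sigma] <= 'E_P[payoff tau_opt sigma_opt])%E
          & forall (Z : {RV P >-> R}) tau, randomisation_devices Z Z2 ->
              randomised_stopping_time F1 (cst 0) Z tau ->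
              ('E_P[payoff tau_opt sigma_opt] <= 'E_P[payoff tau sigma_opt])%E]].

Definition J (Pi : Omega -> R) theta xi zeta (H : set (set Omega)) :
    Omega -> \bar R :=
  condexp P H (fun w => (Pi w *
    payoff_functional T f g h xi zeta
      (fun w => `[theta w, T[%classic) (fun w => `[theta w, T]%classic) w)%:E).

(* E[1 - rho_{theta-} | G_theta] *)
Definition survival G rho theta : Omega -> \bar R :=
  condexp P (sigma_at T G theta) (fun w => (1 - left_val T rho (theta w) w)%:E).

(* The weights Pi^{*,1} and Pi^{*,2} are obtained by taking for G the
   filtration of one player and for rho the control of the other player. *)
Definition weight G rho theta : Omega -> R := fun w =>
  ratio (1 - left_val T rho (theta w) w) (fine (survival G rho theta w)).

Variables xi zeta : R -> Omega -> R.

Definition J1 theta (x : R -> Omega -> R) : Omega -> \bar R :=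
  J (weight F1 zeta theta) theta x (truncated T zeta theta)
    (sigma_at T F1 theta).

Definition J2 gamma (z : R -> Omega -> R) : Omega -> \bar R :=
  J (weight F2 xi gamma) gamma (truncated T xi gamma) z
    (sigma_at T F2 gamma).

Definition V1 theta : Omega -> \bar R :=
  ess_infimum P [set J1 theta x | x in control T F1 theta].

Definition V2 gamma : Omega -> \bar R :=
  ess_supremum P [set J2 gamma z | z in control T F2 gamma].

Definition Gamma1 theta : set Omega := [set w |
  (0 < (1 - left_val T xi (theta w) w)%:E * survival F1 zeta theta w)%E].

Definition Gamma2 gamma : set Omega := [set w |
  (0 < (1 - left_val T zeta (gamma w) w)%:E * survival F2 xi gamma w)%E].

Definition past_payoff G theta : Omega -> \bar R :=
  condexp P (sigma_at T G theta) (fun w =>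
    (payoff_functional T f g h xi zeta
      (fun w => `[0, theta w[%classic) (fun w => `[0, theta w[%classic) w)%:E).

Definition Mstar theta : Omega -> \bar R := fun w =>
  (past_payoff F1 theta w
   + (1 - left_val T xi (theta w) w)%:E * survival F1 zeta theta w
     * V1 theta w)%E.

Definition Nstar gamma : Omega -> \bar R := fun w =>
  (past_payoff F2 gamma w
   + (1 - left_val T zeta (gamma w) w)%:E * survival F2 xi gamma w
     * V2 gamma w)%E.

End game.

(* Main.v *)
(* After a stopping time theta, a control of Player 1 that agrees with xi*
   before theta spends the remaining mass 1 - xi*_{theta-} according to some x
   in A°_theta(F1), and its payoff against zeta* is the payoff before theta plus
   (1 - xi*_{theta-}) (1 - zeta*_{theta-}) times the payoff of x against the
   truncated zeta*. Expected payoffs of randomised times are expectations of the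
   payoff functional, because the time generated by rho has law d rho
   conditionally on F_T. Comparing, for A in F1_theta, the saddle point with the
   deviation that uses x on A and the truncated xi* outside A shows that, up to
   the factor K = (1 - xi*_{theta-}) E[1 - zeta*_{theta-} | F1_theta], the
   truncated xi* has the smallest conditional payoff. Hence V^{*,1}(theta) is
   attained at the truncated xi* on {K > 0}, and M*(theta) is the conditional
   expectation given F1_theta of the total payoff of (xi*, zeta* ). A family of
   conditional expectations of one integrable variable is a uniformly integrable
   martingale system; its cadlag aggregate is obtained from dyadic times by
   upcrossing estimates. Player 2 is Player 1 with f and g exchanged and with
   the inequalities reversed. *)

Require Import Defs.
From HB Require Import structures.
From mathcomp Require Import all_boot all_order all_algebra.
From mathcomp Require Import all_classical all_reals all_analysis.
From mathcomp Require Import measurable_realfun ring lra.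

Set Implicit Arguments.
Unset Strict Implicit.
Unset Printing Implicit Defensive.

Import Order.TTheory GRing.Theory Num.Theory.
Import numFieldNormedType.Exports.
(* Defs again, as its [path] and [ratio] are shadowed by MathComp names. *)
Import Defs.

Local Open Scope classical_set_scope.
Local Open Scope ring_scope.

(** * Measures on the line *)

(** The weight in [J] has a denominator that can be arbitrarily small, so the weighted payoff may
    fail to be integrable. Its product with K is integrable, and K times J is a genuine conditional
    expectation because a conditioning factor with values in [0, 1] can be pulled out of the
    positive and the negative part separately, even if these have infinite integral. Stieltjes
    integrals and uncountable sums of jumps are not visibly measurable in omega. Each path of a
    control is the distribution function of the time at which it first exceeds a uniform level, so
    both become integrals against the law of that time; Tonelli then yields measurability and the
    expected payoff alike. The rewriting is carried out where the supremum of |h| is finite, and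
    completeness of [P] extends measurability to the payoff functional itself. The aggregate has to
    be identified at every stopping time theta, not only at fixed times: theta is approximated from
    above by dyadic times, uniform integrability turns almost sure convergence into convergence in
    L1, and right-continuity of the filtration makes the limit measurable at theta. *)

Section default_display.
Context {R : realType}.
Local Open Scope ereal_scope.

(* The Stieltjes and uniform measures of the library live on
   [measurableTypeR R], which has the same measurable sets as [R] but
   another display. *)
Definition to_default : measurableTypeR R -> R := id.

Lemma measurable_to_default : measurable_fun setT to_default.
Proof. by move=> _ B mB; rewrite setTI. Qed.

HB.instance Definition _ :=
  isMeasurableFun.Build _ _ _ _ to_default measurable_to_default.

Definition unif01 : set R -> \bar R := distribution (uniform_prob ltr01) to_default.

HB.instance Definition _ := Measure.on unif01.

Let unif01_setT : unif01 setT = 1. Proof. exact: probability_setT. Qed.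

HB.instance Definition _ := Measure_isProbability.Build _ _ _ unif01 unif01_setT.

Lemma unif01E (B : set R) : measurable B -> B `<=` `[0%R, 1%R] ->
  unif01 B = (lebesgue_measure : set R -> \bar R) B.
Proof.
move=> mB B01; rewrite /unif01 /distribution /pushforward/= /uniform_prob.
rewrite (_ : to_default @^-1` B = B)//.
transitivity (\int[lebesgue_measure]_(x in B) (cst 1 : R -> \bar R) x).
  apply: eq_integral => x /[!inE] /B01/=; rewrite in_itv/= /uniform_pdf => ->.
  by rewrite subr0 invr1.
by rewrite integral_cst// mul1e.
Qed.

Lemma unif01_co (k : R) : (0 <= k <= 1)%R -> unif01 `[0%R, k[%classic = k%:E.
Proof.
move=> /andP[k0 k1]; rewrite unif01E//; last first.
  by move=> x/=; rewrite !in_itv/= => /andP[-> /ltW/le_trans->].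
transitivity (lebesgue_measure (`[0%R, k[%classic : set R)) => //.
rewrite lebesgue_measure_itv/= lte_fin sube0; case: ltP => // ?.
by congr _%:E; apply/eqP; rewrite eq_le k0.
Qed.

Lemma unif01_cc (k : R) : (0 <= k <= 1)%R -> unif01 `[0%R, k]%classic = k%:E.
Proof.
move=> /andP[k0 k1]; rewrite unif01E//; last first.
  by move=> x/=; rewrite !in_itv/= => /andP[-> /le_trans->].
transitivity (lebesgue_measure (`[0%R, k]%classic : set R)) => //.
rewrite lebesgue_measure_itv/= lte_fin sube0; case: ltP => // ?.
by congr _%:E; apply/eqP; rewrite eq_le k0.
Qed.

End default_display.

Section measurable_comparison.
Context {d : measure_display} {T : measurableType d} {R : realType}.
Implicit Types f g : T -> R.

Lemma measurable_set_ltr f g : measurable_fun setT f -> measurable_fun setT g ->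
  measurable [set x | f x < g x].
Proof.
move=> mf mg; have := measurable_fun_ltr mf mg measurableT (Y := [set true]).
by rewrite setTI; apply.
Qed.

Lemma measurable_set_ler f g : measurable_fun setT f -> measurable_fun setT g ->
  measurable [set x | f x <= g x].
Proof.
move=> mf mg; have := measurable_fun_ler mf mg measurableT (Y := [set true]).
by rewrite setTI; apply.
Qed.

End measurable_comparison.

(** * Conditional expectations and essential infima *)

Section sub_sigma_algebra.
Context {d : measure_display} {Omega : measurableType d}.
Variables (G : set (set Omega)) (sG : sigma_algebra setT G).

Lemma measurable_subsigmaE (A : set Omega) :
  @measurable _ (g_sigma_algebraType G) A = G A.
Proof. by rewrite /measurable/= sigma_algebra_id. Qed.

Lemma measurable_wrtP {d'} {U : measurableType d'} (X : Omega -> U) :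
  measurable_wrt G X <-> measurable_fun setT (X : g_sigma_algebraType G -> U).
Proof.
split=> [mX _ B mB|mX B mB].
  by rewrite setTI measurable_subsigmaE; exact: mX.
by rewrite -measurable_subsigmaE -[_ @^-1` _]setTI; exact: mX.
Qed.

End sub_sigma_algebra.

Lemma measurable_wrt_fun {d d'} {Omega : measurableType d} {U : measurableType d'}
    (G : set (set Omega)) (X : Omega -> U) :
  G `<=` measurable -> measurable_wrt G X -> measurable_fun setT X.
Proof. by move=> GP mX _ B mB; rewrite setTI; exact/GP/mX. Qed.

Section conditional_expectation_theory.
Context {d : measure_display} {Omega : measurableType d} {R : realType}.
Variables (P : probability Omega R) (G : set (set Omega)).
Hypotheses (sG : sigma_algebra setT G) (GP : G `<=` measurable).
Local Open Scope ereal_scope.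
Implicit Types X Y : Omega -> \bar R.

Local Notation GT := (g_sigma_algebraType G).
Let measurable_subsigmaE := measurable_subsigmaE sG.
Let measurable_wrtP := @measurable_wrtP _ _ _ sG.
Let measurable_wrt_fun d' (U : measurableType d') (Z : Omega -> U) :=
  @measurable_wrt_fun _ _ _ _ _ Z GP.

(** The pushforward of [P] along this identity is the restriction of [P] to [G]. Radon-Nikodym and
    the comparison of integrals over all measurable sets are applied to that restriction, whose
    measurable sets are exactly those of [G]. *)
Definition subsigma_inj : Omega -> GT := id.

Lemma measurable_subsigma_inj : measurable_fun setT subsigma_inj.
Proof.
by move=> _ B; rewrite measurable_subsigmaE setTI => GB; exact: GP.
Qed.

HB.instance Definition _ :=
  isMeasurableFun.Build _ _ _ _ subsigma_inj measurable_subsigma_inj.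

Definition trace_prob : probability GT R := distribution P subsigma_inj.

Lemma integral_trace_ge0 A Y : G A -> measurable_wrt G Y ->
  (forall w, 0 <= Y w) ->
  \int[trace_prob]_(w in A) Y w = \int[P]_(w in A) Y w.
Proof.
move=> GA /measurable_wrtP mY Y0.
rewrite /trace_prob /distribution ge0_integral_pushforward//.
- by rewrite measurable_subsigmaE.
- exact: measurable_funTS.
Qed.

Lemma integrable_trace Y : measurable_wrt G Y ->
  trace_prob.-integrable setT Y <-> P.-integrable setT Y.
Proof.
move=> mY.
have trE : \int[trace_prob]_w `|Y w| = \int[P]_w `|Y w|.
  apply: integral_trace_ge0 => //.
    by rewrite -measurable_subsigmaE.
  by apply/measurable_wrtP/measurableT_comp => //; exact/measurable_wrtP.
split=> /integrableP[_ iY]; apply/integrableP; split.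
- exact: measurable_wrt_fun.
- by rewrite -trE.
- exact/measurable_wrtP.
- by rewrite trE.
Qed.

Lemma integral_trace A Y : G A -> measurable_wrt G Y ->
  \int[trace_prob]_(w in A) Y w = \int[P]_(w in A) Y w.
Proof.
move=> GA mY; rewrite integralE [RHS]integralE.
by congr (_ - _); apply: integral_trace_ge0 => //; apply/measurable_wrtP;
  [apply: measurable_funepos|apply: measurable_funeneg]; exact/measurable_wrtP.
Qed.

Lemma ae_trace Q : {ae trace_prob, forall w, Q w} -> {ae P, forall w, Q w}.
Proof.
by move=> [N [mN N0 QN]]; exists N; split => //; apply: GP;
  rewrite -measurable_subsigmaE.
Qed.

Section existence.
Variable X : Omega -> \bar R.
Hypotheses (iX : P.-integrable setT X) (X0 : forall w, 0 <= X w).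

Let mX : measurable_fun setT X. Proof. exact: measurable_int iX. Qed.

Definition weighted_trace (A : set GT) : \bar R := \int[P]_(w in A) X w.

Let mG (A : set GT) : measurable A -> d.-measurable A.
Proof. by rewrite measurable_subsigmaE => /GP. Qed.

Let weighted_trace0 : weighted_trace set0 = 0.
Proof. by rewrite /weighted_trace integral_set0. Qed.

Let weighted_trace_ge0 A : 0 <= weighted_trace A.
Proof. exact: integral_ge0. Qed.

Let weighted_trace_sigma_additive : semi_sigma_additive weighted_trace.
Proof.
move=> A mA tA mU; apply: (semi_sigma_additive_nng_induced mX X0) => //.
  by move=> n; apply: mG; exact: mA.
exact: mG.
Qed.

HB.instance Definition _ := isMeasure.Build _ _ _ weighted_trace
  weighted_trace0 weighted_trace_ge0 weighted_trace_sigma_additive.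

Let weighted_trace_finite : fin_num_fun weighted_trace.
Proof.
move=> A mA; apply: integrable_fin_num; first exact: mG.
by apply: integrableS iX => //; exact: mG.
Qed.

HB.instance Definition _ := Measure_isFinite.Build _ _ _ weighted_trace
  weighted_trace_finite.

(** The finite measure A -> E[X; A] on [G] is dominated by the restriction of [P] to [G]; its
    Radon-Nikodym derivative is [G]-measurable because it is taken on that restricted space. *)
Lemma condexp_ge0_exists_integrable : exists Y, is_condexp_ge0 P G X Y.
Proof.
have dom : weighted_trace `<< trace_prob.
  apply/null_content_dominatesP => A mA A0; apply: null_set_integral => //.
  - exact: mG.
  - exact: measurable_funTS.
have [Y [Y0 _ iY YE]] := radon_nikodym_sigma_finite dom.
have mY : measurable_wrt G Y by apply/measurable_wrtP; exact: measurable_int iY.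
exists Y; split => // A GA.
by rewrite -integral_trace_ge0// -YE// measurable_subsigmaE.
Qed.

End existence.

(* A nonintegrable variable is a countable sum of bounded ones. *)
Lemma condexp_ge0_exists X : measurable_fun setT X -> (forall w, 0 <= X w) ->
  (forall w, X w \is a fin_num) -> exists Y, is_condexp_ge0 P G X Y.
Proof.
move=> mX X0 fX.
pose S n := X @^-1` `[n%:R%:E, n.+1%:R%:E[%classic.
have mS n : measurable (S n).
  by rewrite -[S n]setTI; apply: mX => //; exact: emeasurable_itv.
pose Xn n w := X w * (\1_(S n) w)%:E.
have mXn n : measurable_fun setT (Xn n).
  by apply: emeasurable_funM => //; apply/measurable_EFinP.
have Xn0 n w : 0 <= Xn n w by rewrite mule_ge0// lee_fin.
have iXn n : P.-integrable setT (Xn n).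
  apply: (le_integrable measurableT (mXn n) (g := cst n.+1%:R%:E)).
    move=> w _; rewrite gee0_abs//= /Xn indicE.
    have [|] := boolP (w \in S n); last by rewrite mule0 lee_fin.
    rewrite inE /S/= in_itv/= => /andP[_ /ltW Xw].
    by rewrite mule1 (le_trans Xw)// lee_fin ler_norm.
  exact: finite_measure_integrable_cst.
have XE w : X w = \sum_(n <oo) Xn n w.
  have [r Xr] : exists r, X w = r%:E by exists (fine (X w)); rewrite fineK.
  have r0 : (0 <= r)%R by rewrite -lee_fin -Xr.
  pose k := Num.truncn r.
  (* Each point lies in exactly one slice, indexed by the integer part of its value, so the series
     has at most one nonzero term. *)
  have Sk n : (w \in S n) = (n == k).
    rewrite /k; apply/idP/eqP => [|->]; rewrite inE /S /= in_itv/= Xr lee_fin.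
      by rewrite lte_fin => h; exact/esym/truncn_def.
    by rewrite lte_fin; exact: truncn_itv.
  rewrite (nneseries_split 0 k.+1)//= eseries0 ?adde0; last first.
    move=> n; rewrite add0n => kn _; rewrite /Xn indicE Sk gtn_eqF ?mule0//.
  rewrite add0n big_nat_recr//= big1_seq ?add0e; last first.
    move=> n; rewrite mem_index_iota => /andP[_ nk].
    by rewrite /Xn indicE Sk ltn_eqF ?mule0.
  by rewrite /Xn indicE Sk eqxx mule1.
have /choice[Y YP] : forall n, exists Y, is_condexp_ge0 P G (Xn n) Y.
  by move=> n; exact: condexp_ge0_exists_integrable.
exists (fun w => \sum_(n <oo) Y n w); split.
- apply/measurable_wrtP; apply: ge0_emeasurable_sum => //.
    by move=> n x _ _; case: (YP n).
  by move=> n _; apply/measurable_wrtP; case: (YP n).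
- by move=> w; apply: nneseries_ge0 => n _ _; case: (YP n).
- move=> A GA; have mA := GP GA.
  under [RHS]eq_integral do rewrite XE.
  rewrite integral_nneseries//; last 2 first.
    by move=> n; apply: measurable_funTS; apply: measurable_wrt_fun; case: (YP n).
    by move=> n w _; case: (YP n).
  rewrite integral_nneseries//; last by move=> n; exact: measurable_funTS.
  by apply: eq_eseriesr => n _; case: (YP n) => _ _ ->.
Qed.

Lemma condexp_ge0P X Y :
  is_condexp_ge0 P G X Y -> is_condexp_ge0 P G X (condexp_ge0 P G X).
Proof. by move=> XY; rewrite /condexp_ge0; case: xgetP => [//|/(_ Y)]. Qed.

Lemma condexp_ge0_fin_numP X : measurable_fun setT X -> (forall w, 0 <= X w) ->
  (forall w, X w \is a fin_num) -> is_condexp_ge0 P G X (condexp_ge0 P G X).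
Proof.
by move=> mX X0 fX; have [Y] := condexp_ge0_exists mX X0 fX; exact: condexp_ge0P.
Qed.

Lemma condexp_ge0_integrableP X : P.-integrable setT X -> (forall w, 0 <= X w) ->
  is_condexp_ge0 P G X (condexp_ge0 P G X).
Proof.
by move=> iX X0; have [Y] := condexp_ge0_exists_integrable iX X0;
  exact: condexp_ge0P.
Qed.

Lemma is_condexp_ge0_integrable X Y : P.-integrable setT X ->
  (forall w, 0 <= X w) -> is_condexp_ge0 P G X Y -> P.-integrable setT Y.
Proof.
move=> /integrableP[mX iX] X0 [mY Y0 YX]; apply/integrableP; split.
  exact: measurable_wrt_fun.
have GT' : G setT by rewrite -measurable_subsigmaE.
under eq_integral do rewrite gee0_abs//.
rewrite YX//; move: iX; congr (_ < _).
by apply: eq_integral => w _; rewrite gee0_abs.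
Qed.

(** The property of being an integrable version, free of the choice made in [condexp]. Algebra,
    comparison and uniqueness are proved for it, and [condexp] satisfies it for integrable [X]. *)
Definition is_condexp X Y := [/\ measurable_wrt G Y, P.-integrable setT Y
  & forall A, G A -> \int[P]_(w in A) Y w = \int[P]_(w in A) X w].

Lemma condexpP X : P.-integrable setT X -> is_condexp X (condexp P G X).
Proof.
move=> iX.
have ip := integrable_funepos measurableT iX.
have im := integrable_funeneg measurableT iX.
have cp := condexp_ge0_integrableP ip (funepos_ge0 X).
have cm := condexp_ge0_integrableP im (funeneg_ge0 X).
have ip' := is_condexp_ge0_integrable ip (funepos_ge0 X) cp.
have im' := is_condexp_ge0_integrable im (funeneg_ge0 X) cm.
have [mp _ pE] := cp; have [mm _ mE] := cm.
split.
- apply/measurable_wrtP; apply: emeasurable_funB; exact/measurable_wrtP.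
- exact: integrableB.
- move=> A GA; have mA := GP GA.
  rewrite /condexp integralB//.
  + by rewrite pE// mE// -integralE.
  + exact: integrableS ip'.
  + exact: integrableS im'.
Qed.

(** On {Y' < Y}, an event of [G], and on each of its subsets in [G], the integrals of [Y] and [Y']
    agree: the hypothesis gives one inequality and Y' < Y the other. Hence Y = Y' almost surely on
    that event, which is therefore null. *)
Lemma is_condexp_le X X' Y Y' : is_condexp X Y -> is_condexp X' Y' ->
  (forall A, G A -> \int[P]_(w in A) X w <= \int[P]_(w in A) X' w) ->
  {ae P, forall w, Y w <= Y' w}.
Proof.
move=> [mY iY YX] [mY' iY' YX'] leX.
have mYT := (measurable_wrtP Y).1 mY.
have mYT' := (measurable_wrtP Y').1 mY'.
pose A := [set w | Y' w < Y w].
have mA : measurable (A : set GT).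
  by rewrite -[A]setTI; exact: measurable_lte.
have GA : G A by rewrite -measurable_subsigmaE.
have /ae_trace : {ae trace_prob, forall w, A w -> Y w = Y' w}.
  apply: integral_ae_eq => //.
  - by apply: integrableS ((integrable_trace mY).2 iY).
  - exact: measurable_funTS.
  - move=> E EA mE.
    have GE : G E by rewrite -measurable_subsigmaE.
    have mE' := GP GE.
    rewrite !integral_trace//; apply/eqP; rewrite eq_le; apply/andP; split.
      by rewrite YX// YX'// leX.
    apply: le_integral => //.
    + exact: integrableS iY'.
    + exact: integrableS iY.
    + by move=> w /[!inE] /EA /ltW.
apply: filterS => w /= Aw; rewrite leNgt; apply/negP => lt.
by have := Aw lt; move: lt => /[swap] ->; rewrite ltxx.
Qed.

Lemma is_condexp_unique X Y Y' : is_condexp X Y -> is_condexp X Y' ->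
  {ae P, forall w, Y w = Y' w}.
Proof.
move=> c c'; have h := is_condexp_le c c' (fun A _ => lexx _).
have := is_condexp_le c' c (fun A _ => lexx _).
by apply: filterS2 h => w ? ?; apply/eqP; rewrite eq_le; apply/andP.
Qed.

Lemma is_condexp_aer X Y Y' : is_condexp X Y -> measurable_wrt G Y' ->
  {ae P, forall w, Y w = Y' w} -> is_condexp X Y'.
Proof.
move=> [mY iY YX] mY' YY'; split => //.
  have [mYo Yo] := integrableP _ _ _ iY; apply/integrableP; split.
    exact: measurable_wrt_fun.
  rewrite (ae_eq_integral (abse \o Y))//.
  - by apply: measurableT_comp => //; exact: measurable_wrt_fun.
  - by apply: measurableT_comp => //; exact: measurable_wrt_fun.
  - by apply: filterS YY' => w /= ->.
move=> A GA; rewrite -YX//; apply: ae_eq_integral => //.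
- exact: GP.
- exact/measurable_funTS/measurable_wrt_fun.
- exact/measurable_funTS/measurable_wrt_fun.
- by apply: filterS YY' => w ->.
Qed.

Lemma is_condexp_ael X X' Y : measurable_fun setT X -> measurable_fun setT X' ->
  {ae P, forall w, X w = X' w} -> is_condexp X Y -> is_condexp X' Y.
Proof.
move=> mX mX' XX' [mY iY YX]; split => // A GA; rewrite YX//.
apply: ae_eq_integral.
- exact: GP.
- exact: measurable_funTS.
- exact: measurable_funTS.
- by apply: filterS XX' => w ->.
Qed.

Lemma is_condexpD X X' Y Y' : P.-integrable setT X -> P.-integrable setT X' ->
  is_condexp X Y -> is_condexp X' Y' -> is_condexp (X \+ X') (Y \+ Y').
Proof.
move=> iX iX' [mY iY YX] [mY' iY' YX']; split.
- by apply/measurable_wrtP; apply: emeasurable_funD; exact/measurable_wrtP.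
- exact: integrableD.
- move=> A GA; have mA := GP GA; rewrite !integralD ?YX ?YX'//;
  exact: integrableS measurableT _ _ _.
Qed.

Lemma is_condexpN X Y : P.-integrable setT X -> is_condexp X Y ->
  is_condexp (\- X) (\- Y).
Proof.
move=> iX [mY iY YX]; split.
- by apply/measurable_wrtP; apply: measurableT_comp => //; exact/measurable_wrtP.
- exact: integrableN.
- move=> A GA; have mA := GP GA.
  rewrite !integralN ?YX//; apply: integrable_add_def => //.
    exact: (integrableS measurableT mA (@subsetT _ _) iX).
  exact: (integrableS measurableT mA (@subsetT _ _) iY).
Qed.

Lemma is_condexpB X X' Y Y' : P.-integrable setT X -> P.-integrable setT X' ->
  is_condexp X Y -> is_condexp X' Y' -> is_condexp (X \- X') (Y \- Y').
Proof.
move=> iX iX' [mY iY YX] [mY' iY' YX']; split.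
- by apply/measurable_wrtP; apply: emeasurable_funB; exact/measurable_wrtP.
- exact: integrableB.
- move=> A GA; have mA := GP GA; rewrite !integralB ?YX ?YX'//;
  exact: integrableS measurableT _ _ _.
Qed.

End conditional_expectation_theory.

(** * Pulling a bounded conditioning variable out of a conditional expectation *)

Section pull_out.
Context {d : measure_display} {Omega : measurableType d} {R : realType}.
Variable P : probability Omega R.
Local Open Scope ereal_scope.

(** [K w] is the uniform mass of [[0, K w[], and Tonelli exchanges the integrals over [w] and [t]. A
    factor with values in [0, 1] is thereby traded for the events {t < K}. *)
Lemma ge0_integral_layer_cake (A : set Omega) (X : Omega -> \bar R)
    (K : Omega -> R) : measurable A ->
  measurable_fun setT X -> (forall w, 0 <= X w) ->
  measurable_fun setT K -> (forall w, (0 <= K w <= 1)%R) ->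
  \int[P]_(w in A) ((K w)%:E * X w) =
  \int[unif01]_(t in `[0%R, +oo[)
    \int[P]_(w in A `&` [set w | (t < K w)%R]) X w.
Proof.
move=> mA mX X0 mK K01.
have K0 w : (0 <= K w)%R by have /andP[] := K01 w.
pose D := [set z : Omega * R | (0 <= z.2)%R /\ (z.2 < K z.1)%R].
have mD : measurable D.
  apply: measurableI; first exact: measurable_set_ler.
  apply: measurable_set_ltr => //.
  exact: (measurableT_comp mK (@measurable_fst _ _ _ _)).
pose f z := X z.1 * (\1_A z.1)%:E * (\1_D z)%:E.
have mXA : measurable_fun setT (fun w => X w * (\1_A w)%:E).
  by apply: emeasurable_funM => //; exact/measurable_EFinP.
have XA0 w : 0 <= X w * (\1_A w)%:E by rewrite mule_ge0// lee_fin.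
have mf : measurable_fun setT f.
  apply: emeasurable_funM; last exact/measurable_EFinP.
  exact: (measurableT_comp mXA (@measurable_fst _ _ _ _)).
have f0 z : 0 <= f z by rewrite mule_ge0// lee_fin.
transitivity (\int[P]_w \int[unif01]_t f (w, t)).
  rewrite integral_mkcond; apply: eq_integral => w _; rewrite /f/=.
  have mDw : measurable (xsection D w) by exact: measurable_xsection.
  have DE t : \1_D (w, t) = \1_(xsection D w) t :> R.
    by rewrite !indicE mem_xsection.
  have mDE : measurable_fun [set: R] (fun t => (\1_D (w, t))%:E : \bar R).
    rewrite (_ : (fun t => _) = EFin \o \1_(xsection D w)).
      exact/measurable_EFinP.
    by apply/funext => t; rewrite /= DE.
  rewrite ge0_integralZl//.
  under eq_integral do rewrite DE.
  rewrite integral_indic// setIT.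
  have -> : xsection D w = `[0%R, K w[%classic.
    by apply/seteqP; split=> t; rewrite /xsection/= inE /D/= in_itv/= => /andP.
  rewrite /= unif01_co//.
  by rewrite patchE indicE; case: (w \in A); rewrite ?mule1 ?mule0 ?mul0e// muleC.
rewrite (fubini_tonelli f)// [RHS]integral_mkcond; apply: eq_integral => t _.
rewrite patchE; case: ifPn; rewrite ?inE ?notin_setE/= in_itv/= andbT => t0.
  rewrite [RHS]integral_mkcond; apply: eq_integral => w _.
  rewrite patchE /f/= -muleA -EFinM !indicE in_setI.
  have -> : (w, t) \in D = (w \in [set w | (t < K w)%R]).
    by apply/idP/idP => /[!inE]; [case|split].
  by case: (w \in A); case: (w \in _);
    rewrite ?(mulr1, mulr0, mule1, mule0).
apply: integral0_eq => w _; rewrite /f/= [X in _ * X%:E](_ : _ = 0%R) ?mule0//.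
by rewrite indicE memNset// => -[].
Qed.

(** After the layer-cake formula only the sets [A] intersected with {t < K} remain; they belong to
    [G], where the defining identity of [Y] applies. All terms are nonnegative, so the argument
    covers an [X] of infinite integral, as parts of the weighted payoff may be. *)
Lemma is_condexp_ge0Z (G : set (set Omega)) (X Y : Omega -> \bar R)
    (K : Omega -> R) : sigma_algebra setT G -> G `<=` measurable ->
  measurable_fun setT X -> (forall w, 0 <= X w) ->
  measurable_wrt G K -> (forall w, (0 <= K w <= 1)%R) ->
  is_condexp_ge0 P G X Y ->
  is_condexp_ge0 P G (fun w => (K w)%:E * X w) (fun w => (K w)%:E * Y w).
Proof.
move=> sG GP mX X0 mK K01 [mY Y0 YX].
have K0 w : (0 <= K w)%R by have /andP[] := K01 w.
split.
- apply/(measurable_wrtP sG)/emeasurable_funM; last exact/(measurable_wrtP sG).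
  exact/measurable_EFinP/(measurable_wrtP sG).
- by move=> w; rewrite mule_ge0// lee_fin.
- move=> A GA.
  rewrite !ge0_integral_layer_cake//;
    do ?[exact: GP|exact: (measurable_wrt_fun GP)].
  apply: eq_integral => t _; apply: YX.
  suff : G [set w | (t < K w)%R].
    by rewrite -!(measurable_subsigmaE sG) in GA * => ?; exact: measurableI.
  rewrite -(measurable_subsigmaE sG); apply: measurable_set_ltr => //.
  exact/(measurable_wrtP sG).
Qed.

End pull_out.

Lemma ae_forall_count {d} {T : measurableType d} {R : realType}
    (mu : {measure set T -> \bar R}) (I : countType) (Q : I -> T -> Prop) :
  (forall i, {ae mu, forall x, Q i x}) -> {ae mu, forall x, forall i, Q i x}.
Proof.
move=> muQ.
have : {ae mu, forall x, forall n, if @unpickle I n is Some i then Q i x else True}.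
  apply/ae_foralln => n; case: unpickle => [i|]; first exact: muQ.
  exact: aeW.
by apply: filterS => x Qx i; have := Qx (pickle i); rewrite pickleK.
Qed.

Lemma lte_rat_between {R : realType} (x y : \bar R) : (x < y)%E ->
  exists2 q : rat, (x < (ratr q)%:E)%E & ((ratr q)%:E <= y)%E.
Proof.
case: x y => [x||] [y||]//; rewrite ?lte_fin => xy.
- have [q] := rat_in_itvoo xy; rewrite in_itv/= => /andP[? ?].
  by exists q; rewrite ?lte_fin ?lee_fin ?ltW.
- have [q] : exists q : rat, ratr q \in `]x, x + 1[.
    by apply: rat_in_itvoo; rewrite ltrDl.
  rewrite in_itv/= => /andP[? ?].
  by exists q; rewrite ?lte_fin ?leey.
- have [q] : exists q : rat, ratr q \in `]y - 1, y[.
    by apply: rat_in_itvoo; rewrite ltrBlDr ltrDl.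
  rewrite in_itv/= => /andP[? ?].
  by exists q; rewrite ?ltNyr ?lee_fin ?ltW.
- by exists 0; rewrite ?ltNyr ?leey.
Qed.

(** * Existence of essential infima and suprema *)

Section essential_infimum_theory.
Context {d : measure_display} {Omega : measurableType d} {R : realType}.
Variable P : probability Omega R.
Local Open Scope ereal_scope.

(* Exhaustion: a sequence whose union has the largest probability among all
   countable unions of members of the family. *)
Lemma essential_union (F : set (set Omega)) : F `<=` measurable -> F set0 ->
  exists2 A : nat -> set Omega, (forall n, F (A n)) &
    forall B, F B -> P (B `\` \bigcup_n A n) = 0.
Proof.
move=> Fm F0.
pose S := [set P (\bigcup_n A n) | A in [set A : nat -> set Omega | forall n, F (A n)]].
have S0 : S !=set0 by exists (P (\bigcup_(n : nat) set0)); exists (fun=> set0).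
have mU (A : nat -> set Omega) : (forall n, F (A n)) -> measurable (\bigcup_n A n).
  by move=> FA; apply: bigcupT_measurable => n; exact/Fm.
have S1 x : S x -> x <= 1 by move=> [A FA <-]; exact/probability_le1/mU.
have Sfin : ereal_sup S \is a fin_num.
  rewrite ge0_fin_numE; last first.
    have [x Sx] := S0; apply: (le_trans _ (ereal_sup_ubound Sx)).
    by case: Sx => A _ <-.
  by apply: (@le_lt_trans _ _ 1); [exact: ge_ereal_sup|rewrite ltry].
have /choice[A AP] : forall k : nat, exists A : nat -> set Omega,
    (forall n, F (A n)) /\ ereal_sup S - (k.+1%:R^-1)%:E < P (\bigcup_n A n).
  move=> k.
  have k0 : (0 < k.+1%:R^-1 :> R)%R by rewrite invr_gt0.
  have [x [B FB <-] xk] := ub_ereal_sup_adherent k0 Sfin.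
  by exists B.
(* One sequence listing the members of all the near-optimal sequences; its union attains the
   supremum. *)
pose B n := if unpickle n is Some (i, j) then A i j else set0.
have FB n : F (B n).
  by rewrite /B; case: unpickle => // -[i j]; have [] := AP i.
have AB k : \bigcup_n A k n `<=` \bigcup_n B n.
  by move=> w [n _ Aw]; exists (pickle (k, n)) => //; rewrite /B pickleK.
exists B => // C FC.
have supB k : ereal_sup S - (k.+1%:R^-1)%:E < P (\bigcup_n B n).
  apply: (lt_le_trans (AP k).2); apply: le_measure; rewrite ?inE; last exact: AB.
  - by apply: mU; exact: (AP k).1.
  - exact: mU.
have supBE : P (\bigcup_n B n) = ereal_sup S.
  apply/eqP; rewrite eq_le; apply/andP; split.
    by apply: ereal_sup_ubound; exists B.
  apply/lee_addgt0Pr => e e0.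
  pose k := Num.truncn e^-1.
  have ke : (k.+1%:R^-1 < e)%R.
    by rewrite -[ltRHS]invrK ltf_pV2 ?posrE ?invr_gt0// truncnS_gt.
  rewrite -leeBlDr//; apply: (le_trans _ (ltW (supB k))).
  by rewrite leeD2l// leeN2 lee_fin ltW.
(* Adding [C] to the sequence cannot raise the probability of the union above the supremum already
   attained, so [C] adds only a null set. *)
pose D n := if n is m.+1 then B m else C.
have FD n : F (D n) by case: n.
have DE : \bigcup_n D n = (\bigcup_n B n) `|` (C `\` \bigcup_n B n).
  apply/seteqP; split => [w [[|n] _ Dw]|w [[n _ Bw]|[Cw _]]].
  - by have [Bw|nBw] := pselect ((\bigcup_n B n) w); [left|right].
  - by left; exists n.
  - by exists n.+1.
  - by exists 0%N.
have mB := mU _ FB; have mC := Fm _ FC.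
have := ereal_sup_ubound (ex_intro2 _ _ D FD (erefl _) : S (P (\bigcup_n D n))).
rewrite DE measureU//; [|exact: measurableD|]; last first.
  by apply/seteqP; split => // w [Bw []].
rewrite -supBE -[leRHS]adde0 leeD2lE ?fin_num_measure// => h.
by apply/eqP; rewrite eq_le h measure_ge0.
Qed.

(** For each rational q, exhaustion applied to the events {X < q} selects countably many members of
    [S]; [Y] is the infimum of all members selected for all q. If V < Y at a point for some [V] in
    [S], a rational q with V < q <= Y puts the point in {V < q} but outside the selected events,
    which is a null set. *)
Lemma is_ess_infimum_exists (S : set (Omega -> \bar R)) :
  (forall X, S X -> measurable_fun setT X) -> exists Y, is_ess_infimum P S Y.
Proof.
move=> mS.
(* The constant [+oo] contributes the empty event that the exhaustion asks for and leaves the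
   infimum unchanged; it also covers an empty [S]. *)
pose S1 := S `|` [set cst +oo].
have mS1 X : S1 X -> measurable_fun setT X by move=> [/mS//|->].
have /choice[A AP] : forall q : rat, exists A : nat -> set Omega,
   (forall n, exists2 X, S1 X & A n = [set w | X w < (ratr q)%:E]) /\
   (forall X, S1 X -> P ([set w | X w < (ratr q)%:E] `\` \bigcup_n A n) = 0).
  move=> q.
  have [||A FA AP] := @essential_union
      [set [set w | X w < (ratr q)%:E] | X in S1].
  - move=> _ [X SX <-]; rewrite -[X in measurable X]setTI.
    by apply: emeasurable_fun_infty_o => //; exact: mS1.
  - by exists (cst +oo); [right|apply/seteqP; split].
  exists A; split => [n|X SX]; first by have [X SX <-] := FA n; exists X.
  by apply: AP; exists X.
have /choice[X XP] : forall qn : rat * nat, exists X, S1 X /\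
    A qn.1 qn.2 = [set w | X w < (ratr qn.1)%:E].
  by move=> [q n]; have [X SX AX] := (AP q).1 n; exists X.
pose Z n := if unpickle n is Some qn then X qn else cst +oo.
have SZ n : S1 (Z n).
  by rewrite /Z; case: unpickle => [qn|]; [exact: (XP qn).1|right].
pose Y w := ereal_inf (range (Z ^~ w)).
have mY : measurable_fun setT Y.
  have := @measurable_fun_einfs _ _ _ setT Z (fun n => mS1 _ (SZ n)) 0%N.
  congr measurable_fun; apply/funext => w; rewrite /Y /einfs; congr ereal_inf.
  by apply/seteqP; split => [_ [n _ <-]|_ [n _ <-]]; exists n.
exists Y; split => // [V SV|V mV VS].
- have : {ae P, forall w, forall q : rat,
      ~ ([set w | V w < (ratr q)%:E] `\` \bigcup_n A q n) w}.
    apply: ae_forall_count => q.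
    have := (AP q).2 V (or_introl SV) => V0.
    exists ([set w | V w < (ratr q)%:E] `\` \bigcup_n A q n); split => //; last first.
      by move=> w /= /contrapT.
    apply: measurableD.
      rewrite -[X in measurable X]setTI.
      by apply: emeasurable_fun_infty_o => //; exact: mS.
    apply: bigcupT_measurable => n; have [W SW ->] := (AP q).1 n.
    rewrite -[X in measurable X]setTI.
    by apply: emeasurable_fun_infty_o => //; exact: mS1.
  apply: filterS => w /= Aw; rewrite leNgt; apply/negP => VY.
  have [q Vq qY] := lte_rat_between VY.
  apply: (Aw q); split => // -[n _].
  have [_ ->]/= := XP (q, n); apply/negP; rewrite -leNgt (le_trans qY)//.
  apply: ereal_inf_lbound; exists (pickle (q, n)) => //.
  by rewrite /Z pickleK.
- have : {ae P, forall w, forall n, V w <= Z n w}.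
    apply/ae_foralln => n; case: (SZ n) => [/VS//|->].
    by apply: aeW => w; rewrite leey.
  apply: filterS => w Vw; apply: le_ereal_inf_tmp => _ [n _ <-]; exact: Vw.
Qed.

Lemma ess_infimumP (S : set (Omega -> \bar R)) :
  (forall X, S X -> measurable_fun setT X) ->
  is_ess_infimum P S (ess_infimum P S).
Proof.
move=> mS; have [Y SY] := is_ess_infimum_exists mS.
by rewrite /ess_infimum; case: xgetP => [//|/(_ Y)].
Qed.

Lemma ess_supremumP (S : set (Omega -> \bar R)) :
  (forall X, S X -> measurable_fun setT X) ->
  is_ess_supremum P S (ess_supremum P S).
Proof.
move=> mS; have [|Y [mY YS SY]] := @is_ess_infimum_exists [set X | S (fun w => - X w)].
  move=> X /mS mX; rewrite (_ : X = -%E \o (fun w => - X w)).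
    exact: measurableT_comp.
  by apply/funext => w /=; rewrite oppeK.
have : is_ess_supremum P S (fun w => - Y w).
  split; first exact: measurableT_comp.
  - move=> X SX; have : S (fun w => - (- X w)) by under eq_fun do rewrite oppeK.
    by move=> /YS; apply: filterS => w; rewrite leeNr.
  - move=> Z mZ ZS; have : {ae P, forall w, - Z w <= Y w}.
      apply: SY; first exact: measurableT_comp.
      by move=> X /ZS; apply: filterS => w; rewrite leeNl.
    by apply: filterS => w; rewrite leeNl.
by rewrite /ess_supremum; case: xgetP => [//|/(_ (fun w => - Y w))].
Qed.

End essential_infimum_theory.

Lemma limn_einf_le_cst {R : realType} (u : nat -> \bar R) (c : \bar R) :
  (forall n, u n <= c)%E -> (limn_einf u <= c)%E.
Proof.
move=> uc; rewrite limn_einf_lim; apply: lime_le; first exact: is_cvg_einfs.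
by apply: nearW => n; apply: le_trans (uc n); apply: ereal_inf_lbound; exists n => /=.
Qed.

Lemma limn_einf_ge_cst {R : realType} (u : nat -> \bar R) (c : \bar R) N :
  (forall n, (N <= n)%N -> c <= u n)%E -> (c <= limn_einf u)%E.
Proof.
move=> uc; rewrite limn_einf_lim; apply: lime_ge; first exact: is_cvg_einfs.
exists N => // n /= Nn; apply: le_ereal_inf_tmp => _ [m /= nm <-].
by apply: uc; exact: leq_trans nm.
Qed.

(** * Stopping times and uniform integrability *)

Section sigma_algebra_closure.
Context {d : measure_display} {Omega : measurableType d}.
Variables (G : set (set Omega)) (sG : sigma_algebra setT G).

Lemma sigma_algebra_set0 : G set0. Proof. by case: sG. Qed.

Lemma sigma_algebra_setT : G setT.
Proof. by rewrite -(measurable_subsigmaE sG). Qed.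

Lemma sigma_algebraC A : G A -> G (~` A).
Proof. by case: sG => _ GD _ GA; rewrite -setTD; exact: GD. Qed.

Lemma sigma_algebraI A B : G A -> G B -> G (A `&` B).
Proof. by rewrite -!(measurable_subsigmaE sG) => *; exact: measurableI. Qed.

Lemma sigma_algebraU A B : G A -> G B -> G (A `|` B).
Proof. by rewrite -!(measurable_subsigmaE sG) => *; exact: measurableU. Qed.

Lemma sigma_algebra_bigcup (A : nat -> set Omega) : (forall n, G (A n)) ->
  G (\bigcup_n A n).
Proof. by case: sG => _ _; apply. Qed.

Lemma sigma_algebra_bigcap (A : nat -> set Omega) : (forall n, G (A n)) ->
  G (\bigcap_n A n).
Proof.
move=> GA; rewrite -[\bigcap_n A n]setCK setC_bigcap; apply: sigma_algebraC.
by apply: sigma_algebra_bigcup => n; exact: sigma_algebraC.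
Qed.

End sigma_algebra_closure.

Lemma measurable_wrt_ae {d d'} {Omega : measurableType d} {U : measurableType d'}
    {R : realType} (P : probability Omega R) (G : set (set Omega))
    (X Y : Omega -> U) :
  sigma_algebra setT G -> P.-negligible `<=` G ->
  measurable_wrt G X -> {ae P, forall w, X w = Y w} -> measurable_wrt G Y.
Proof.
move=> sG GP mX XY B mB.
pose N := ~` [set w | X w = Y w].
have NB C : C `<=` N -> G C by move=> CN; apply: GP; exact: negligibleS XY.
have -> : Y @^-1` B = ((X @^-1` B) `&` ~` N) `|` ((Y @^-1` B) `&` N).
  apply/seteqP; split => w /=.
    by move=> YB; have [wN|/contrapT XYw] := pselect (N w);
      [right|left; split; rewrite ?XYw//= => /(_ XYw)].
  by rewrite /N/= => -[[XB /contrapT <-]|[]].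
apply: sigma_algebraU => //; last by apply: NB => w [].
by apply: sigma_algebraI => //; [exact: mX|apply: sigma_algebraC => //; exact: NB].
Qed.

Section stopping_time_theory.
Context {d : measure_display} {Omega : measurableType d} {R : realType}.
Variables (P : probability Omega R) (T : R).
Variable G : R -> set (set Omega).
Hypothesis fG : filtration P T G.
Implicit Types (s t : R) (theta : Omega -> R).

Let sG t : 0 <= t <= T -> sigma_algebra setT (G t).
Proof. by move=> tT; case: fG => /(_ t tT)[]. Qed.

Lemma filtration_sigma_algebra t : 0 <= t <= T -> sigma_algebra setT (G t).
Proof. exact: sG. Qed.

Lemma filtration_measurable t : 0 <= t <= T -> G t `<=` measurable.
Proof. by move=> tT; case: fG => /(_ t tT)[]. Qed.

Lemma filtration_le s t : 0 <= s -> s <= t -> t <= T -> G s `<=` G t.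
Proof. by case: fG => _ + _ _; exact. Qed.

Lemma filtration_right_continuous t A : 0 <= t < T ->
  (forall s, t < s -> s <= T -> G s A) -> G t A.
Proof.
case: fG => _ _ + _ => /(_ t) + tT => /(_ tT) rc GA; apply: rc => s/=.
by rewrite in_itv/= => /andP[]; exact: GA.
Qed.

Lemma filtration_negligible t : 0 <= t <= T -> P.-negligible `<=` G t.
Proof. by case: fG => _ _ _ +; exact. Qed.

Lemma stopping_time_cst s : 0 <= s <= T -> stopping_time T G (cst s).
Proof.
move=> sT; split => // t tT /=; have [st|st] := leP s t.
  by rewrite (_ : [set _ | _] = setT)//; [exact: sigma_algebra_setT (sG tT)|exact/seteqP].
rewrite (_ : [set _ | _] = set0); first exact: sigma_algebra_set0 (sG tT).
by apply/seteqP; split.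
Qed.

Lemma sigma_at_cst s : 0 <= s <= T -> sigma_at T G (cst s) = G s.
Proof.
move=> /andP[s0 sT]; apply/seteqP; split => A /=.
  move=> /(_ s); rewrite s0 sT => /(_ isT).
  by rewrite (_ : [set _ | _] = setT) ?setIT//; apply/seteqP; split => w/=.
move=> GA t /andP[t0 tT]; have [st|ts] := leP s t.
  rewrite (_ : [set _ | _] = setT) ?setIT; first exact: filtration_le GA.
  by apply/seteqP; split => w/=.
rewrite (_ : [set _ | _] = set0) ?setI0; last by apply/seteqP; split.
have tT' : 0 <= t <= T by apply/andP.
exact: sigma_algebra_set0 (sG tT').
Qed.

Section one_stopping_time.
Variable theta : Omega -> R.
Hypothesis st : stopping_time T G theta.

Let thetaT w : 0 <= theta w <= T. Proof. by case: st. Qed.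

Lemma sigma_at_sigma_algebra : sigma_algebra setT (sigma_at T G theta).
Proof.
split.
- by move=> t tT; rewrite set0I; exact: sigma_algebra_set0 (sG tT).
- move=> A GA t tT; rewrite setTD.
  rewrite (_ : _ `&` _ = [set w | theta w <= t] `&` ~` (A `&` [set w | theta w <= t])).
    apply: sigma_algebraI; [exact: sG|exact: st.2|].
    by apply: sigma_algebraC; [exact: sG|exact: GA].
  apply/seteqP; split => w/=; first by move=> [nA tw]; split => // -[].
  by move=> [tw nA]; split => // Aw; exact: nA.
- move=> A GA t tT; rewrite setI_bigcupl.
  by apply: sigma_algebra_bigcup => [|n]; [exact: sG|exact: GA].
Qed.

Lemma sigma_at_top A : 0 <= T -> sigma_at T G theta A -> G T A.
Proof.
move=> T0 /(_ T); rewrite T0 lexx => /(_ isT).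
rewrite (_ : [set _ | _] = setT) ?setIT//; apply/seteqP; split => w //= _.
by have /andP[] := thetaT w.
Qed.

Lemma sigma_at_measurable : 0 <= T -> sigma_at T G theta `<=` measurable.
Proof.
by move=> T0 A /(sigma_at_top T0); apply: filtration_measurable; rewrite T0 lexx.
Qed.

Lemma sigma_at_negligible : P.-negligible `<=` sigma_at T G theta.
Proof.
move=> A nA t tT; apply: (filtration_negligible tT).
by apply: negligibleS nA => w [].
Qed.

Lemma stopping_time_le t : 0 <= t -> t <= T -> G t [set w | theta w <= t].
Proof. by move=> t0 tT; apply: st.2; rewrite t0. Qed.

Lemma stopping_time_lt t : 0 <= t -> t <= T -> G t [set w | theta w < t].
Proof.
move=> t0 tT; have gt : 0 <= t <= T by rewrite t0.
have -> : [set w | theta w < t] =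
    \bigcup_n ([set w | theta w <= t - n.+1%:R^-1]).
  apply/seteqP; split => w /=.
    rewrite -subr_gt0 => tw.
    exists (Num.truncn (t - theta w)^-1) => //=.
    rewrite lerBrDr -lerBrDl -[leRHS]invrK lef_pV2 ?posrE ?invr_gt0//.
    by rewrite ltW// truncnS_gt.
  by move=> [n _ /=] /le_lt_trans; apply; rewrite ltrBlDr ltrDl.
apply: sigma_algebra_bigcup => [|n]; first exact: sG.
have [tn|tn] := leP 0 (t - n.+1%:R^-1).
  apply: (@filtration_le (t - n.+1%:R^-1)) => //.
    by rewrite lerBlDr lerDl.
  by apply: st.2; rewrite tn/= (le_trans _ tT)// lerBlDr lerDl.
rewrite (_ : [set _ | _] = set0); first exact: sigma_algebra_set0 (sG gt).
apply/seteqP; split => w //= /le_lt_trans/(_ tn).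
by rewrite ltNge; have /andP[->] := thetaT w.
Qed.

Lemma measurable_stopping_time : measurable_fun setT theta.
Proof.
move=> mT; apply: (measurability _ (RGenOInfty.measurableE R)) => //.
move=> _ [_ [x ->] <-]; rewrite setTI.
rewrite (_ : _ @^-1` _ = ~` [set w | theta w <= x]); last first.
  by apply/seteqP; split => w/=; rewrite in_itv/= andbT ltNge => /negP.
apply: measurableC; have [x0|x0] := leP 0 x; last first.
  rewrite (_ : [set _ | _] = set0)//; apply/seteqP; split => w//= /le_lt_trans.
  by move=> /(_ _ x0); rewrite ltNge; have /andP[->] := thetaT w.
have [xT|xT] := leP x T.
  by apply: (@filtration_measurable x); [rewrite x0|exact: stopping_time_le].
rewrite (_ : [set _ | _] = setT)//; apply/seteqP; split => w//= _.
by have /andP[_ /le_trans] := thetaT w; apply; exact: ltW.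
Qed.

End one_stopping_time.

(** Since the order is only almost sure, {theta2 <= t < theta1} may be nonempty; it is negligible,
    hence so are its subsets, and [G t] contains them. *)
Lemma sigma_at_le theta1 theta2 : stopping_time T G theta1 ->
  stopping_time T G theta2 -> {ae P, forall w, theta1 w <= theta2 w} ->
  sigma_at T G theta1 `<=` sigma_at T G theta2.
Proof.
move=> st1 st2 le12 A GA t tT.
pose B := [set w | theta2 w <= t]; pose C := [set w | theta1 w <= t].
have -> : A `&` B = (A `&` C `&` B) `|` (A `&` B `&` ~` C).
  apply/seteqP; split => w /=.
    by move=> [Aw Bw]; have [Cw|Cw] := pselect (C w); [left|right].
  by move=> [[[]]|[[]]].
apply: sigma_algebraU; first exact: sG.
  by apply: sigma_algebraI; [exact: sG|exact: GA|exact: st2.2].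
apply: (filtration_negligible tT); apply: negligibleS le12 => w/=.
rewrite /B /C/= => -[[_ Bw] nC le]; apply: nC; exact: le_trans Bw.
Qed.

End stopping_time_theory.

(** * Uniform integrability of the conditional expectations of one variable *)

Section uniform_integrability.
Context {d : measure_display} {Omega : measurableType d} {R : realType}.
Variables (P : probability Omega R) (X : Omega -> R).
Hypothesis iX : P.-integrable setT (EFin \o X).
Local Open Scope ereal_scope.

Let mX : measurable_fun setT X.
Proof. by apply/measurable_EFinP; exact: measurable_int iX. Qed.

Let C := fine (\int[P]_w `|X w|%:E).

Let CE : \int[P]_w `|X w|%:E = C%:E.
Proof. by rewrite fineK// integrable_fin_num//; exact: integrable_norm. Qed.

Let C0 : (0 <= C)%R.
Proof. by rewrite -lee_fin -CE integral_ge0. Qed.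

(* The pieces [{Y > c}] and [{Y < -c}] are conditioning events, so that
   [Y] may be replaced by [X] on them. *)
Lemma is_condexp_tail (G : set (set Omega)) (Y : Omega -> \bar R) (c : R) :
  sigma_algebra setT G -> G `<=` measurable -> is_condexp P G (EFin \o X) Y ->
  (0 <= c)%R ->
  \int[P]_(w in [set w | c%:E < `|Y w|]) `|Y w| <=
  \int[P]_(w in [set w | c%:E < `|Y w|]) `|X w|%:E.
Proof.
move=> sG GP [mY iY YX] c0.
have mYT : measurable_fun setT Y by exact: measurable_wrt_fun mY.
pose A := [set w | c%:E < Y w]; pose B := [set w | Y w < (- c)%:E].
have GA : G A.
  rewrite /A (_ : [set w | _] = Y @^-1` `]c%:E, +oo]); first exact/mY/emeasurable_itv.
  by apply/seteqP; split => w/=; rewrite in_itv/= leey andbT.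
have GB : G B.
  rewrite /B (_ : [set w | _] = Y @^-1` `[-oo, (-c)%:E[); first exact/mY/emeasurable_itv.
  by apply/seteqP; split => w/=; rewrite in_itv/= leNye.
have mA := GP _ GA; have mB := GP _ GB.
have AB : [disjoint A & B].
  apply/disj_setPS => w [/=]; rewrite /A/B/= => Aw /(lt_trans Aw).
  by rewrite lte_fin ltNge ge0_cp.
have -> : [set w | c%:E < `|Y w|] = A `|` B.
  apply/seteqP; split => w /=; rewrite /A /B/=; case: (Y w) => [r||]//=;
    rewrite ?ltry ?ltNyr ?lte_fin ?ltNyr.
  - by rewrite lter_normr (ltrNr c) => /orP[]; [left|right].
  - by left.
  - by right.
  - by rewrite lter_normr (ltrNr c) => -[->//|->]; rewrite orbT.
  - by [].
  - by [].
rewrite !ge0_integral_setU//=; last 2 first.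
- by apply: measurable_funTS; do 2 apply: measurableT_comp => //.
- by apply: measurable_funTS; exact: measurableT_comp.
have iXA D : measurable D -> P.-integrable D (EFin \o X).
  by move=> mD; exact: integrableS iX.
have iXn D : measurable D -> P.-integrable D (fun w => `|X w|%:E).
  by move=> mD; apply: integrable_norm; exact: iXA.
apply: leeD.
  rewrite (eq_integral Y); last first.
    move=> w /[!inE]; rewrite /A/= => cY; rewrite gee0_abs//.
    by rewrite (le_trans _ (ltW cY))// lee_fin.
  rewrite YX//; apply: le_integral => //; [exact: iXA|exact: iXn|].
  by move=> w _; rewrite lee_fin ler_norm.
rewrite (eq_integral (\- Y)); last first.
  move=> w /[!inE]; rewrite /B/= => cY; rewrite lee0_abs//.
  by rewrite (le_trans (ltW cY))// lee_fin oppr_le0.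
rewrite integralN; last first.
  by apply: integrable_add_def => //; exact: integrableS iY.
rewrite YX// -integralN; last first.
  by apply: integrable_add_def => //; exact: iXA.
apply: le_integral => //; [exact/integrableN/iXA|exact: iXn|].
by move=> w _; rewrite lee_fin -normrN ler_norm.
Qed.

Lemma is_condexp_le_norm (G : set (set Omega)) (Y : Omega -> \bar R) :
  sigma_algebra setT G -> G `<=` measurable -> is_condexp P G (EFin \o X) Y ->
  \int[P]_w `|Y w| <= \int[P]_w `|X w|%:E.
Proof.
move=> sG GP cY; have [mY iY YX] := cY.
have mYT : measurable_fun setT Y by exact: measurable_wrt_fun mY.
have -> : \int[P]_w `|Y w| = \int[P]_(w in [set w | 0%:E < `|Y w|]) `|Y w|.
  rewrite [RHS]integral_mkcond; apply: eq_integral => w _.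
  rewrite patchE; case: ifPn => //; rewrite notin_setE/= => /negP.
  by rewrite -leNgt => Y0; apply/eqP; rewrite eq_le Y0 abse_ge0.
apply: (le_trans (is_condexp_tail sG GP cY _)) => //.
apply: ge0_subset_integral => //.
- rewrite -[X in measurable X]setTI; apply: emeasurable_fun_o_infty => //.
  exact: measurableT_comp.
- by apply/measurable_EFinP; exact: measurableT_comp.
Qed.

(** The threshold is chosen before [G] and [Y]: it serves all conditional expectations of [X] at
    once, which is their uniform integrability. *)
Lemma is_condexp_class_D (e : R) : (0 < e)%R -> exists2 c : R, (0 <= c)%R &
  forall (G : set (set Omega)) (Y : Omega -> \bar R),
  sigma_algebra setT G -> G `<=` measurable -> is_condexp P G (EFin \o X) Y ->
  \int[P]_(w in [set w | c%:E < `|Y w|]) `|Y w| <= e%:E.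
Proof.
move=> e0; have [r [r0 re]] := integral_normr_continuous iX e0.
(* Markov's inequality bounds P(|Y| > c) by C / c, which is below [r] because c r = C + r; absolute
   continuity of the integral of |X| then applies. *)
exists (C / r + 1)%R; first by rewrite addr_ge0// divr_ge0// ltW.
set c := (C / r + 1)%R => G Y sG GP cY.
have c0 : (0 < c)%R by rewrite ltr_wpDl// divr_ge0// ltW.
have [mY iY YX] := cY.
have mYT : measurable_fun setT Y by exact: measurable_wrt_fun mY.
pose A := [set w | c%:E < `|Y w|].
have mA : measurable A.
  rewrite -[A]setTI; apply: emeasurable_fun_o_infty => //.
  exact: measurableT_comp.
have YC : \int[P]_w `|Y w| <= C%:E by rewrite -CE; exact: is_condexp_le_norm cY.
have PA : P A < r%:E.
  have : c%:E * P A <= C%:E.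
    apply: le_trans YC; rewrite -integral_cst//.
    apply: (@le_trans _ _ (\int[P]_(w in A) `|Y w|)).
      apply: ge0_le_integral => //.
      - by move=> w _; rewrite lee_fin ltW.
      - by apply: measurable_funTS; exact: measurableT_comp.
      - by move=> w /ltW.
    by apply: ge0_subset_integral => //; exact: measurableT_comp.
  have PAf : P A = (fine (P A))%:E by rewrite fineK// fin_num_measure.
  rewrite PAf -EFinM !lee_fin lte_fin => cP; rewrite ltNge; apply/negP => rP.
  have : (c * r <= C)%R by apply: le_trans cP; rewrite ler_pM2l.
  by rewrite /c mulrDl divfK ?gt_eqF// mul1r leNgt ltrDl r0.
apply: (le_trans (is_condexp_tail sG GP cY (ltW c0))).
have := re A mA PA; rewrite /Rintegral -lte_fin fineK; first exact: ltW.
apply: integrable_fin_num => //; apply: integrable_norm.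
exact: integrableS iX.
Qed.

(** Being conditional expectations of one [X], the [Y n] are uniformly integrable, so almost sure
    convergence improves to L1 estimates and the integrals over a set of [H] pass to the limit.
    These estimates come from clamping to [-c, c]: the clamped parts converge by dominated
    convergence, while the excess is small uniformly in n, and for [Z] by Fatou. The intended [G n]
    are the sigma-algebras of dyadic approximations of a stopping time. *)
Lemma is_condexp_cvg (G : nat -> set (set Omega)) (H : set (set Omega))
    (Y : nat -> Omega -> R) (Z : Omega -> R) :
  (forall n, sigma_algebra setT (G n)) -> (forall n, G n `<=` measurable) ->
  (forall n, is_condexp P (G n) (EFin \o X) (EFin \o Y n)) ->
  (forall n, H `<=` G n) -> measurable_wrt H Z -> H `<=` measurable ->
  {ae P, forall w, Y ^~ w @ \oo --> Z w} ->
  is_condexp P H (EFin \o X) (EFin \o Z).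
Proof.
move=> sG GP YX HG mZ Hm YZ.
have mZT : measurable_fun setT Z by exact: measurable_wrt_fun mZ.
have mY n : measurable_fun setT (Y n).
  by apply/measurable_EFinP; case: (YX n) => + _ _; exact: measurable_wrt_fun.
have iY n : P.-integrable setT (EFin \o Y n) by case: (YX n).
(* truncation at level [c] *)
pose phi (c x : R) : R := ((`|x + c| - `|x - c|) / 2)%R.
have phiE (c x : R) : (0 <= c)%R ->
    (`|x - phi c x| <= if (c < `|x|)%R then `|x| else 0)%R.
  move=> c0; rewrite /phi; case: ifPn; rewrite -?leNgt => cx.
    have [x0|x0] := leP 0%R x.
      move: cx; rewrite (ger0_norm x0) => cx.
      rewrite (@ger0_norm _ (x + c)) ?(@ger0_norm _ (x - c)); [|lra..].
      by rewrite ger0_norm; lra.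
    move: cx; rewrite (ltr0_norm x0) => cx.
    rewrite (@ler0_norm _ (x + c)) ?(@ler0_norm _ (x - c)); [|lra..].
    by rewrite ler0_norm; lra.
  move: cx; rewrite ler_norml => /andP[cx xc].
  rewrite (@ger0_norm _ (x + c)) ?(@ler0_norm _ (x - c)); [|lra..].
  by rewrite normr_le0; apply/eqP; lra.
have phile (c x : R) : (0 <= c)%R -> (`|phi c x| <= c)%R.
  move=> c0; rewrite /phi normrM (@ger0_norm _ 2^-1)//.
  rewrite ler_pdivrMr// (le_trans (ler_dist_dist _ _))//.
  by rewrite [X in `|X|%R](_ : _ = c * 2)%R ?ger0_norm//; lra.
have phicvg c (u : nat -> R) (l : R) : u @ \oo --> l ->
    (fun n => phi c (u n)) @ \oo --> phi c l.
  move=> ul; apply: cvgMl; apply: cvgB; apply: cvg_norm.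
    by apply: cvgD => //; exact: cvg_cst.
  by apply: cvgB => //; exact: cvg_cst.
have mphi c (u : Omega -> R) : measurable_fun setT u ->
    measurable_fun setT (phi c \o u).
  move=> mu; apply: measurable_funM => //; apply: measurable_funB;
    apply: measurableT_comp => //; [exact: measurable_funD|exact: measurable_funB].
have tail (e : R) : (0 < e)%R -> exists2 c : R, (0 <= c)%R & forall n,
    \int[P]_w `|Y n w - phi c (Y n w)|%:E <= e%:E.
  move=> e0; have [c c0 cP] := is_condexp_class_D e0; exists c => // n.
  apply: le_trans (cP _ _ (sG n) (@GP n) (YX n)).
  rewrite [leRHS]integral_mkcond; apply: ge0_le_integral => //.
  - apply/measurable_EFinP/measurableT_comp => //; apply: measurable_funB => //.
    exact: mphi.
  - have mE : measurable [set w | c%:E < `|(EFin \o Y n) w|].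
      rewrite -[X in measurable X]setTI; apply: emeasurable_fun_o_infty => //.
      by do 2 apply: measurableT_comp => //.
    apply: (measurable_restrictT _ mE).1.
    by apply: measurable_funTS; do 2 apply: measurableT_comp => //.
  - move=> w _; rewrite patchE; have := phiE c (Y n w) c0.
    by case: ifPn => [h|h]; [rewrite mem_set|rewrite memNset//=; exact/negP].
have mD (u v : Omega -> R) : measurable_fun setT u -> measurable_fun setT v ->
    measurable_fun setT (fun w => `|u w - v w|%:E).
  by move=> mu mv; apply/measurable_EFinP/measurableT_comp => //;
    exact: measurable_funB.
have L1 (e : R) : (0 < e)%R -> exists n,
    \int[P]_w `|Y n w - Z w|%:E <= e%:E.
  move=> e0; have e3 : (0 < e / 3)%R by rewrite divr_gt0.
  have [c c0 cP] := tail _ e3.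
  have cZ : \int[P]_w `|Z w - phi c (Z w)|%:E <= (e / 3)%:E.
    rewrite (ae_eq_integral
      (fun w => limn_einf (fun n => `|Y n w - phi c (Y n w)|%:E)))//.
    - apply: (le_trans (fatou _ _ _ _)) => //.
      + by move=> n; apply: mD => //; exact: mphi.
      + exact: limn_einf_le_cst.
    - by apply: mD => //; exact: mphi.
    - rewrite (_ : (fun w => _) = (fun w => - limn_esup
          (fun n => - `|Y n w - phi c (Y n w)|%:E))); last first.
        by apply/funext => w; rewrite limn_esupN oppeK.
      apply: measurableT_comp => //; apply: measurable_fun_limn_esup => n.
      by apply: measurableT_comp => //; apply: mD => //; exact: mphi.
    - apply: filterS YZ => w Yw _; apply/esym.
      suff /cvg_limn_einf_sup[] : (fun n => `|Y n w - phi c (Y n w)|%:E) @ \oo -->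
        `|Z w - phi c (Z w)|%:E by [].
      apply: cvg_EFin; first exact: nearW.
      by apply: cvg_norm; apply: cvgB => //; exact: phicvg.
  have [|||||_ dom _] := @dominated_convergence _ _ _ P setT measurableT
    (fun n w => (phi c (Y n w))%:E) (fun w => (phi c (Z w))%:E) (cst c%:E).
  - by move=> n; apply/measurable_EFinP; exact: mphi.
  - by apply/measurable_EFinP; exact: mphi.
  - apply: filterS YZ => w Yw _; apply: cvg_EFin; first exact: nearW.
    exact: phicvg.
  - exact: finite_measure_integrable_cst.
  - by apply: aeW => w n _; rewrite lee_fin phile.
  have [n Pn] : exists n, \int[P]_w `|phi c (Y n w) - phi c (Z w)|%:E <= (e / 3)%:E.
    apply: contrapT => /forallNP nP.
    have : (e / 3)%:E <= 0.
      rewrite -(cvg_lim _ dom)//; apply: lime_ge; first exact: cvgP dom.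
      by apply: nearW => n; have /negP := nP n; rewrite -ltNge => /ltW.
    by rewrite lee_fin leNgt e3.
  exists n; apply: (@le_trans _ _ (\int[P]_w (`|Y n w - phi c (Y n w)|%:E +
     `|phi c (Y n w) - phi c (Z w)|%:E + `|Z w - phi c (Z w)|%:E))).
    apply: ge0_le_integral => //; first exact: mD.
      by apply: emeasurable_funD; [apply: emeasurable_funD|];
        apply: mD => //; exact: mphi.
    move=> w _; rewrite -!EFinD lee_fin.
    rewrite [in leRHS](distrC (Z w)) (_ : Y n w - Z w = Y n w - phi c (Y n w) +
      (phi c (Y n w) - phi c (Z w)) + (phi c (Z w) - Z w))%R; last by ring.
    by rewrite (le_trans (ler_normD _ _))// lerD2r ler_normD.
  rewrite ge0_integralD//; last 3 first.
  - by move=> w _; rewrite -EFinD lee_fin addr_ge0.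
  - by apply: emeasurable_funD; apply: mD => //; exact: mphi.
  - by apply: mD => //; exact: mphi.
  rewrite ge0_integralD//; last 2 first.
  - by apply: mD => //; exact: mphi.
  - by apply: mD => //; exact: mphi.
  rewrite (_ : e = e / 3 + e / 3 + e / 3)%R; last by field.
  by rewrite !EFinD; apply: leeD => //; apply: leeD.
have iZ : P.-integrable setT (EFin \o Z).
  have [n Yn] := L1 1%R ltr01.
  apply/integrableP; split; first exact/measurable_EFinP.
  apply: (@le_lt_trans _ _ (\int[P]_w (`|Y n w|%:E + `|Y n w - Z w|%:E))).
    apply: ge0_le_integral => //.
    - by apply: measurableT_comp => //; exact/measurable_EFinP.
    - apply: emeasurable_funD; last exact: mD.
      by apply/measurable_EFinP; exact: measurableT_comp.
    - move=> w _; rewrite -EFinD lee_fin.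
      by rewrite -lerBlDl (le_trans (lerB_dist _ _))// distrC.
  rewrite ge0_integralD//; last 2 first.
  - by apply/measurable_EFinP; exact: measurableT_comp.
  - exact: mD.
  apply: lte_add_pinfty; last by rewrite (le_lt_trans Yn)// ltry.
  by have /integrableP[_] := iY n.
split => // [|A HA].
  move=> B mB; rewrite comp_preimage; apply: mZ.
  by rewrite -[X in measurable X]setTI; exact: EFin_measurable.
have mA := Hm _ HA.
have iXA := integrableS measurableT mA (@subsetT _ A) iX.
have iZA := integrableS measurableT mA (@subsetT _ A) iZ.
rewrite -[LHS]fineK ?integrable_fin_num// -[RHS]fineK ?integrable_fin_num//.
congr EFin; apply/eqP; rewrite -subr_eq0 -normr_le0; apply/ler_addgt0Pr => e e0.
rewrite add0r; have [n Yn] := L1 e e0.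
have [_ _ <-] := YX n; last exact: HG.
have iYA := integrableS measurableT mA (@subsetT _ A) (iY n).
rewrite -lee_fin; apply: le_trans Yn; rewrite -fineB ?integrable_fin_num//.
rewrite -integralB//.
have iZY : P.-integrable A ((EFin \o Z) \- (EFin \o Y n)) by exact: integrableB.
have -> (x : \bar R) : x \is a fin_num -> (`|fine x|%R)%:E = `|x| by case: x.
  apply: (le_trans (le_abse_integral _ _ _)) => //; first exact: measurable_int iZY.
  apply: (@le_trans _ _ (\int[P]_(w in A) `|Y n w - Z w|%:E)).
    apply: ge0_le_integral => //.
    - by apply: measurableT_comp => //; exact: measurable_int iZY.
    - by apply: measurable_funTS; exact: mD.
    - by move=> w _; rewrite /= distrC.
  by apply: ge0_subset_integral => //; exact: mD.
exact: integrable_fin_num.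
Qed.

End uniform_integrability.

(** * Cadlag versions of closed martingales *)

Section upcrossing.
Context {d : measure_display} {Omega : measurableType d} {R : realType}.
Variables (P : probability Omega R) (H : nat -> set (set Omega)).
Variables (y : nat -> Omega -> R) (a b : R).
Hypotheses (sH : forall n, sigma_algebra setT (H n))
  (Hm : forall n, H n `<=` measurable) (Hle : forall n, H n `<=` H n.+1)
  (my : forall n, measurable_wrt (H n) (y n))
  (iy : forall n, P.-integrable setT (EFin \o y n))
  (martingale_y : forall n A, H n A ->
    (\int[P]_(w in A) (y n.+1 w)%:E = \int[P]_(w in A) (y n w)%:E)%E).
Hypothesis ab : a < b.

(* Buy below a, sell above b; the position is open at the beginning, so that
   an excursion above b from the start counts as a crossing. *)
Fixpoint invested n : set Omega :=
  if n is m.+1 then [set w | y m w < a] `|` (invested m `&` [set w | y m w <= b])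
  else setT.

Fixpoint crossings n (w : Omega) : nat :=
  if n is m.+1 then (crossings m w + (w \in invested m `&` [set w | (b < y m w)%R]))%N
  else 0%N.

Lemma crossings_homo w : {homo crossings^~ w : n m / (n <= m)%N}.
Proof.
move=> n m /subnK <-; elim: (m - n)%N => // k /leq_trans; apply.
by rewrite addSn /= leq_addr.
Qed.

(** Either the position open at time m has been closed before time j, which counted a crossing, or
    it is still open and closes at j. The sale at time j enters the count at [j.+1]. *)
Lemma crossings_hit m j w : invested m w -> (m <= j)%N -> b < y j w ->
  (crossings m w < crossings j.+1 w)%N.
Proof.
move=> Im mj by_.
have : (crossings m w < crossings j w)%N \/ invested j w.
  move: mj => /subnK <-; elim: (j - m)%N => [|k IH]; first by right.
  rewrite addSn; case: IH => [IH|IH].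
    by left; apply: (leq_trans IH); exact: crossings_homo.
  have [yb|yb] := leP (y (k + m)%N w) b; first by right; right.
  left; rewrite /= mem_set ?addn1 ?ltnS; last by split.
  by apply: crossings_homo; rewrite leq_addl.
move=> [lt|Ij]; first by apply: (leq_trans lt); exact: crossings_homo.
by rewrite /= mem_set ?addn1 ?ltnS; [exact: crossings_homo|split].
Qed.

Let mlt n c : H n [set w | y n w < c].
Proof.
rewrite (_ : [set w | _] = y n @^-1` `]-oo, c[); first exact: my.
by apply/seteqP; split => w/=; rewrite in_itv.
Qed.

Let mle n c : H n [set w | y n w <= c].
Proof.
rewrite (_ : [set w | _] = y n @^-1` `]-oo, c]); first exact: my.
by apply/seteqP; split => w/=; rewrite in_itv.
Qed.

Lemma invested_measurable n : H n (invested n.+1).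
Proof.
elim: n => [|n IH].
  by apply: sigma_algebraU => //; apply: sigma_algebraI => //; exact: sigma_algebra_setT.
apply: sigma_algebraU => //; apply: sigma_algebraI => //.
by apply: Hle; exact: IH.
Qed.

Let minv n : measurable (invested n).
Proof.
by case: n => [|n]; [exact: measurableT|apply: Hm (invested_measurable n)].
Qed.

Let myT n : measurable_fun setT (y n).
Proof. by apply: measurable_wrt_fun (my n). Qed.

Let iyA n A : measurable A -> P.-integrable A (fun w => (y n w)%:E).
Proof. by move=> mA; exact: (integrableS measurableT mA (@subsetT _ _) (iy n)). Qed.

Let icst r A : measurable A -> P.-integrable A (fun=> r%:E).
Proof. by move=> mA; exact: finite_measure_integrable_cst. Qed.

Let iya r m : P.-integrable setT (fun w => (`|y m w| + r)%:E).
Proof.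
under eq_fun do rewrite EFinD; apply: integrableD => //; last exact: icst.
by apply: integrable_norm; exact: iy.
Qed.

Let iyB r m : P.-integrable setT (fun w => (y m w - r)%:E).
Proof.
by under eq_fun do rewrite EFinB; apply: integrableB => //; [exact: iyA|exact: icst].
Qed.

Let crossingsS n w : (crossings n.+1 w)%:R =
  (crossings n w)%:R + \1_(invested n `&` [set w | b < y n w]) w :> R.
Proof. by rewrite /= natrD indicE. Qed.

Lemma measurable_crossings n : measurable_fun setT (fun w => (crossings n w)%:R : R).
Proof.
elim: n => [|n IH]; first exact: measurable_cst.
under eq_fun do rewrite crossingsS.
apply: measurable_funD => //; apply: measurable_indic; apply: measurableI => //.
exact: measurable_set_ltr (measurable_cst _) _.
Qed.

Let c n w : R := (crossings n w)%:R.

Let ic n : P.-integrable setT (EFin \o c n).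
Proof.
apply: (le_integrable measurableT (g := cst n%:R%:E)).
- by apply/measurable_EFinP; exact: measurable_crossings.
- move=> w _; rewrite /= lee_fin !ger0_norm// /c ler_nat.
  elim: n => //= n IH; apply: (leq_trans (leq_add IH (leq_b1 _))).
  by rewrite addn1.
- exact: finite_measure_integrable_cst.
Qed.

(** Unrealised gain relative to the level [a]. The price index m and the position index n advance in
    turn: the price step preserves the expectation, and the position step is controlled pathwise. *)
Let gain n m w : R := \1_(invested n) w * (y m w - a).

Let igain n m : P.-integrable setT (EFin \o gain n m).
Proof.
apply: (le_integrable measurableT (g := fun w => (`|y m w| + `|a|)%:E)).
- apply/measurable_EFinP; apply: measurable_funM.
    by apply: measurable_indic; exact: minv.
  exact: measurable_funB.
- move=> w _; rewrite /= lee_fin normrM ger0_norm//.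
  rewrite [leRHS]ger0_norm ?addr_ge0// indicE.
  by case: (_ \in _); rewrite ?mul1r ?mul0r ?addr_ge0// ler_normB.
- exact: iya.
Qed.

Let gain_step n : (\int[P]_w (gain n.+1 n.+1 w)%:E = \int[P]_w (gain n.+1 n w)%:E)%E.
Proof.
have gE m : (\int[P]_w (gain n.+1 m w)%:E =
    \int[P]_(w in invested n.+1) (y m w)%:E - \int[P]_(w in invested n.+1) a%:E)%E.
  have mI := minv n.+1.
  rewrite -integralB//; [|exact: iyA|exact: icst].
  rewrite [RHS]integral_mkcond; apply: eq_integral => w _.
  rewrite patchE /gain indicE; case: (w \in _); rewrite ?mul1r ?mul0r//.
by rewrite !gE martingale_y//; exact: invested_measurable.
Qed.

(** A sale above [b] gives up a gain of at least b - a and records one crossing; a purchase below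
    [a] adds a negative gain. Crediting each crossing with b - a therefore never increases the
    total. *)
Let crossing_gain n w :
  (b - a) * c n.+1 w + gain n.+1 n w <= (b - a) * c n w + gain n n w.
Proof.
rewrite /c crossingsS /gain !indicE mulrDr -addrA lerD2l in_setI/= in_setU in_setI.
have [ya|ya] := ltP (y n w) a.
  rewrite [w \in [set w | b < y n w]]memNset/= ?andbF; last first.
    by apply/negP; rewrite -leNgt (le_trans (ltW ya))// ltW.
  rewrite [w \in [set w | y n w < a]]mem_set// mul1r mulr0 add0r.
  case: (w \in invested n); rewrite ?mul1r ?mul0r//.
  by rewrite subr_le0 ltW.
rewrite [w \in [set w | y n w < a]]memNset/=; last by apply/negP; rewrite -leNgt.
have [yb|yb] := leP (y n w) b.
  rewrite [w \in [set w | y n w <= b]]mem_set// andbT.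
  rewrite [w \in [set w | b < y n w]]memNset/= ?andbF; last first.
    by apply/negP; rewrite -leNgt.
  by rewrite mulr0 add0r.
rewrite [w \in [set w | y n w <= b]]memNset/= ?andbF; last first.
  by apply/negP; rewrite -ltNge.
rewrite [w \in [set w | b < y n w]]mem_set//= andbT mul0r addr0.
case: (w \in invested n); rewrite ?mul1r ?mul0r ?mulr1 ?mulr0//.
by rewrite lerD2r ltW.
Qed.

Let icg n m k : P.-integrable setT (fun w => ((b - a) * c n w + gain m k w)%:E).
Proof.
under eq_fun do rewrite EFinD EFinM; apply: integrableD => //.
  by apply: integrableZl => //; exact: ic.
exact: igain.
Qed.

Let crossing_gain_le n : (\int[P]_w ((b - a) * c n.+1 w + gain n.+1 n w)%:E <=
  \int[P]_w (y 0%N w - a)%:E)%E.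
Proof.
elim: n => [|n IH].
  apply: le_integral => //.
  move=> w _; rewrite lee_fin (le_trans (crossing_gain 0%N w))//.
  by rewrite /c/= mulr0 add0r /gain/= indicT mul1r.
apply: le_trans IH.
apply: (@le_trans _ _ (\int[P]_w ((b - a) * c n.+1 w + gain n.+1 n.+1 w)%:E)%E).
  apply: le_integral => //.
  by move=> w _; rewrite lee_fin crossing_gain.
have cgE m k : (\int[P]_w ((b - a) * c m w + gain m k w)%:E =
    \int[P]_w ((b - a) * c m w)%:E + \int[P]_w (gain m k w)%:E)%E.
  under eq_integral do rewrite EFinD.
  rewrite integralD//; last exact: igain.
  by under eq_fun do rewrite EFinM; apply: integrableZl => //; exact: ic.
by rewrite !cgE gain_step.
Qed.

(** The crossings credited with b - a, plus the open gain, have expectation at most E[y_0 - a], as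
    the position is open at the start. The open gain is at least -(|y_n| + |a|). Each of the two
    estimates costs one summand C + |a|, whence the factor 2. *)
Lemma crossings_le (C : R) n : (forall n, \int[P]_w `|y n w|%:E <= C%:E)%E ->
  (\int[P]_w (crossings n.+1 w)%:R%:E <= (2 * (C + `|a|) / (b - a))%:E)%E.
Proof.
move=> yC; have ba0 : 0 < b - a by rewrite subr_gt0.
have yaC m : (\int[P]_w (`|y m w| + `|a|)%:E <= (C + `|a|)%:E)%E.
  under eq_integral do rewrite EFinD.
  rewrite integralD//; [|by apply: integrable_norm; exact: iy|exact: icst].
  have -> : (\int[P]_w `|a|%:E = `|a|%:E)%E.
    by rewrite -[RHS]mule1 -(probability_setT P) -(integral_cst P measurableT).
  rewrite EFinD.
  by apply: leeD => //; exact: yC.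
rewrite EFinM lee_pdivlMr// muleC -ge0_integralZl//; last 2 first.
- by apply/measurable_EFinP; exact: measurable_crossings.
- by rewrite lee_fin ltW.
apply: (@le_trans _ _ (\int[P]_w (((b - a) * c n.+1 w + gain n.+1 n w)%:E +
    (`|y n w| + `|a|)%:E)))%E.
  apply: le_integral => //.
  - by apply: integrableZl => //; exact: ic.
  - exact: integrableD.
  - move=> w _; rewrite -EFinM -EFinD lee_fin -addrA lerDl.
    rewrite -lerBlDr sub0r lerNl -normrN.
    rewrite (@le_trans _ _ (`|gain n.+1 n w|))//; first by rewrite -normrN ler_norm.
    rewrite /gain normrM ger0_norm// indicE.
    by case: (_ \in _); rewrite ?mul1r ?mul0r ?addr_ge0// ?normrN ler_normB.
rewrite integralD//.
rewrite mulr_natl mulr2n EFinD; apply: leeD; last exact: yaC.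
apply: (le_trans (crossing_gain_le n)); apply: le_trans (yaC 0%N).
apply: le_integral => //.
by move=> w _; rewrite lee_fin (le_trans (ler_norm _))// ler_normB.
Qed.

End upcrossing.

Section one_sided_neighborhoods.
Context {R : realType}.
Implicit Types (t : R) (A : set R).

Lemma at_rightP t A :
  t^'+ A <-> exists2 e : R, 0 < e & forall s, t < s -> s < t + e -> A s.
Proof.
split.
  move=> /nbhs_ballP[e /= e0 eA]; exists e => // s ts se; apply: eA => //=.
  by rewrite /ball/= ltr_distlC se andbT (lt_trans _ ts) // ltrBlDr ltrDl.
move=> [e e0 eA]; apply/nbhs_ballP; exists e => // s/=.
by rewrite /ball/= ltr_distlC => /andP[_ se] ts; exact: eA.
Qed.

Lemma at_leftP t A :
  t^'- A <-> exists2 e : R, 0 < e & forall s, s < t -> t - e < s -> A s.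
Proof.
split.
  move=> /nbhs_ballP[e /= e0 eA]; exists e => // s ts se; apply: eA => //=.
  by rewrite /ball/= ltr_distlC se/= (lt_trans ts)// ltrDl.
move=> [e e0 eA]; apply/nbhs_ballP; exists e => // s/=.
by rewrite /ball/= ltr_distlC => /andP[se _] ts; exact: eA.
Qed.

End one_sided_neighborhoods.

(** * Dyadic times of [0, T] *)

Section dyadic_grid.
Context {R : realType}.
Variable T : R.
Hypothesis T0 : 0 < T.
Implicit Types (t e : R).

(** The cap at [T] makes every natural number an index; all those from [2 ^ n] on denote [T]. *)
Definition grid (n i : nat) : R := Num.min T (T * i%:R / 2 ^+ n).

Definition dyadic : set R := \bigcup_n range (grid n).

Lemma grid_ge0 n i : 0 <= grid n i.
Proof. by rewrite le_min (ltW T0)/= divr_ge0// mulr_ge0// ltW. Qed.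

Lemma grid_le n i : grid n i <= T.
Proof. by rewrite ge_min lexx. Qed.

Lemma grid_itv n i : 0 <= grid n i <= T.
Proof. by rewrite grid_ge0 grid_le. Qed.

Lemma grid_homo n : {homo grid n : i j / (i <= j)%N >-> i <= j}.
Proof.
move=> i j ij; rewrite le_min !ge_min lexx/=; apply/orP; right.
by rewrite ler_pM2r ?invr_gt0 ?exprn_gt0// ler_pM2l// ler_nat.
Qed.

Lemma grid_top n i : (2 ^ n <= i)%N -> grid n i = T.
Proof.
move=> ni; apply/min_idPl; rewrite ler_pdivlMr ?exprn_gt0// ler_pM2l//.
by rewrite -natrX ler_nat.
Qed.

Lemma range_grid_homo n m : (n <= m)%N -> range (grid n) `<=` range (grid m).
Proof.
move=> /subnK <-; elim: (m - n)%N => // k IH; rewrite addSn.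
apply: (subset_trans IH) => _ [i _ <-]; exists i.*2 => //.
rewrite /grid; congr Num.min; rewrite -muln2 natrM exprS.
by field; rewrite expf_neq0.
Qed.

Definition gidx n (t : R) : nat := Num.truncn (t * 2 ^+ n / T).

(** For 0 <= t < T, the first grid time strictly after t, so that values at [gnext n t] see right
    limits; [T] is kept fixed. *)
Definition gnext n (t : R) : R := grid n (gidx n t).+1.

Lemma gidxP n t : 0 <= t -> T * (gidx n t)%:R / 2 ^+ n <= t < T * (gidx n t).+1%:R / 2 ^+ n.
Proof.
move=> t0; have := truncn_itv (x := t * 2 ^+ n / T).
rewrite divr_ge0 ?mulr_ge0 ?exprn_ge0// ?(ltW T0)// => /(_ isT).
rewrite -/(gidx n t) ler_pdivlMr// ltr_pdivrMr// => /andP[h1 h2].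
by rewrite ler_pdivrMr ?exprn_gt0// ltr_pdivlMr ?exprn_gt0// ![T * _]mulrC h1 h2.
Qed.

Lemma gnext_gt n t : 0 <= t < T -> t < gnext n t.
Proof.
by move=> /andP[t0 tT]; rewrite lt_min tT/=; have /andP[] := gidxP n t0.
Qed.

Lemma gnext_le n t : 0 <= t -> gnext n t <= t + T / 2 ^+ n.
Proof.
move=> t0; rewrite ge_min; apply/orP; right.
have /andP[h _] := gidxP n t0.
by rewrite -natr1 mulrDr mulr1 mulrDl lerD2r.
Qed.

Lemma gnextT n : gnext n T = T.
Proof.
apply: grid_top; rewrite /gidx mulrAC divff ?gt_eqF// mul1r.
by rewrite -natrX natrK leqnSn.
Qed.

Lemma dyadic_gnext n t : dyadic (gnext n t).
Proof. by exists n => //; exists (gidx n t).+1. Qed.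

Lemma cvg_step : (fun n => T / 2 ^+ n) @ \oo --> (0 : R).
Proof.
rewrite -[0](mulr0 T); apply: cvgMr.
under eq_fun do rewrite -exprVn.
by apply: cvg_expr; rewrite ger0_norm// invf_lt1// ltr1n.
Qed.

Lemma step_lt (e : R) : 0 < e -> \forall n \near \oo, T / 2 ^+ n < e.
Proof. by move=> e0; apply: (cvgr_lt _ cvg_step). Qed.

Lemma cvg_gnext t : 0 <= t < T -> gnext ^~ t @ \oo --> within dyadic t^'+.
Proof.
move=> tT A /at_rightP[e e0 eA]; have [N _ Ne] := step_lt e0.
exists N => // n /Ne/= ne; apply: eA.
- exact: gnext_gt.
- by case/andP: tT => t0 _; rewrite (le_lt_trans (gnext_le n t0))// ltrD2l.
- exact: dyadic_gnext.
Qed.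

Lemma within_dyadic_right_proper t : 0 <= t < T ->
  ProperFilter (within dyadic t^'+).
Proof.
move=> tT; apply: Build_ProperFilter_ex => A /(cvg_gnext tT)[n _ nA].
by exists (gnext n t); exact: (nA n (leqnn n)).
Qed.

Lemma within_dyadic_left_proper t : 0 < t <= T ->
  ProperFilter (within dyadic t^'-).
Proof.
move=> /andP[t0 tT]; apply: Build_ProperFilter_ex => A /at_leftP[e e0 eA].
have et0 : 0 < Num.min e t by rewrite lt_min e0.
have [N _ Ne] := step_lt et0.
have := Ne N (leqnn N); rewrite /= lt_min => /andP[Ne' Nt].
pose s := t - T / 2 ^+ N.
have s0 : 0 <= s by rewrite subr_ge0 ltW.
have sT : s < T.
  by rewrite ltrBlDr (le_lt_trans tT)// ltrDl divr_gt0// exprn_gt0.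
(* The grid time following [s] is at most [t]. If it is [t] itself, then [s] is on the grid and is
   the required point. *)
have [st|st] := ltP (gnext N s) t.
  exists (gnext N s); apply: eA => //; last exact: dyadic_gnext.
  apply: (@lt_trans _ _ s); last by apply: gnext_gt; rewrite s0.
  by rewrite ltrD2l ltrN2.
exists (grid N (gidx N s)).
have /andP[h1 h2] := gidxP N s0.
have gs : grid N (gidx N s) <= s by rewrite ge_min h1 orbT.
have st' : T * (gidx N s).+1%:R / 2 ^+ N <= s + T / 2 ^+ N.
  by rewrite -natr1 mulrDr mulr1 mulrDl lerD2r.
apply: eA.
- by rewrite (le_lt_trans gs)// ltrBlDr ltrDl divr_gt0// exprn_gt0.
- have gE : grid N (gidx N s) = T * (gidx N s)%:R / 2 ^+ N.
    by apply/min_idPr; rewrite (le_trans h1)// ltW.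
  rewrite gE; have : t <= T * (gidx N s).+1%:R / 2 ^+ N.
    by apply: (le_trans st); rewrite ge_min lexx orbT.
  rewrite -natr1 mulrDr mulr1 mulrDl -lerBlDr; apply: lt_le_trans.
  by rewrite ltrD2l ltrN2.
- by exists N => //; exists (gidx N s).
Qed.

End dyadic_grid.

(** * Oscillation and the existence of limits *)

Section alternations.
Context {R : realType}.
Implicit Types (D : set R) (y : R -> R) (a b l r t : R).

Fixpoint alternates D y a b (k : nat) l r : Prop :=
  if k is k'.+1 then exists s t, [/\ D s, D t, l < s & s < t] /\
    [/\ t < r, y s < a, b < y t & alternates D y a b k' t r]
  else True.

Lemma alternates_widen D y a b k l l' r : l' <= l ->
  alternates D y a b k l r -> alternates D y a b k l' r.
Proof.
case: k => // k l'l /= [s [t [[Ds Dt ls st] h]]].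
by exists s, t; split => //; split => //; exact: le_lt_trans ls.
Qed.

Lemma alternates_sub D D' y a b k l r : D `<=` D' ->
  alternates D y a b k l r -> alternates D' y a b k l r.
Proof.
move=> DD'; elim: k l => // k IH l /= [s [t [[Ds Dt ls st] [tr ya yb h]]]].
exists s, t; split; first by split => //; exact: DD'.
by split => //; exact: IH.
Qed.

(** Oscillation to the right of [t] provides points below [a] and above [b] in every ]t, r'[.
    Crossings are therefore placed from right to left, each between [t] and the left end [l] of
    those already found, which is why [l] is returned. *)
Lemma alternates_right D y a b t k r : t < r ->
  ~ (within D t^'+) [set s | a <= y s] -> ~ (within D t^'+) [set s | y s <= b] ->
  exists2 l, t < l & alternates D y a b k l r.
Proof.
move=> + na nb; have low r' : t < r' -> exists s, [/\ D s, t < s, s < r' & y s < a].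
  move=> tr; apply: contrapT => ns; apply: na; apply/at_rightP.
  exists (r' - t); rewrite ?subr_gt0// => s ts; rewrite addrC subrK => sr Ds /=.
  by rewrite leNgt; apply/negP => ya; apply: ns; exists s.
have high r' : t < r' -> exists s, [/\ D s, t < s, s < r' & b < y s].
  move=> tr; apply: contrapT => ns; apply: nb; apply/at_rightP.
  exists (r' - t); rewrite ?subr_gt0// => s ts; rewrite addrC subrK => sr Ds /=.
  by rewrite leNgt; apply/negP => ya; apply: ns; exists s.
elim: k r => [|k IH] r tr; first by exists r.
have [l tl altl] := IH r tr.
have tl' : t < Num.min l r by rewrite lt_min tl.
have [j [Dj tj + yj]] := high _ tl'; rewrite lt_min => /andP[jl jr].
have [i [Di ti ij yi]] := low _ tj.
exists ((t + i) / 2); first by rewrite midf_lt.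
exists i, j; split; first by split => //; rewrite midf_lt.
by split => //; apply: alternates_widen altl; exact: ltW.
Qed.

Lemma alternates_left D y a b t k l : l < t ->
  ~ (within D t^'-) [set s | a <= y s] -> ~ (within D t^'-) [set s | y s <= b] ->
  alternates D y a b k l t.
Proof.
move=> + na nb; have low r' : r' < t -> exists s, [/\ D s, s < t, r' < s & y s < a].
  move=> tr; apply: contrapT => ns; apply: na; apply/at_leftP.
  exists (t - r'); rewrite ?subr_gt0// => s ts; rewrite subKr => sr Ds /=.
  by rewrite leNgt; apply/negP => ya; apply: ns; exists s.
have high r' : r' < t -> exists s, [/\ D s, s < t, r' < s & b < y s].
  move=> tr; apply: contrapT => ns; apply: nb; apply/at_leftP.
  exists (t - r'); rewrite ?subr_gt0// => s ts; rewrite subKr => sr Ds /=.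
  by rewrite leNgt; apply/negP => ya; apply: ns; exists s.
elim: k l => [//|k IH] l lt.
have [i [Di it li yi]] := low _ lt.
have [j [Dj jt ij yj]] := high _ it.
by exists i, j; split => //; split => //; exact: IH.
Qed.

(** The limit is the limit superior [L] along [F], the infimum of the eventual upper bounds. For
    rationals q1 < q2 < L, q2 is not an eventual upper bound, so the alternative makes q1 an
    eventual lower bound. *)
Lemma cvg_no_alternation (F : set_system R) (FF : ProperFilter F) y (c : R) :
  F [set s | `|y s| <= c] ->
  (forall a b : rat, a < b ->
    F [set s | ratr a <= y s] \/ F [set s | y s <= ratr b]) ->
  cvg (y @ F).
Proof.
move=> Fc FF'; pose S := [set b | F [set s | y s <= b]].
have Sc : S c by apply: filterS Fc => s/=; rewrite ler_norml => /andP[].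
have lS : lbound S (- c).
  move=> b Sb; have [s [/= + sb]] := filter_ex (filterI Fc Sb).
  by rewrite ler_norml => /andP[cs _]; exact: le_trans sb.
have hS : has_inf S by split; [exists c|exists (- c)].
pose L := inf S; apply/cvg_ex; exists L; apply/cvgrPdist_le => e e0.
have [b Sb bL] := inf_adherent e0 hS.
have [q1] : exists q : rat, ratr q \in `]L - e, L[.
  by apply: rat_in_itvoo; rewrite ltrBlDr ltrDl.
rewrite in_itv/= => /andP[q1L q1L'].
have [q2] := rat_in_itvoo q1L'; rewrite in_itv/= => /andP[q12 q2L].
have : F [set s | ratr q1 <= y s].
  have q12' : q1 < q2 by rewrite -(ltr_rat R).
  have [//|Fq2] := FF' q1 q2 q12'.
  have : L <= ratr q2 by apply: ge_inf => //; exists (- c).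
  by rewrite leNgt q2L.
apply: filterS2 Sb => s /= yb qy; rewrite ler_distlC; apply/andP; split.
  by rewrite (le_trans (ltW q1L)).
by rewrite (le_trans yb)// ltW.
Qed.

End alternations.

Section regularization.
Context {R : realType}.
Variables (T : R) (y : R -> R).
Implicit Types t : R.
Hypothesis T0 : 0 < T.
Hypothesis right_limits : forall t, 0 <= t < T -> cvg (y @ within (dyadic T) t^'+).
Hypothesis left_limits : forall t, 0 < t <= T -> cvg (y @ within (dyadic T) t^'-).

(** [T] has no dyadic times to its right, so the value of [y] is kept there. *)
Definition regularize (t : R) : R :=
  if t < T then lim (y @ within (dyadic T) t^'+) else y T.

Lemma regularize_cvg t : 0 <= t < T ->
  y @ within (dyadic T) t^'+ --> regularize t.
Proof.
by move=> tT; rewrite /regularize; case/andP: (tT) => _ ->; exact: right_limits.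
Qed.

Lemma regularize_gnext t : 0 <= t <= T ->
  (fun n => y (gnext T n t)) @ \oo --> regularize t.
Proof.
move=> /andP[t0]; rewrite le_eqVlt => /predU1P[->|tT].
  rewrite /regularize ltxx; under eq_fun do rewrite gnextT//.
  exact: cvg_cst.
by apply: cvg_comp (regularize_cvg _); [apply: cvg_gnext|]; rewrite ?t0.
Qed.

Lemma regularize_near (u L e : R) : 0 <= u < T ->
  (within (dyadic T) u^'+) [set s | `|y s - L| <= e] -> `|regularize u - L| <= e.
Proof.
move=> uT uL; apply/ler_addgt0Pr => eta eta0.
have /cvgrPdist_le/(_ _ eta0) := regularize_cvg uT.
have PF := within_dyadic_right_proper T0 uT.
move=> /(filterI uL)/filter_ex[s [/= h1 h2]].
rewrite (_ : _ - L = (y s - L) + (regularize u - y s)); last by ring.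
by rewrite (le_trans (ler_normD _ _))// lerD.
Qed.

Lemma regularize_right_continuous t : 0 <= t < T ->
  regularize s @[s --> t^'+] --> regularize t.
Proof.
move=> tT; apply/cvgrPdist_le => e e0.
have /cvgrPdist_le/(_ _ e0) := regularize_cvg tT.
move=> /at_rightP[d d0 dP]; apply/at_rightP.
case/andP: tT => t0 tT; exists (Num.min d (T - t)); rewrite ?lt_min ?d0 ?subr_gt0//.
move=> u tu; rewrite -ltrBlDl lt_min ltrBlDl ltrBlDl [t + (T - t)]addrC subrK.
move=> /andP[ud uT]; rewrite distrC; apply: regularize_near.
  by rewrite uT (le_trans t0)// ltW.
apply/at_rightP; exists (t + d - u); rewrite ?subr_gt0// => s us.
rewrite addrC subrK => sd Ds /=; rewrite distrC; apply: dP => //.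
exact: lt_trans us.
Qed.

Lemma regularize_left_limit t : 0 < t <= T ->
  exists l : R, regularize s @[s --> t^'-] --> l.
Proof.
move=> tT; exists (lim (y @ within (dyadic T) t^'-)).
apply/cvgrPdist_le => e e0.
have /cvgrPdist_le/(_ _ e0) := left_limits tT; set L := lim _.
move=> /at_leftP[d d0 dP]; apply/at_leftP.
case/andP: tT => t0 tT; exists (Num.min d t); rewrite ?lt_min ?d0//.
move=> u ut; rewrite ltrBlDr -ltrBlDl lt_min !ltrBlDl => /andP[ud tu].
rewrite distrC; apply: regularize_near.
  by rewrite (lt_le_trans ut tT) andbT; move: tu; rewrite -{1}[t]add0r ltrD2r => /ltW.
apply/at_rightP; exists (t - u); rewrite ?subr_gt0// => s us.
rewrite addrC subrK => st Ds /=; rewrite distrC; apply: dP => //.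
by rewrite ltrBlDr (lt_trans ud)// ltrD2r.
Qed.

End regularization.

(** Links the two ways of counting: the position opens at the index of the low point, and
    [crossings_hit] records a crossing at the index of the high point. [m] is the index from which
    crossings are still to be counted. *)
Lemma crossings_alternates {R : realType} {d : measure_display}
    {Omega : measurableType d} (T : R)
    (Y : R -> Omega -> R) (a b : R) (n : nat) (w : Omega) k l r m :
  0 < T -> alternates (range (grid T n)) (Y ^~ w) a b k l r ->
  (m <= (2 ^ n).+1)%N -> (forall i, l < grid T n i -> (m <= i)%N) ->
  let c i := crossings (fun i => Y (grid T n i)) a b i w in
  (c m + k <= c (2 ^ n).+1)%N.
Proof.
move=> T0; set c := fun i => crossings _ a b i w => + + + /=; rewrite -!/(c _).
elim: k l m => [|k IH] l m /=.
  by move=> _ mn _; rewrite addn0; exact: crossings_homo.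
move=> [s [t [[[i _ <-] [j _ <-] li ij] [jr ya yb alt]]]] mn lm.
have mi := lm _ li.
(* The same time, with its index capped where the grid becomes constant, so that the crossing is
   counted by [(2 ^ n).+1]. *)
pose j' := minn j (2 ^ n).
have jE : grid T n j = grid T n j'.
  rewrite /j'; case: (leqP j (2 ^ n)) => // /ltnW nj.
  by rewrite grid_top// grid_top.
have ij' : (i < j')%N.
  by rewrite ltnNge; apply/negP => /(grid_homo T0 n); rewrite leNgt -jE ij.
have j'n : (j'.+1 <= (2 ^ n).+1)%N by rewrite ltnS geq_minr.
rewrite -addSnnS; apply: leq_trans (IH _ j'.+1 alt j'n _); last first.
  move=> i' ji'; rewrite ltnNge; apply/negP => /(grid_homo T0 n).
  by rewrite leNgt -jE ji'.
rewrite leq_add2r; apply: (@leq_ltn_trans (c i.+1)).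
  by apply: crossings_homo; rewrite (leq_trans mi).
by apply: crossings_hit => //; [left|rewrite -jE].
Qed.

(** * The cadlag version of the martingale closed by an integrable variable *)

Section closed_martingale.
Context {d : measure_display} {Omega : measurableType d} {R : realType}.
Variables (P : probability Omega R) (T : R).
Hypothesis T0 : 0 < T.
Variable G : R -> set (set Omega).
Hypothesis fG : filtration P T G.
Implicit Types (t : R).

Section upper_bounds.
Variables (X : Omega -> R) (Y : R -> Omega -> R).
Hypothesis iX : P.-integrable setT (EFin \o X).
Hypothesis YX : forall t, 0 <= t <= T -> is_condexp P (G t) (EFin \o X) (EFin \o Y t).

Let sG t : 0 <= t <= T -> sigma_algebra setT (G t).
Proof. exact: (filtration_sigma_algebra fG). Qed.

Let mG t : 0 <= t <= T -> G t `<=` measurable.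
Proof. exact: (filtration_measurable fG). Qed.

Let C := fine (\int[P]_w `|X w|%:E).

Let CE : (\int[P]_w `|X w|%:E = C%:E)%E.
Proof. by rewrite fineK// integrable_fin_num//; exact: integrable_norm. Qed.

Let y n i := Y (grid T n i).

Let gT n i : 0 <= grid T n i <= T. Proof. exact: grid_itv. Qed.

Let my n i : measurable_wrt (G (grid T n i)) (y n i).
Proof.
have [+ _ _] := YX (gT n i) => mY B mB.
rewrite (_ : _ @^-1` B = (EFin \o y n i) @^-1` (EFin @` B)).
  by apply: mY; exact: measurable_image_EFin.
by apply/seteqP; split => w/=; [exists (y n i w)|move=> [r Br [<-]]].
Qed.

(** Refining the grid keeps alternations, so those found on one grid are counted for all larger n
    and seen by the limit inferior; Fatou carries the uniform upcrossing bound over to [W]. *)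
Let W a b w : \bar R :=
  limn_einf (fun n => (crossings (y n) a b (2 ^ n).+1 w)%:R%:E).

Let mc a b n : measurable_fun setT
  (fun w => (crossings (y n) a b (2 ^ n).+1 w)%:R%:E : \bar R).
Proof.
apply/measurable_EFinP.
apply: (@measurable_crossings _ _ _ (fun i => G (grid T n i)) (y n)) => i.
- exact: sG.
- exact: mG.
- apply: (filtration_le fG); [exact: grid_ge0|exact: grid_homo|exact: grid_le].
- exact: my.
Qed.

Let mW a b : measurable_fun setT (W a b).
Proof.
rewrite (_ : W a b = (fun w => - limn_esup (fun n =>
    - (crossings (y n) a b (2 ^ n).+1 w)%:R%:E))%E); last first.
  by apply/funext => w; rewrite limn_esupN oppeK.
apply: measurableT_comp => //; apply: measurable_fun_limn_esup => n.
by apply: measurableT_comp => //; exact: mc.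
Qed.

Let W0 a b w : (0 <= W a b w)%E.
Proof. by apply: (limn_einf_ge_cst (N := 0%N)) => n _; rewrite lee_fin. Qed.

Let W_le a b : a < b ->
  (\int[P]_w W a b w <= (2 * (C + `|a|) / (b - a))%:E)%E.
Proof.
move=> ab; have c0 n w : setT w ->
    (0 <= (crossings (y n) a b (2 ^ n).+1 w)%:R%:E :> \bar R)%E by rewrite lee_fin.
apply: (le_trans (fatou P measurableT (mc a b) c0)).
apply: limn_einf_le_cst => n.
apply: (@crossings_le _ _ _ P (fun i => G (grid T n i)) (y n)) => // i.
- exact: sG.
- exact: mG.
- apply: (filtration_le fG); [exact: grid_ge0|exact: grid_homo|exact: grid_le].
- by have [] := YX (gT n i).
- move=> A GA; have [_ _ ->//] := YX (gT n i).
  have [_ _ ->//] := YX (gT n i.+1).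
  by move: GA; apply: (filtration_le fG); [exact: grid_ge0|exact: grid_homo|exact: grid_le].
- rewrite -CE; apply: (is_condexp_le_norm iX _ _ (YX (gT n i))).
    exact: sG.
  exact: mG.
Qed.

Lemma dyadic_alternates k a b l r w :
  alternates (dyadic T) (Y ^~ w) a b k l r ->
  exists n, alternates (range (grid T n)) (Y ^~ w) a b k l r.
Proof.
elim: k l => [|k IH] l /=; first by exists 0%N.
move=> [s [t [[[n1 _ Ds] [n2 _ Dt] ls st] [tr ya yb /IH[n3 alt]]]]].
exists (maxn n1 (maxn n2 n3)).
exists s, t; split.
  split => //.
    by move: Ds; apply: range_grid_homo; exact: leq_maxl.
  by move: Dt; apply: range_grid_homo; rewrite leq_max leq_maxl orbT.
split => //; apply: alternates_sub alt; apply: range_grid_homo.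
by rewrite leq_max leq_maxr orbT.
Qed.

Lemma ae_no_alternation (a b : R) : a < b -> {ae P, forall w, exists K,
  forall l r, ~ alternates (dyadic T) (Y ^~ w) a b K l r}.
Proof.
move=> ab; have iW : P.-integrable setT (W a b).
  apply/integrableP; split; first exact: mW.
  under eq_integral do rewrite gee0_abs//.
  by apply: (le_lt_trans (W_le ab)); rewrite ltry.
have := integrable_ae measurableT iW; apply: filterS => w /(_ Logic.I) Wfin.
(* An integer larger than [W]: that many alternations would force [W] to be at least as large. *)
exists (Num.truncn (fine (W a b w))).+1 => l r /dyadic_alternates[n alt].
have : ((Num.truncn (fine (W a b w))).+1%:R%:E <= W a b w)%E.
  apply: (limn_einf_ge_cst (N := n)) => m nm; rewrite lee_fin ler_nat.
  have alt' := alternates_sub (range_grid_homo nm) alt.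
  by have /= := crossings_alternates (m := 0) T0 alt' isT (fun _ _ => isT).
rewrite -(fineK Wfin) lee_fin leNgt => /negP; apply; exact: truncnS_gt.
Qed.

(** A maximal estimate is read off from the upcrossings of [0, j+1]: as the position is open at the
    start, one dyadic value above j+1 already counts as a crossing. Paths unbounded above thus have
    [W 0 j.+1%:R] at least 1 for every j, and for each j this has probability at most 2 C /
    (j+1). *)
Lemma ae_bounded_above : {ae P, forall w, exists c,
  forall s, dyadic T s -> Y s w <= c}.
Proof.
pose B := \bigcap_(j : nat) [set w | (1 <= W 0 j.+1%:R w)%E].
have mWB j : measurable [set w | (1 <= W 0 j.+1%:R w)%E].
  rewrite -[X in measurable X]setTI; exact: emeasurable_fun_c_infty.
have mB : measurable B by exact: bigcapT_measurable.
have PB j : (P B <= (2 * C / j.+1%:R)%:E)%E.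
  have := @W_le 0 j.+1%:R; rewrite ltr0n normr0 addr0 subr0 => /(_ isT).
  apply: le_trans; rewrite -[leLHS]mul1e -integral_cst//.
  apply: (@le_trans _ _ (\int[P]_(w in B) W 0 j.+1%:R w)%E).
    apply: ge0_le_integral => //; last by move=> w /(_ j); exact.
    by apply: measurable_funTS; exact: mW.
  by apply: ge0_subset_integral => //; exact: mW.
exists B; split => //.
  apply/eqP; rewrite eq_le measure_ge0 andbT; apply/lee_addgt0Pr => e e0.
  rewrite add0e; apply: (le_trans (PB (Num.truncn (e^-1 * (2 * C))))).
  by rewrite lee_fin ler_pdivrMr// -ler_pdivrMl// ltW// truncnS_gt.
move=> w /= /forallNP nw j _ /=.
have /existsNP[s /not_implyP[[n _ [i _ <-]] /negP]] := nw j.+1%:R.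
rewrite -ltNge => js.
apply: (limn_einf_ge_cst (N := n)) => m nm; rewrite lee_fin ler1n.
have [i' _ i'E] : range (grid T m) (grid T n i).
  by apply: (range_grid_homo nm); exists i.
pose i'' := minn i' (2 ^ m).
have iE : grid T n i = grid T m i''.
  rewrite -i'E /i''; case: (leqP i' (2 ^ m)) => // /ltnW mi'.
  by rewrite grid_top// grid_top.
have := @crossings_hit _ _ _ (y m) 0 j.+1%:R 0%N i'' w Logic.I isT.
rewrite /y -iE => /(_ js) /leq_trans; apply.
by apply: crossings_homo; rewrite ltnS geq_minr.
Qed.

End upper_bounds.

Variable X : Omega -> R.
Hypothesis iX : P.-integrable setT (EFin \o X).

Let Y t : Omega -> R := fine \o condexp P (G t) (EFin \o X).

Let sG t : 0 <= t <= T -> sigma_algebra setT (G t).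
Proof. exact: (filtration_sigma_algebra fG). Qed.

Let mG t : 0 <= t <= T -> G t `<=` measurable.
Proof. exact: (filtration_measurable fG). Qed.

Let YX t : 0 <= t <= T -> is_condexp P (G t) (EFin \o X) (EFin \o Y t).
Proof.
move=> tT; have cX := condexpP (sG tT) (mG tT) iX.
have [mc ic _] := cX.
apply: (is_condexp_aer (mG tT) cX).
  apply/(measurable_wrtP (sG tT))/measurable_EFinP.
  by apply: measurableT_comp => //; exact/(measurable_wrtP (sG tT)).
have := integrable_ae measurableT ic; apply: filterS => w /(_ Logic.I) fw.
by rewrite /= fineK.
Qed.

Let YNX t : 0 <= t <= T ->
  is_condexp P (G t) (EFin \o (\- X)) (EFin \o (\- Y t)).
Proof.
move=> tT; have := YX tT.
rewrite (_ : EFin \o (\- X) = (\- (EFin \o X))%E)//.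
rewrite (_ : EFin \o (\- Y t) = (\- (EFin \o Y t))%E)//.
exact: (is_condexpN (sG tT) (mG tT)).
Qed.

Definition regular_path w := (exists c, forall s, dyadic T s -> `|Y s w| <= c) /\
  forall a b : rat, a < b -> exists K, forall l r,
    ~ alternates (dyadic T) (Y ^~ w) (ratr a) (ratr b) K l r.

Lemma ae_regular_path : {ae P, forall w, regular_path w}.
Proof.
have h1 := ae_bounded_above iX YX.
have h2 : {ae P, forall w, exists c, forall s, dyadic T s -> - Y s w <= c}.
  apply: (@ae_bounded_above (\- X) (fun t => \- Y t)); last exact: YNX.
  rewrite (_ : _ \o _ = -%E \o (EFin \o X))%E; first exact: integrableN.
  by apply/funext.
have h3 : {ae P, forall w, forall ab : rat * rat, ab.1 < ab.2 -> exists K, forall l r,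
    ~ alternates (dyadic T) (Y ^~ w) (ratr ab.1) (ratr ab.2) K l r}.
  apply: ae_forall_count => -[a b] /=.
  have [ab|nab] := pselect (a < b); last exact: aeW.
  have ab' : ratr a < ratr b :> R by rewrite ltr_rat.
  by have := ae_no_alternation iX YX ab'; apply: filterS => w h _.
apply: filterS3 h1 h2 h3 => w [c1 h1] [c2 h2] h3; split.
  exists (Num.max c1 c2) => s Ds; rewrite ler_norml.
  by rewrite lerNl !le_max h1// h2// orbT.
by move=> a b ab; exact: (h3 (a, b)).
Qed.

Lemma regular_path_right w t : regular_path w -> 0 <= t < T ->
  cvg (Y ^~ w @ within (dyadic T) t^'+).
Proof.
move=> [[c hc] alt] tT; have PF := within_dyadic_right_proper T0 tT.
apply: (@cvg_no_alternation _ _ PF _ c).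
  by apply/at_rightP; exists 1 => // s _ _ Ds; exact: hc.
move=> a b ab; apply: contrapT => /not_orP[na nb].
have [K nK] := alt a b ab.
have tt1 : t < t + 1 by rewrite ltrDl.
have [l _] := alternates_right K tt1 na nb.
exact: nK.
Qed.

Lemma regular_path_left w t : regular_path w -> 0 < t <= T ->
  cvg (Y ^~ w @ within (dyadic T) t^'-).
Proof.
move=> [[c hc] alt] tT; have PF := within_dyadic_left_proper T0 tT.
apply: (@cvg_no_alternation _ _ PF _ c).
  by apply/at_leftP; exists 1 => // s _ _ Ds; exact: hc.
move=> a b ab; apply: contrapT => /not_orP[na nb].
have [K nK] := alt a b ab.
have t0 : 0 < t by case/andP: tT.
exact: nK (alternates_left K t0 na nb).
Qed.

(** Irregular paths form a null set and are replaced by 0, so that every path is cadlag; adaptedness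
    survives because the filtration contains the null sets. *)
Definition cadlag_version (t : R) (w : Omega) : R :=
  if pselect (regular_path w) then regularize T (Y ^~ w) t else 0.

Lemma cadlag_version_cadlag : cadlag T cadlag_version.
Proof.
move=> w; rewrite /cadlag_version; case: pselect => rw; last first.
  split => t _; first exact: cvg_cst.
  by exists 0; exact: cvg_cst.
split => t tT.
  by apply: regularize_right_continuous => // s sT; exact: regular_path_right.
apply: regularize_left_limit => // s sT; first exact: regular_path_right.
exact: regular_path_left.
Qed.

(** * Optional sampling by dyadic approximation from above *)

Section optional_sampling.
Variable theta : Omega -> R.
Hypothesis st : stopping_time T G theta.

Let thetaT w : 0 <= theta w <= T. Proof. by case: st. Qed.

(** On this event the dyadic approximation of [theta] equals [grid T n k.+1], a time at which the
    event is already known. *)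
Let B n k := [set w | gidx T n (theta w) = k].

Let GB n k : G (grid T n k.+1) (B n k).
Proof.
have gT : 0 <= grid T n k.+1 <= T by exact: grid_itv.
have -> : B n k = [set w | T * k%:R / 2 ^+ n <= theta w] `&`
    [set w | theta w < T * k.+1%:R / 2 ^+ n].
  apply/seteqP; split => w; rewrite /B/=.
    by move=> <-; have /andP[] := gidxP T0 n (proj1 (andP (thetaT w))).
  move=> [h1 h2]; apply: truncn_def.
  rewrite ler_pdivlMr// ltr_pdivrMr// ![_ * T]mulrC.
  by rewrite -ler_pdivrMr ?exprn_gt0// -ltr_pdivlMr ?exprn_gt0// h1 h2.
have lt_G x y : 0 <= x -> x <= y -> 0 <= y <= T ->
    G y [set w | theta w < x].
  move=> x0 xy /andP[y0 yT].
  apply: (filtration_le fG x0 xy yT).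
  by apply: (stopping_time_lt fG st) => //; exact: le_trans yT.
(* Either the cell ends before [T] and its end is the grid time, or the grid time is [T], where
   everything about [theta] is known. *)
have [kn|kn] := ltP (T * k.+1%:R / 2 ^+ n) T.
  have gE : grid T n k.+1 = T * k.+1%:R / 2 ^+ n by apply/min_idPr; exact: ltW.
  apply: (sigma_algebraI (sG gT)).
    rewrite (_ : [set w | _] = ~` [set w | theta w < T * k%:R / 2 ^+ n]).
      apply: (sigma_algebraC (sG gT)).
      apply: lt_G => //; first by rewrite divr_ge0// mulr_ge0// ltW.
      by rewrite gE ler_pM2r ?invr_gt0 ?exprn_gt0// ler_pM2l// ler_nat.
    by apply/seteqP; split => w/=; rewrite leNgt => /negP.
  by apply: lt_G => //; rewrite ?gE// divr_ge0// mulr_ge0// ltW.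
have -> : grid T n k.+1 = T by apply/min_idPl.
have TT : 0 <= T <= T by rewrite lexx ltW.
have GT x : G T [set w | theta w < x].
  have [x0|x0] := ltP x 0.
    rewrite (_ : [set w | _] = set0); first exact: (sigma_algebra_set0 (sG TT)).
    apply/seteqP; split => w//= /lt_trans/(_ x0); rewrite ltNge.
    by have /andP[->] := thetaT w.
  have [xT|xT] := leP x T; first exact: lt_G.
  rewrite (_ : [set w | _] = setT); first exact: (sigma_algebra_setT (sG TT)).
  by apply/seteqP; split => w//= _; have /andP[_ /le_lt_trans] := thetaT w; apply.
apply: (sigma_algebraI (sG TT)) => //.
rewrite (_ : [set w | _] = ~` [set w | theta w < T * k%:R / 2 ^+ n]).
  exact: (sigma_algebraC (sG TT)).
by apply/seteqP; split => w/=; rewrite leNgt => /negP.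
Qed.

(* The sigma-algebra of the dyadic approximation of theta from above. *)
Let H n : set (set Omega) :=
  [set A | measurable A /\ forall k, G (grid T n k.+1) (A `&` B n k)].

Let gT n k : 0 <= grid T n k <= T. Proof. exact: grid_itv. Qed.

Let mB n k : measurable (B n k).
Proof. exact: mG (GB n k). Qed.

Let sH n : sigma_algebra setT (H n).
Proof.
split.
- split => // k; rewrite set0I; exact: sigma_algebra_set0 (sG (gT _ _)).
- move=> A [mA GA]; split => [|k]; first exact: measurableD.
  rewrite setTD (_ : _ `&` _ = B n k `&` ~` (A `&` B n k)).
    apply: (sigma_algebraI (sG (gT _ _))) => //.
    exact: (sigma_algebraC (sG (gT _ _))).
  apply/seteqP; split => w/=; first by move=> [nA Bw]; split => // -[].
  by move=> [Bw nA]; split => // Aw; exact: nA.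
- move=> A GA; split => [|k]; first by apply: bigcupT_measurable => i; case: (GA i).
  rewrite setI_bigcupl; apply: sigma_algebra_bigcup => [|i]; first exact: sG.
  by case: (GA i).
Qed.

Let Hm n : H n `<=` measurable. Proof. by move=> A []. Qed.

Let thetaH n : sigma_at T G theta `<=` H n.
Proof.
move=> A GA; split; first by exact: (sigma_at_measurable fG st (ltW T0)).
move=> k; rewrite (_ : A `&` B n k = A `&` [set w | theta w <= grid T n k.+1] `&` B n k).
  by apply: (sigma_algebraI (sG (gT _ _))) => //; exact: GA.
apply/seteqP; split => w/=; last by move=> [[]].
move=> [Aw Bw]; split => //; split => //; rewrite -Bw.
have := thetaT w => /andP[t0]; rewrite le_eqVlt => /predU1P[->|tT].
  by rewrite -/(gnext T n T) gnextT.
by rewrite ltW//; apply: (gnext_gt T0); rewrite t0.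
Qed.

Let N n w := Y (gnext T n (theta w)) w.

Let Y_wrt s t : 0 <= s -> s <= t -> t <= T -> measurable_wrt (G t) (Y s).
Proof.
move=> s0 st' tT C mC; have sT : 0 <= s <= T by rewrite s0 (le_trans st').
have [+ _ _] := YX sT => mY.
apply: (filtration_le fG s0 st' tT).
rewrite (_ : _ @^-1` C = (EFin \o Y s) @^-1` (EFin @` C)).
  by apply: mY; exact: measurable_image_EFin.
by apply/seteqP; split => w/=; [exists (Y s w)|move=> [r Br [<-]]].
Qed.

Let gidx_le n w : (gidx T n (theta w) < (2 ^ n).+1)%N.
Proof.
have /andP[t0 tT] := thetaT w; rewrite ltnS /gidx -(@natrK R (2 ^ n)).
by apply: le_truncn; rewrite ler_pdivrMr// natrX mulrC ler_pM2l// exprn_gt0.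
Qed.

(** At level n, [theta] visits finitely many cells, so integrability and integrals are computed cell
    by cell. *)
Let gluing n (U : nat -> Omega -> \bar R) : (forall k, P.-integrable setT (U k)) ->
  let V w := U (gidx T n (theta w)) w in P.-integrable setT V /\
  forall A, measurable A -> (\int[P]_(w in A) V w =
    \sum_(k < (2 ^ n).+1) \int[P]_(w in A `&` B n k) U k w)%E.
Proof.
move=> iU V; have VE : V = (fun w => \sum_(k < (2 ^ n).+1) (U k \_ (B n k)) w)%E.
  apply/funext => w /=; pose k0 := Ordinal (gidx_le n w).
  rewrite (bigD1 k0)//= big1 ?adde0 => [|k kk0].
    by rewrite patchE mem_set.
  rewrite patchE memNset//; apply: contraNnot kk0 => Bw.
  by apply/eqP/val_inj.
have iZ A k : measurable A -> P.-integrable A (U k \_ (B n k)).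
  move=> mA; apply: (integrableS measurableT mA) => //.
  by apply/(integrable_mkcond _ (mB n k)); exact: (integrableS measurableT).
split=> [|A mA]; rewrite VE; first by apply: integrable_sum => // k _; exact: iZ.
rewrite integral_sum//; last by move=> k; exact: iZ.
by apply: eq_bigr => k _; rewrite -integral_mkcondr.
Qed.

Let cN n : is_condexp P (H n) (EFin \o X) (EFin \o N n).
Proof.
have iY k : P.-integrable setT (EFin \o Y (grid T n k.+1)) by case: (YX (gT n k.+1)).
have [iN NE] := gluing n iY.
have mY k C : measurable C -> G (grid T n k.+1) ((EFin \o Y (grid T n k.+1)) @^-1` C).
  by case: (YX (gT n k.+1)) => + _ _; exact.
split => //.
- move=> C mC; split; last first.
    move=> k; rewrite (_ : _ `&` _ =
        (EFin \o Y (grid T n k.+1)) @^-1` C `&` B n k).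
      by apply: (sigma_algebraI (sG (gT _ _))) => //; exact: mY.
    by apply/seteqP; split => w/= [+ Bw]; rewrite /N /gnext Bw.
  rewrite (_ : _ @^-1` C =
      \bigcup_k ((EFin \o Y (grid T n k.+1)) @^-1` C `&` B n k)).
    apply: bigcupT_measurable => k; apply: measurableI => //.
    by apply: (mG (gT n k.+1)); exact: mY.
  apply/seteqP; split => w/=; first by move=> Cw; exists (gidx T n (theta w)).
  by move=> [k _ [+ Bw]]; rewrite /N /gnext Bw.
- move=> A [mA GA]; rewrite NE//.
  have [_ ->//] := gluing n (fun=> iX); apply: eq_bigr => k _.
  by have [_ _ ->] := YX (gT n k.+1).
Qed.

(** On {theta <= t} the dyadic approximation exceeds [t] by at most the mesh, hence stays below or
    at [s] once the mesh is at most s - t; for s = T this is automatic. *)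
Let N_wrt n s t : 0 <= t -> t <= s -> s <= T -> (s < T -> T / 2 ^+ n <= s - t) ->
  measurable_wrt (G s) (fun w => if theta w <= t then N n w else 0).
Proof.
move=> t0 ts sT hs C mC; have sT' : 0 <= s <= T by rewrite (le_trans t0).
have tT' : t <= T by rewrite (le_trans ts).
have Gt : G s [set w | theta w <= t].
  by apply: (filtration_le fG t0 ts sT); exact: (stopping_time_le st).
have -> : (fun w => if theta w <= t then N n w else 0) @^-1` C =
    \bigcup_k ([set w | theta w <= t] `&` (B n k `&` Y (grid T n k.+1) @^-1` C))
    `|` (~` [set w | theta w <= t] `&` (cst 0 : Omega -> R) @^-1` C).
  apply/seteqP; split => w /=.
    case: ifPn => [tw Cw|/negP tw Cw]; last by right.
    by left; exists (gidx T n (theta w)).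
  move=> [[k _ [tw [Bw Cw]]]|[/negP/negbTE-> //]].
  by rewrite tw /N /gnext; move: Bw => /= ->.
apply: (sigma_algebraU (sG sT')); last first.
  apply: (sigma_algebraI (sG sT')); first exact: (sigma_algebraC (sG sT')).
  have [C0|C0] := pselect (C 0).
    by rewrite preimage_cst mem_set//; exact: (sigma_algebra_setT (sG sT')).
  by rewrite preimage_cst memNset//; exact: (sigma_algebra_set0 (sG sT')).
apply: (sigma_algebra_bigcup (sG sT')) => k.
have [gs|gs] := leP (grid T n k.+1) s.
  apply: (sigma_algebraI (sG sT')) => //; apply: (sigma_algebraI (sG sT')).
    by apply: (filtration_le fG _ gs sT (GB _ _)); exact: grid_ge0.
  by apply: Y_wrt => //; exact: grid_ge0.
rewrite (_ : _ `&` _ = set0); first exact: (sigma_algebra_set0 (sG sT')).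
apply/seteqP; split => w //= [tw [Bw _]]; move: gs; rewrite ltNge => /negP; apply.
rewrite -Bw -/(gnext T n (theta w)).
have [sT1|Ts] := ltP s T; last by rewrite (le_trans (grid_le _ _ _)).
have /andP[w0 _] := thetaT w.
rewrite (le_trans (gnext_le T0 n w0))// (le_trans (lerD tw (hs sT1)))//.
by rewrite addrC subrK.
Qed.

Let N_cvg : {ae P, forall w, N ^~ w @ \oo --> cadlag_version (theta w) w}.
Proof.
apply: filterS ae_regular_path => w rw.
rewrite (_ : cadlag_version (theta w) w = regularize T (Y ^~ w) (theta w)).
  by apply: regularize_gnext => // t tT; exact: regular_path_right.
by rewrite /cadlag_version; case: pselect.
Qed.

Let version_wrt s t : 0 <= t -> t <= s -> s <= T -> (s < T -> t < s) ->
  measurable_wrt (G s)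
    (fun w => if theta w <= t then cadlag_version (theta w) w else 0).
Proof.
move=> t0 ts sT hs; have sT' : 0 <= s <= T by rewrite (le_trans t0).
have [m mP] : exists m, forall n, s < T -> T / 2 ^+ (n + m) <= s - t.
  have [sT1|Ts] := ltP s T; last by exists 0%N.
  have st0 : 0 < s - t by rewrite subr_gt0 hs.
  have [m _ mP] := step_lt T st0.
  by exists m => n _; apply/ltW/mP; exact: leq_addl.
pose W n w : R := if theta w <= t then N (n + m) w else 0.
have mW n : measurable_wrt (G s) (W n) by apply: N_wrt => //; exact: mP.
pose V w := limn_esup (fun n => (W n w)%:E).
have mV : measurable_wrt (G s) V.
  apply/(measurable_wrtP (sG sT')); apply: measurable_fun_limn_esup => n.
  exact/measurable_EFinP/(measurable_wrtP (sG sT')).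
have : measurable_wrt (G s) (EFin \o
    (fun w => if theta w <= t then cadlag_version (theta w) w else 0)).
  apply: (measurable_wrt_ae (sG sT') (filtration_negligible fG sT') mV).
  apply: filterS N_cvg => w Nw; rewrite /V /W/=; case: ifPn => _.
    suff /cvg_limn_einf_sup[_ ->//] : (fun n => (N (n + m) w)%:E) @ \oo -->
      (cadlag_version (theta w) w)%:E.
    apply: cvg_EFin; first exact: nearW.
    by move: Nw; rewrite -(cvg_shiftn m).
  suff /cvg_limn_einf_sup[_ ->//] : (fun n : nat => (0 : R)%:E) @ \oo --> (0 : R)%:E.
  exact: cvg_cst.
by move=> /(measurable_wrtP (sG sT'))/measurable_EFinP/(measurable_wrtP (sG sT')).
Qed.

(** For t < T the restriction to {theta <= t} is an almost sure limit of variables known at any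
    given s > t, and right-continuity of the filtration brings [s] down to [t]. *)
Lemma cadlag_version_stopped :
  measurable_wrt (sigma_at T G theta) (fun w => cadlag_version (theta w) w).
Proof.
move=> C mC t tT; have /andP[t0 tT'] := tT.
rewrite (_ : _ `&` _ = [set w | theta w <= t] `&`
  (fun w => if theta w <= t then cadlag_version (theta w) w else 0) @^-1` C).
  apply: (sigma_algebraI (sG tT)); first exact: (stopping_time_le st).
  have [tT1|Tt] := ltP t T; last first.
    by apply: version_wrt => // tT1; move: Tt; rewrite leNgt tT1.
  apply: (filtration_right_continuous fG) => [|s ts sT]; first by rewrite t0.
  by apply: version_wrt => //; exact: ltW.
apply/seteqP; split => w/= [].
  by move=> Cw tw; rewrite tw.
by move=> tw; rewrite tw.
Qed.

Lemma cadlag_version_condexp : is_condexp P (sigma_at T G theta) (EFin \o X)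
  (fun w => (cadlag_version (theta w) w)%:E).
Proof.
apply: (@is_condexp_cvg _ _ _ P X iX H _ N) => //.
- exact: cadlag_version_stopped.
- exact: (sigma_at_measurable fG st (ltW T0)).
Qed.

End optional_sampling.

Lemma cadlag_version_at t : 0 <= t <= T ->
  is_condexp P (G t) (EFin \o X) (EFin \o cadlag_version t).
Proof.
move=> tT; have st := stopping_time_cst fG tT.
by have := cadlag_version_condexp st; rewrite (sigma_at_cst fG tT).
Qed.

Lemma cadlag_version_adapted : adapted T G cadlag_version.
Proof.
move=> t tT; have [m _ _] := cadlag_version_at tT.
exact/(measurable_wrtP (sG tT))/measurable_EFinP/(measurable_wrtP (sG tT)).
Qed.

Lemma cadlag_version_martingale : martingale P T G cadlag_version.
Proof.
split; first exact: cadlag_version_adapted.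
  by move=> t /cadlag_version_at[].
move=> s t s0 st tT; have sT : 0 <= s <= T by rewrite s0 (le_trans st).
have tT' : 0 <= t <= T by rewrite tT (le_trans s0).
have [_ iY YtX] := cadlag_version_at tT'.
have [mY iYs YsX] := cadlag_version_at sT.
apply: (is_condexp_unique (sG sT) (mG sT) (condexpP (sG sT) (mG sT) iY)).
split; [exact: mY|exact: iYs|move=> A GA].
have GtA := filtration_le fG s0 st tT GA.
by rewrite (YsX _ GA) (YtX _ GtA).
Qed.

Lemma optional_adapted_cadlag x : adapted T G x -> cadlag T x -> optional T G x.
Proof.
move=> ax cx B mB; apply: sub_sigma_algebra; exists x => //.
by exists B.
Qed.

Lemma cadlag_indistinguishable x y : cadlag T x -> cadlag T y ->
  (forall t, 0 <= t <= T -> {ae P, forall w, x t w = y t w}) ->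
  indistinguishable P T x y.
Proof.
move=> cx cy xy; have : {ae P, forall w, forall ni : nat * nat,
    x (grid T ni.1 ni.2) w = y (grid T ni.1 ni.2) w}.
  by apply: ae_forall_count => ni; apply: xy; exact: grid_itv.
apply: filterS => w xyw t /andP[t0]; rewrite le_eqVlt => /predU1P[->|tT].
  by rewrite -(gnextT T0 0); exact: (xyw (0%N, (gidx T 0 T).+1)).
have t0T : 0 <= t < T by rewrite t0.
have lim (z : R -> Omega -> R) : cadlag T z -> (fun n => z (gnext T n t) w) @ \oo --> z t w.
  move=> /(_ w)[/(_ t t0T) zt _]; apply: cvg_comp zt.
  by apply: cvg_trans (cvg_gnext T0 t0T) _; exact: cvg_within.
have xyE : (fun n => x (gnext T n t) w) = (fun n => y (gnext T n t) w).
  by apply/funext => n; exact: (xyw (n, (gidx T n t).+1)).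
have := lim x cx; rewrite xyE => xt; have yt := lim y cy.
exact: (cvg_unique (@norm_hausdorff _ _) xt yt).
Qed.

Section closed_family.
Variable M : (Omega -> R) -> Omega -> \bar R.
Hypothesis MX : forall theta, stopping_time T G theta ->
  {ae P, forall w, M theta w = condexp P (sigma_at T G theta) (EFin \o X) w}.

Let sS theta (st : stopping_time T G theta) := sigma_at_sigma_algebra fG st.
Let mS theta (st : stopping_time T G theta) := sigma_at_measurable fG st (ltW T0).

Let cM theta : stopping_time T G theta ->
  is_condexp P (sigma_at T G theta) (EFin \o X) (M theta).
Proof.
move=> st; have cX := condexpP (sS st) (mS st) iX.
have MX' : {ae P, forall w, condexp P (sigma_at T G theta) (EFin \o X) w = M theta w}.
  by apply: filterS (MX st) => w ->.
apply: (is_condexp_aer (mS st) cX _ MX').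
have [mX _ _] := cX.
exact: (measurable_wrt_ae (sS st) (@sigma_at_negligible _ _ _ _ _ _ fG theta) mX MX').
Qed.

Let M_version theta : stopping_time T G theta ->
  {ae P, forall w, M theta w = (cadlag_version (theta w) w)%:E}.
Proof.
move=> st; exact: (is_condexp_unique (sS st) (mS st) (cM st) (cadlag_version_condexp st)).
Qed.

(** Up to null sets all members of the family are values at their stopping times of one process,
    which gives the agreement on {th1 = th2}; the martingale identity is the tower property. *)
Lemma closed_family_martingale_system : martingale_system P T G M.
Proof.
split; first split.
- by move=> theta /cM[].
- move=> th1 th2 st1 st2.
  by apply: filterS2 (M_version st1) (M_version st2) => w -> -> ->.
- by move=> theta /cM[].
- move=> th1 th2 st1 st2 th12; have [_ iM2 M2X] := cM st2.
  have [mM1 iM1 M1X] := cM st1.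
  apply: (is_condexp_unique (sS st1) (mS st1) (condexpP (sS st1) (mS st1) iM2)).
  split => // A GA; rewrite M1X// M2X//.
  exact: (sigma_at_le fG st1 st2 th12).
Qed.

Lemma closed_family_class_D : class_D P T G M.
Proof.
move=> e e0; have [c c0 cP] := is_condexp_class_D iX e0; exists c => theta st.
exact: (cP _ _ (sS st) (@mS _ st) (cM st)).
Qed.

Lemma closed_family_aggregated : uniquely_aggregated_cadlag_martingale P T G M.
Proof.
exists cadlag_version; split.
- exact: cadlag_version_cadlag.
- exact: cadlag_version_martingale.
- split; last exact: M_version.
  apply: optional_adapted_cadlag; last exact: cadlag_version_cadlag.
  exact: cadlag_version_adapted.
- move=> y cy _ [_ My]; apply: cadlag_indistinguishable => //.
    exact: cadlag_version_cadlag.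
  move=> t tT; have st := stopping_time_cst fG tT.
  by apply: filterS2 (M_version st) (My _ st) => w -> [].
Qed.

End closed_family.

End closed_martingale.

(** * Laws of controls *)

Section uniform_intervals.
Context {R : realType}.
Local Open Scope ereal_scope.

Let unif01_itv_compl : (unif01 (~` `[0%R, 1%R]) = 0 :> \bar R).
Proof.
rewrite probability_setC//; have := @unif01_cc R 1%R; rewrite ler01 lexx.
by move=> /(_ isT) /= ->; rewrite subee.
Qed.

Lemma unif01_lt (k : R) : (0 <= k <= 1)%R -> unif01 [set u | (u < k)%R] = k%:E.
Proof.
move=> k01; have mlt : measurable [set u : R | (u < k)%R].
  by rewrite (_ : mkset _ = `]-oo, k[%classic)//; apply/seteqP; split => u; rewrite /= in_itv.
apply/eqP; rewrite eq_le; apply/andP; split; last first.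
  rewrite -(unif01_co k01); apply: le_measure; rewrite ?inE//.
  by move=> u; rewrite /= in_itv/= => /andP[].
rewrite -[leRHS]adde0 -unif01_itv_compl -(unif01_co k01).
apply: (@le_trans _ _ (unif01 (`[0%R, k[ `|` ~` `[0%R, 1%R]))).
  apply: le_measure; rewrite ?inE//.
    by apply: measurableU => //; exact: measurableC.
  move=> u /= uk; rewrite !in_itv/=; have [u0|u0] := leP 0%R u; first by left.
  by right => /andP[].
by apply: measureU2 => //; exact: measurableC.
Qed.

Lemma unif01_le (k : R) : (0 <= k <= 1)%R -> unif01 [set u | (u <= k)%R] = k%:E.
Proof.
move=> k01; have mle : measurable [set u : R | (u <= k)%R].
  by rewrite (_ : mkset _ = `]-oo, k]%classic)//; apply/seteqP; split => u; rewrite /= in_itv.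
apply/eqP; rewrite eq_le; apply/andP; split; last first.
  rewrite -(unif01_cc k01); apply: le_measure; rewrite ?inE//.
  by move=> u; rewrite /= in_itv/= => /andP[].
rewrite -[leRHS]adde0 -unif01_itv_compl -(unif01_cc k01).
apply: (@le_trans _ _ (unif01 (`[0%R, k] `|` ~` `[0%R, 1%R]))).
  apply: le_measure; rewrite ?inE//.
    by apply: measurableU => //; exact: measurableC.
  move=> u /= uk; rewrite !in_itv/=; have [u0|u0] := leP 0%R u; first by left.
  by right => /andP[].
by apply: measureU2 => //; exact: measurableC.
Qed.

End uniform_intervals.

Lemma finite_measure_rays_unique {R : realType}
    (m1 m2 : {measure set R -> \bar R}) : (m1 setT < +oo)%E ->
  (forall t, m1 `]t, +oo[ = m2 `]t, +oo[)%classic ->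
  forall A, measurable A -> m1 A = m2 A.
Proof.
move=> m1T m12 A mA.
apply: (@measure_unique _ _ _ (@RGenOInfty.G R)
   (fun n => `](- n%:R), +oo[%classic)) => //.
- exact: RGenOInfty.measurableE.
- move=> _ _ [x ->] [y ->]; exists (Num.max x y).
  by apply/seteqP; split => z/=; rewrite !in_itv/= !andbT gt_max => /andP.
- by move=> n; exists (- n%:R).
- apply/seteqP; split => // x _; exists (Num.truncn (- x)).+1 => //=.
  by rewrite in_itv/= andbT ltrNl truncnS_gt.
- by move=> _ [x ->]; exact: m12.
- by move=> n; apply: le_lt_trans m1T; apply: le_measure; rewrite ?inE.
Qed.

(** * Hitting times of a path at a uniform level *)

Section randomised_time.
Context {R : realType}.
Variable T : R.
Hypothesis T0 : 0 < T.
Implicit Types (p : R -> R) (s t u b : R).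

(** [generated_time] along one path, with a level [u] in place of the device. *)
Definition hitting p u : R := inf ([set t | 0 <= t <= T /\ u < p t] `|` [set T]).

Let hitting_set p u := [set t | 0 <= t <= T /\ u < p t] `|` [set T].

Let hitting_has_inf p u : has_inf (hitting_set p u).
Proof.
split; first by exists T; right.
by exists 0 => t [[/andP[]]//|->]; exact: ltW.
Qed.

Lemma hitting_itv p u : 0 <= hitting p u <= T.
Proof.
apply/andP; split.
  apply: lb_le_inf; first by case: (hitting_has_inf p u).
  by move=> t [[/andP[]]//|->]; exact: ltW.
by apply: ge_inf; [case: (hitting_has_inf p u)|right].
Qed.

Lemma hitting_ge0 p u : 0 <= hitting p u.
Proof. by case/andP: (hitting_itv p u). Qed.

Lemma hitting_leT p u : hitting p u <= T.
Proof. by case/andP: (hitting_itv p u). Qed.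

(** What a control provides along one path; left limits follow from monotonicity. *)
Definition control_path p :=
  [/\ forall t, 0 <= t < T -> p s @[s --> t^'+] --> p t,
      0 <= p 0,
      forall s t, 0 <= s -> s <= t -> t <= T -> p s <= p t
    & p T = 1].

Section control_path_theory.
Variable p : R -> R.
Hypothesis cp : control_path p.

Lemma control_path_itv t : 0 <= t <= T -> 0 <= p t <= 1.
Proof.
case: cp => _ p0 pm <- /andP[t0 tT].
by rewrite (le_trans p0) ?pm.
Qed.

(** The infimum need not be attained, so hitting by time [b] only says that [u] is exceeded
    immediately after [b]. This places {hitting <= b} between {u < p b}, by monotonicity, and {u <=
    p b}, by right-continuity, two events of uniform mass [p b]. *)
Lemma hitting_leP u b : 0 <= b < T ->
  hitting p u <= b <-> (forall s, b < s -> s <= T -> u < p s).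
Proof.
move=> /andP[b0 bT]; case: cp => _ _ pm _; split.
  move=> hb s bs sT.
  have : hitting p u < s by exact: le_lt_trans bs.
  move=> /(inf_lt (hitting_has_inf p u).1)[t [[/andP[t0 tT] ut] ts|-> Ts]].
    by apply: (lt_le_trans ut); apply: pm => //; exact: ltW.
  by move: sT; rewrite leNgt Ts.
move=> us; apply/ler_addgt0Pr => e e0.
have bs : b < Num.min (b + e) T by rewrite lt_min bT ltrDl e0.
apply: (@le_trans _ _ (Num.min (b + e) T)); last by rewrite ge_min lexx.
apply: ge_inf; first by case: (hitting_has_inf p u).
left; split; last by apply: us => //; rewrite ge_min lexx orbT.
by rewrite (le_trans b0 (ltW bs)) ge_min lexx orbT.
Qed.

Lemma hitting_le_lt u b : 0 <= b < T -> u < p b -> hitting p u <= b.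
Proof.
move=> bT ub; apply/(hitting_leP _ bT) => s bs sT; apply: (lt_le_trans ub).
by case: cp => _ _ pm _; case/andP: bT => b0 _; apply: pm => //; exact: ltW.
Qed.

Lemma hitting_le_le u b : 0 <= b < T -> hitting p u <= b -> u <= p b.
Proof.
move=> bT /(hitting_leP _ bT) us; case: cp => pr _ _ _.
have pb := pr b bT; rewrite -(cvg_lim _ pb)//.
apply: limr_ge; first by apply/cvg_ex; exists (p b).
case/andP: bT => b0 bT; apply/at_rightP; exists (T - b); rewrite ?subr_gt0// => s bs.
by rewrite addrC subrK => sT; apply/ltW/us => //; exact: ltW.
Qed.

End control_path_theory.

Lemma measurable_hitting {d} {Omega : measurableType d} (x : R -> Omega -> R) :
  (forall t, 0 <= t <= T -> measurable_fun setT (x t)) ->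
  (forall w, control_path (x ^~ w)) ->
  measurable_fun setT (fun z : Omega * R => hitting (x ^~ z.1) z.2).
Proof.
move=> mx cx mT; apply: (measurability _ (RGenOInfty.measurableE R)) => //.
move=> _ [_ [b ->] <-]; rewrite setTI.
rewrite (_ : _ @^-1` _ =
    ~` [set z : Omega * R | hitting (x ^~ z.1) z.2 <= b]); last first.
  by apply/seteqP; split => z/=; rewrite in_itv/= andbT ltNge => /negP.
apply: measurableC; have [b0|b0] := leP 0 b; last first.
  rewrite (_ : [set _ | _] = set0)//; apply/seteqP; split => z//= /le_lt_trans.
  by move=> /(_ _ b0); rewrite ltNge hitting_ge0.
have [Tb|bT] := leP T b.
  rewrite (_ : [set _ | _] = setT)//; apply/seteqP; split => z//= _.
  exact: le_trans (hitting_leT _ _) Tb.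
pose s n := Num.min (b + n.+1%:R^-1) T.
have bs n : b < s n by rewrite lt_min bT ltrDl invr_gt0 ltr0n.
have sT n : s n <= T by rewrite ge_min lexx orbT.
rewrite (_ : [set _ | _] = \bigcap_n [set z | z.2 < x (s n) z.1]).
  apply: bigcapT_measurable => n; apply: measurable_set_ltr => //.
  have sT' : 0 <= s n <= T by rewrite sT andbT (le_trans b0)// ltW.
  exact: (measurableT_comp (mx _ sT') (@measurable_fst _ _ _ _)).
have bT' : 0 <= b < T by rewrite b0.
apply/seteqP; split => z /=.
  by move=> /(hitting_leP (cx z.1) _ bT') h n _; exact: h.
move=> h; apply/(hitting_leP (cx z.1) _ bT') => r br rT.
pose n := Num.truncn (r - b)^-1.
have : s n <= r.
  rewrite ge_min; apply/orP; left; rewrite addrC -lerBrDr.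
  rewrite -[leRHS]invrK lef_pV2 ?posrE ?invr_gt0 ?subr_gt0 ?ltr0n//.
  by rewrite ltW// truncnS_gt.
have := h n Logic.I; rewrite /= => /lt_le_trans zs sr; apply: zs.
case: (cx z.1) => _ _ pm _; apply: pm => //.
by rewrite (le_trans b0)// ltW.
Qed.

End randomised_time.

Section stieltjes_display.
Context {R : realType}.

Definition to_stieltjes : R -> measurableTypeR R := id.

Lemma measurable_to_stieltjes : measurable_fun setT to_stieltjes.
Proof. by move=> _ B mB; rewrite setTI. Qed.

HB.instance Definition _ :=
  isMeasurableFun.Build _ _ _ _ to_stieltjes measurable_to_stieltjes.

End stieltjes_display.

Section control_law.
Context {R : realType}.
Variable T : R.
Hypothesis T0 : 0 < T.
Implicit Types (p : R -> R) (s t u b : R).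

Lemma measurable_hitting_path p : control_path T p ->
  measurable_fun setT (hitting T p).
Proof.
move=> cp; have mc t : 0 <= t <= T -> measurable_fun [set: R] (cst (p t) : R -> R) by [].
have mh := @measurable_hitting R T T0 _ R (fun t _ => p t) mc (fun=> cp).
exact: (measurableT_comp mh (@pair1_measurable _ _ R R (0 : R))).
Qed.

(** The probability on [0, T] with distribution function [p]. The value chosen for other [p] only
    makes the definition total. *)
Definition law p : probability R R :=
  if pselect (control_path T p) is left cp
  then distribution unif01 (mfun_Sub (mem_set (measurable_hitting_path cp)))
  else unif01.

Lemma lawE p A : control_path T p -> law p A = unif01 (hitting T p @^-1` A).
Proof. by rewrite /law; case: pselect. Qed.

Section law_theory.
Variable p : R -> R.
Hypothesis cp : control_path T p.

Lemma ge0_integral_law A (phi : R -> \bar R) : measurable A ->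
  measurable_fun A phi -> {in A, forall t, 0 <= phi t}%E ->
  (\int[law p]_(t in A) phi t =
   \int[unif01]_(u in hitting T p @^-1` A) phi (hitting T p u))%E.
Proof.
move=> mA mphi phi0; rewrite /law; case: pselect => // cp'.
exact: ge0_integral_pushforward.
Qed.

Lemma law_le t : 0 <= t <= T -> law p `]-oo, t]%classic = (p t)%:E.
Proof.
move=> /andP[t0]; rewrite le_eqVlt => /predU1P[->|tT].
  rewrite (_ : p T = 1); last by case: cp.
  rewrite lawE// (_ : _ @^-1` _ = setT) ?probability_setT//.
  by apply/seteqP; split => u //= _; rewrite in_itv/= hitting_leT.
have tT' : 0 <= t < T by rewrite t0.
have pt : 0 <= p t <= 1 by apply: (control_path_itv cp); rewrite t0 ltW.
have mh := measurable_hitting_path cp.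
have mA : measurable (hitting T p @^-1` `]-oo, t]%classic).
  by rewrite -[X in measurable X]setTI; exact: mh.
have mle : measurable [set u : R | (u <= p t)%R].
  by rewrite (_ : mkset _ = `]-oo, p t]%classic)//; apply/seteqP; split => u; rewrite /= in_itv.
have mlt : measurable [set u : R | (u < p t)%R].
  by rewrite (_ : mkset _ = `]-oo, p t[%classic)//; apply/seteqP; split => u; rewrite /= in_itv.
rewrite lawE//; apply/eqP; rewrite eq_le; apply/andP; split.
  rewrite -(unif01_le pt); apply: le_measure; rewrite ?inE// => u /=.
  by rewrite in_itv/=; exact: (hitting_le_le T0 cp).
rewrite -(unif01_lt pt); apply: le_measure; rewrite ?inE// => u /=.
by rewrite in_itv/=; exact: (hitting_le_lt T0 cp).
Qed.

Lemma law_lt0 t : t <= 0 -> law p `]-oo, t[%classic = 0%E.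
Proof.
move=> t0; rewrite lawE// (_ : _ @^-1` _ = set0) ?measure0//.
apply/seteqP; split => u //=; rewrite in_itv/= => /lt_le_trans/(_ t0).
by rewrite ltNge hitting_ge0.
Qed.

Lemma law_gt t : 0 <= t <= T -> law p `]t, +oo[%classic = (1 - p t)%:E.
Proof.
move=> tT; rewrite -[X in law p X]setCK setCitvr/= probability_setC//.
by rewrite EFinB; congr (_ - _)%E; exact: law_le.
Qed.

Lemma law_itv : law p `[0, T]%classic = 1%E.
Proof.
rewrite lawE// (_ : _ @^-1` _ = setT) ?probability_setT//.
by apply/seteqP; split => u //= _; rewrite in_itv/= hitting_itv.
Qed.

End law_theory.

Section path_measure.
Context {d : measure_display} {Omega : measurableType d}.
Variables (x : R -> Omega -> R) (w : Omega).
Hypothesis cx : control_path T (x ^~ w).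

Lemma path_lt0 t : t < 0 -> path T x w t = 0.
Proof. by rewrite /path => ->. Qed.

Lemma path_itv t : 0 <= t <= T -> path T x w t = x t w.
Proof. by move=> /andP[t0 tT]; rewrite /path ltNge t0/=; congr x; apply/min_idPl. Qed.

Lemma path_geT t : T <= t -> path T x w t = 1.
Proof.
move=> Tt; rewrite /path ltNge (le_trans (ltW T0) Tt)/=.
by case: cx => _ _ _ <-; congr (x _ w); apply/min_idPr.
Qed.

Lemma law_path t : law (x ^~ w) `]-oo, t]%classic = (path T x w t)%:E.
Proof.
have [t0|t0] := ltP t 0.
  rewrite path_lt0//; apply/eqP; rewrite eq_le measure_ge0 andbT.
  rewrite -[leRHS](law_lt0 cx (lexx 0)); apply: le_measure; rewrite ?inE//.
  by move=> s; rewrite /= !in_itv/= => /le_lt_trans; apply.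
have [Tt|tT] := leP T t.
  rewrite path_geT//; apply/eqP; rewrite eq_le probability_le1//=.
  rewrite -(law_itv cx); apply: le_measure; rewrite ?inE//.
  by move=> s; rewrite /= !in_itv/= => /andP[_ /le_trans->].
have tT' : 0 <= t <= T by rewrite t0 ltW.
by rewrite path_itv// (law_le cx).
Qed.

Lemma path_homo s t : s <= t -> path T x w s <= path T x w t.
Proof.
move=> st; rewrite -lee_fin -!law_path; apply: le_measure; rewrite ?inE//.
by move=> r; rewrite /= !in_itv/= => /le_trans->.
Qed.

Lemma path_right_continuous : right_continuous (path T x w).
Proof.
move=> t; have [t0|t0] := ltP t 0.
  rewrite (path_lt0 t0); apply: cvg_near_cst.
  apply/at_rightP; exists (- t); rewrite ?oppr_gt0// => s _.
  by rewrite subrr => s0; exact: path_lt0.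
have [Tt|tT] := leP T t.
  rewrite (path_geT Tt); apply: cvg_near_cst.
  apply/at_rightP; exists 1 => // s ts _; apply: path_geT.
  by rewrite (le_trans Tt)// ltW.
have tT' : 0 <= t <= T by rewrite t0 ltW.
rewrite (path_itv tT').
case: cx => /(_ t) + _ _ _; rewrite t0 tT => /(_ isT).
apply: cvg_trans; apply: near_eq_cvg.
apply/at_rightP; exists (T - t); rewrite ?subr_gt0// => s ts.
rewrite addrC subrK => sT; rewrite path_itv//.
by rewrite (ltW sT) (le_trans t0)// ltW.
Qed.

Lemma to_cumulative_path : to_cumulative (path T x w) = path T x w :> (R -> R).
Proof.
rewrite /to_cumulative; case: pselect => [e|[]]; first by case: cid.
pose mix := isCumulative.Build R _ R (path T x w) path_homo path_right_continuous.
by exists (Cumulative.Pack (Cumulative.Class mix)).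
Qed.

(** Both measures give ]a, b] the increment of the path, which determines a Stieltjes measure. As
    the law of a hitting time, [dpath] becomes accessible to pushforwards and Tonelli. *)
Lemma dpath_law A : measurable A -> dpath T x w A = law (x ^~ w) A.
Proof.
move=> mA; rewrite /dpath.
transitivity (distribution (law (x ^~ w)) to_stieltjes A); last by [].
apply: lebesgue_stieltjes_measure_unique => [I [[a b]]/= _ <-|//].
rewrite /lebesgue_stieltjes_measure /measure_extension/=.
rewrite measurable_mu_extE/=; last exact: is_ocitv.
have [ab | ba] := leP a b; last first.
  by rewrite set_itv_ge ?wlength0 ?measure0// bnd_simp -leNgt ltW.
rewrite wlength_itv_bnd// to_cumulative_path EFinB -!law_path.
rewrite /distribution /pushforward.
rewrite (_ : to_stieltjes @^-1` _ = `]-oo, b]%classic `\` `]-oo, a]%classic).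
  rewrite measureD ?setIidr//; first exact: subset_itvl.
  by rewrite -ge0_fin_numE// fin_num_measure.
by rewrite -[RHS]setCK setCD setCitvl setUC -[LHS]setCK setCitv.
Qed.

Lemma integral_dpath A (phi : R -> \bar R) : measurable A -> measurable_fun A phi ->
  (\int[dpath T x w]_(t in A) phi t = \int[law (x ^~ w)]_(t in A) phi t)%E.
Proof.
move=> mA mphi.
rewrite (eq_measure_integral (distribution (law (x ^~ w)) to_stieltjes)).
  rewrite integralE [RHS]integralE; congr (_ - _)%E.
    rewrite ge0_integral_pushforward//; first exact: (measurable_funepos mphi).
  rewrite ge0_integral_pushforward//; exact: (measurable_funeneg mphi).
by move=> B mB _; exact: dpath_law.
Qed.

Let cvg_path_left t :
  path T x w s @[s --> t^'-] --> fine (law (x ^~ w) `]-oo, t[%classic).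
Proof.
have lf : law (x ^~ w) `]-oo, t[%classic \is a fin_num by rewrite fin_num_measure.
apply/cvgrPdist_le => e e0.
have cvg : (law (x ^~ w) \o (fun n => `]-oo, t - n.+1%:R^-1]%classic)) @ \oo -->
    law (x ^~ w) (\bigcup_n `]-oo, t - n.+1%:R^-1]%classic).
  apply: nondecreasing_cvg_mu => //; first exact: bigcupT_measurable.
  move=> n m nm; apply/subsetPset => s; rewrite /= !in_itv/= => /le_trans; apply.
  by rewrite lerD2l lerN2 lef_pV2 ?posrE// ler_nat.
have UE : \bigcup_n `]-oo, t - n.+1%:R^-1]%classic = `]-oo, t[%classic.
  apply/seteqP; split => s /=.
    by move=> [n _]; rewrite /= !in_itv/= => /le_lt_trans; apply; rewrite ltrBlDr ltrDl.
  rewrite in_itv/= -subr_gt0 => st; exists (Num.truncn (t - s)^-1) => //=.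
  rewrite in_itv/= lerBrDr -lerBrDl -[leRHS]invrK lef_pV2 ?posrE ?invr_gt0//.
  by rewrite ltW// truncnS_gt.
rewrite UE -(fineK lf) in cvg.
have fcvg : (fun n => fine (law (x ^~ w) `]-oo, t - n.+1%:R^-1]%classic)) @ \oo -->
    fine (law (x ^~ w) `]-oo, t[%classic) by exact: fine_cvg cvg.
have /cvgrPdist_le/(_ _ e0)[n _ /(_ n (leqnn n))/= nP] := fcvg.
apply/at_leftP; exists n.+1%:R^-1; rewrite ?invr_gt0// => s st ns /=.
have sl : path T x w s <= fine (law (x ^~ w) `]-oo, t[%classic).
  rewrite -lee_fin fineK// -law_path; apply: le_measure; rewrite ?inE//.
  by move=> r; rewrite /= !in_itv/= => /le_lt_trans; apply.
have nl : fine (law (x ^~ w) `]-oo, t - n.+1%:R^-1]%classic) <= path T x w s.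
  rewrite -lee_fin fineK ?fin_num_measure// -law_path; apply: le_measure; rewrite ?inE//.
  by move=> r; rewrite /= !in_itv/= => /le_trans; apply; exact: ltW.
rewrite ger0_norm ?subr_ge0//; apply: le_trans nP.
rewrite ger0_norm; first exact: lerB.
by rewrite subr_ge0 (le_trans nl).
Qed.

Lemma left_valE t : (left_val T x t w)%:E = law (x ^~ w) `]-oo, t[%classic.
Proof.
rewrite -[RHS]fineK ?fin_num_measure//; congr _%:E.
by apply: cvg_lim => //; exact: cvg_path_left.
Qed.

Lemma cvg_left_val t : path T x w s @[s --> t^'-] --> left_val T x t w.
Proof.
have := @cvg_path_left t; rewrite -left_valE; exact.
Qed.

Lemma left_val_itv t : 0 <= left_val T x t w <= 1.
Proof. by rewrite -!lee_fin left_valE measure_ge0 probability_le1. Qed.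

Lemma left_val_ge s t : s < t -> path T x w s <= left_val T x t w.
Proof.
move=> st; rewrite -lee_fin left_valE -law_path; apply: le_measure; rewrite ?inE//.
by move=> r; rewrite /= !in_itv/= => /le_lt_trans; apply.
Qed.

Lemma left_val_le t : left_val T x t w <= path T x w t.
Proof.
rewrite -lee_fin left_valE -law_path; apply: le_measure; rewrite ?inE//.
by move=> r; rewrite /= !in_itv/= => /ltW.
Qed.

Lemma jumpE t : 0 <= t <= T -> (jump T x t w)%:E = law (x ^~ w) [set t].
Proof.
move=> tT; rewrite /jump EFinB left_valE -(law_le cx tT).
rewrite (_ : `]-oo, t]%classic = `]-oo, t[%classic `|` [set t]); last first.
  by rewrite setUitv1// bnd_simp.
rewrite measureU//; first by rewrite addeAC subee ?add0e// fin_num_measure.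
by apply/seteqP; split => s //= [/[swap] ->]; rewrite in_itv/= ltxx.
Qed.

End path_measure.

End control_law.

Section atoms.
Context {R : realType}.
Local Open Scope ereal_scope.

Lemma countable_atoms (m : probability R R) : countable [set t | 0 < m [set t]].
Proof.
have mid : measurable_fun setT (id : R -> R) by exact: measurable_id.
pose X : {RV m >-> R} := mfun_Sub (mem_set mid).
apply: sub_countable (pmf_gt0_countable X); apply: subset_card_le => t /= t0.
by rewrite /pmf fine_gt0// t0 ltey_eq fin_num_measure.
Qed.

Lemma ge0_integral_set1 (m : probability R R) (k : R -> \bar R) t : 0 <= k t ->
  \int[m]_(s in [set t]) k s = k t * m [set t].
Proof.
move=> k0; rewrite -integral_cst//; apply: eq_integral => s.
by rewrite inE => ->.
Qed.

(** Within [B], [k] is supported by a countable set. Enumerated by an injection into the naturals,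
    this set splits into pieces [D n] of at most one point, on which sum and integral visibly
    agree. *)
Lemma esum_atoms (m : probability R R) (B : set R) (k : R -> \bar R) :
  measurable B -> measurable_fun B k -> (forall t, 0 <= k t) ->
  countable [set t | B t /\ k t != 0] ->
  \esum_(t in B) (k t * m [set t]) = \int[m]_(t in B) k t.
Proof.
move=> mB mk k0 cC; set C := [set t | _] in cC.
have a0 t : 0 <= k t * m [set t] by rewrite mule_ge0.
have -> : \esum_(t in B) (k t * m [set t]) = \esum_(t in C) (k t * m [set t]).
  rewrite esum_mkcond [RHS]esum_mkcond; apply: eq_esum => t _.
  case: ifPn => [|/negP]; rewrite inE => Bt; case: ifPn => [|/negP]; rewrite inE//.
  - move=> nC; have [->|k1] := eqVneq (k t) 0; first by rewrite mul0e.
    by case: nC.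
  - by move=> [].
have -> : \int[m]_(t in B) k t = \int[m]_(t in C) k t.
  rewrite integral_mkcond [RHS]integral_mkcond; apply: eq_integral => t _.
  rewrite !patchE; case: ifPn => [|/negP]; rewrite inE => Bt; case: ifPn => [|/negP]; rewrite inE//.
  - move=> nC; apply/eqP; rewrite -[_ == _]negbK; apply/negP => k1.
    by case: nC.
  - by move=> [].
have [f finj] := countable_injP _ cC.
pose D n := C `&` [set t | f t = n].
have mC D' : D' `<=` C -> measurable D'.
  move=> D'C; apply: countable_measurable => [t|]; first exact: measurable_set1.
  by apply: sub_countable cC; exact: subset_card_le.
have DT : trivIset setT D.
  by apply/trivIsetP => i j _ _ ij; apply/seteqP; split => t //;
    move=> [[_ /= fi] [_ /= fj]]; move: ij; rewrite -fi -fj eqxx.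
have CE : C = \bigcup_n D n.
  apply/seteqP; split => [t Ct|t [n _ []//]].
  by exists (f t).
rewrite CE ge0_integral_bigcup//; last 2 first.
- by move=> n; apply: mC => t [].
- by rewrite -CE; apply: measurable_funS mk => // t [].
rewrite esum_bigcupT// nneseries_esumT//; last first.
  by move=> n; exact: integral_ge0.
apply: eq_esum => n _.
have [D0|/set0P[t [Ct tn]]] := eqVneq (D n) set0.
  by rewrite D0 esum_set0 integral_set0.
rewrite (_ : D n = [set t]) ?esum_set1 ?ge0_integral_set1//.
apply/seteqP; split => s /= => [[Cs sn]|->//].
by apply: finj; rewrite ?inE// sn.
Qed.

End atoms.

(** * The payoff functional as a sum of integrals against laws *)

Section payoff_representation.
Context {R : realType} {d : measure_display} {Omega : measurableType d}.
Variable T : R.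
Hypothesis T0 : 0 < T.
Implicit Types (x y : R -> Omega -> R) (w : Omega) (phi : R -> R) (A B : set R).

Lemma measurable_path x w : control_path T (x ^~ w) ->
  measurable_fun `[0, T]%classic (x ^~ w).
Proof.
move=> cx; apply: (eq_measurable_fun (path T x w)).
  by move=> t; rewrite inE/= in_itv/= => tT; rewrite path_itv.
by apply: nondecreasing_measurable => // s t; exact: (path_homo T0 cx).
Qed.

Lemma measurable_jump x w : control_path T (x ^~ w) ->
  measurable_fun `[0, T]%classic (fun t => jump T x t w).
Proof.
move=> cx; apply: measurable_funB; first exact: measurable_path.
apply: nondecreasing_measurable => // s t st.
rewrite -lee_fin !(left_valE T0 cx); apply: le_measure; rewrite ?inE//.
by move=> r; rewrite /= !in_itv/= => /lt_le_trans->.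
Qed.

Lemma jump_itv x w t : control_path T (x ^~ w) -> 0 <= t <= T ->
  0 <= jump T x t w <= 1.
Proof.
move=> cx tT; rewrite -!lee_fin (jumpE T0 cx tT) measure_ge0/=.
exact: probability_le1.
Qed.

Lemma integrable_bounded (m : probability R R) A phi (c : R) : measurable A ->
  measurable_fun A phi -> (forall t, A t -> `|phi t| <= c) ->
  m.-integrable A (EFin \o phi).
Proof.
move=> mA mphi phic; apply: (le_integrable mA (g := cst c%:E)).
- exact/measurable_EFinP.
- by move=> t At /=; rewrite lee_fin (le_trans (phic t At))// ler_norm.
- apply/integrableP; split => //; rewrite integral_cst//=.
  by rewrite lte_mul_pinfty// ?ltey_eq ?fin_num_measure.
Qed.

(** [phi * jump y] vanishes outside the countably many atoms of the law of [y], and the jump of [x]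
    at t is the mass that its law gives to t. The uncountable sum is therefore an integral against
    the law of [x], first for the positive and negative parts. *)
Lemma real_sum_jump x y w phi B (c : R) :
  control_path T (x ^~ w) -> control_path T (y ^~ w) ->
  measurable B -> B `<=` `[0, T]%classic -> measurable_fun B phi ->
  (forall t, B t -> `|phi t| <= c) ->
  real_sum B (fun t => phi t * jump T y t w * jump T x t w) =
  \int[law T0 (x ^~ w)]_(t in B) (phi t * jump T y t w).
Proof.
move=> cx cy mB BT mphi phic.
pose k t := phi t * jump T y t w.
have mk : measurable_fun B k.
  apply: measurable_funM => //; apply: measurable_funS (measurable_jump cy) => //.
have kc t : B t -> `|k t| <= c.
  move=> Bt; rewrite normrM (le_trans _ (phic t Bt))// ler_piMr//.
  have /andP[j0 j1] : 0 <= jump T y t w <= 1 by apply: jump_itv => //; exact: BT Bt.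
  by rewrite ger0_norm.
have ik := integrable_bounded (law T0 (x ^~ w)) mB mk kc.
have supp (k' : R -> \bar R) : (forall t, k' t != 0%E -> k t != 0) ->
    countable [set t | B t /\ (k' t != 0)%E].
  move=> k'k; apply: sub_countable (countable_atoms (law T0 (y ^~ w))).
  apply: subset_card_le => t /= [/BT/= + /k'k]; rewrite in_itv/= => tT.
  rewrite -(jumpE T0 cy tT) lte_fin lt0r.
  by rewrite /k mulf_eq0 negb_or => /andP[_ ->]; case/andP: (jump_itv cy tT).
have part (k' : R -> \bar R) (a' : R -> \bar R) : measurable_fun B k' -> (forall t, 0 <= k' t)%E ->
   (forall t, k' t != 0%E -> k t != 0) ->
   (forall t, B t -> a' t = k' t * (jump T x t w)%:E)%E ->
   \esum_(t in B) a' t = (\int[law T0 (x ^~ w)]_(t in B) k' t)%E.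
  move=> mk' k'0 k'k a'E; rewrite -esum_atoms//; last exact: supp.
  apply: eq_esum => t Bt; rewrite a'E//; congr (_ * _)%E.
  by apply: (jumpE T0 cx); exact: BT Bt.
have jx t : B t -> 0 <= jump T x t w.
  by move=> /BT tT; have /andP[] := jump_itv cx tT.
rewrite /real_sum /Rintegral integralE fineB; last 2 first.
- exact: integrable_pos_fin_num.
- exact: integrable_neg_fin_num.
congr (_ - _); congr fine; apply: part => //.
- by apply: measurable_funepos; exact/measurable_EFinP.
- by move=> t; rewrite funeposE; apply: contra_neq; rewrite /k => ->; rewrite maxxx.
- move=> t Bt; rewrite !funeposE/= -!EFin_max -EFinM; congr EFin.
  by rewrite maxr_pMl ?mul0r// jx.
- by apply: measurable_funeneg; exact/measurable_EFinP.
- by move=> t; rewrite funenegE; apply: contra_neq; rewrite /k => ->; rewrite oppe0 maxxx.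
- move=> t Bt; rewrite !funenegE/= -!EFin_max -EFinM; congr EFin.
  by rewrite maxr_pMl ?mul0r ?mulNr// jx.
Qed.

Lemma payoff_functional_law (f g h : R -> Omega -> R) x y (A B : Omega -> set R) w (c : R) :
  control_path T (x ^~ w) -> control_path T (y ^~ w) ->
  measurable (A w) -> A w `<=` `[0, T]%classic ->
  measurable (B w) -> B w `<=` `[0, T]%classic ->
  measurable_fun `[0, T]%classic (f ^~ w) ->
  measurable_fun `[0, T]%classic (g ^~ w) ->
  measurable_fun `[0, T]%classic (h ^~ w) ->
  (forall t, 0 <= t <= T -> `|h t w| <= c) ->
  payoff_functional T f g h x y A B w =
  \int[law T0 (x ^~ w)]_(t in A w) (f t w * (1 - y t w)) +
  \int[law T0 (y ^~ w)]_(t in A w) (g t w * (1 - x t w)) +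
  \int[law T0 (x ^~ w)]_(t in B w) (h t w * jump T y t w).
Proof.
move=> cx cy mA AT mB BT mf mg mh hc.
have int (u v : R -> Omega -> R) (k : R -> R) : control_path T (u ^~ w) ->
    control_path T (v ^~ w) -> measurable_fun `[0, T]%classic k ->
    \int[dpath T u w]_(t in A w) (k t * (1 - v t w)) =
    \int[law T0 (u ^~ w)]_(t in A w) (k t * (1 - v t w)).
  move=> cu cv mk; congr fine; apply: (integral_dpath T0 cu) => //.
  apply/measurable_EFinP; apply: (measurable_funS _ AT) => //.
  apply: measurable_funM => //; apply: measurable_funB => //.
  exact: measurable_path.
rewrite /payoff_functional !int//; congr (_ + _).
apply: (real_sum_jump (c := c)) => //.
  exact: measurable_funS mh.
by move=> t /BT; exact: hc.
Qed.

End payoff_representation.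

Lemma scaled_law_unique {R : realType} (m1 m2 : probability R R) (k : R)
    (D A : set R) : 0 <= k -> measurable D -> measurable A -> A `<=` D ->
  (forall t, m1 (`]t, +oo[%classic `&` D) = k%:E * m2 (`]t, +oo[%classic `&` D))%E ->
  m1 A = (k%:E * m2 A)%E.
Proof.
move=> k0 mD mA AD rays.
rewrite -{1}(setIidl AD) -[in RHS](setIidl AD).
change (mrestr m1 mD A = mscale (NngNum k0) (mrestr m2 mD) A).
apply: finite_measure_rays_unique => [|t|//]; last exact: rays.
change (m1 (setT `&` D) < +oo)%E.
by rewrite ltey_eq fin_num_measure//; exact: measurableI.
Qed.

(** * Concatenation and truncation of controls *)

Section concatenation.
Context {R : realType} {d : measure_display} {Omega : measurableType d}.
Variable T : R.
Hypothesis T0 : 0 < T.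
Implicit Types (X Z x z : R -> Omega -> R) (theta : Omega -> R) (w : Omega).
Implicit Types (s t : R).

(* The control which follows X before theta and spends the mass that X has
   left at theta- according to x. *)
Definition concat X theta x : R -> Omega -> R := fun t w =>
  if theta w <= t then
    left_val T X (theta w) w + (1 - left_val T X (theta w) w) * x t w
  else X t w.

Lemma cadlag_control_path x : (forall w, control_path T (x ^~ w)) -> cadlag T x.
Proof.
move=> cx w; split; first by case: (cx w).
move=> t /andP[t0 tT]; exists (left_val T x t w).
have lx := @cvg_left_val _ _ T0 _ _ x w (cx w) t.
apply: cvg_trans lx; apply: near_eq_cvg.
apply/at_leftP; exists t => // s st; rewrite subrr => s0.
by rewrite path_itv// (ltW s0)/= (le_trans (ltW st)).
Qed.

Lemma control_control_path G theta x : control T G theta x ->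
  forall w, control_path T (x ^~ w).
Proof.
by case=> _ cx mx _ xT w; split => //; [case: (cx w)|case: (mx w)|case: (mx w)].
Qed.

Lemma left_val_near x y t w e : 0 < e ->
  (forall s, t - e < s -> s < t -> path T x w s = path T y w s) ->
  left_val T x t w = left_val T y t w.
Proof.
move=> e0 xy; have E : t^'- [set s | path T x w s = path T y w s].
  by apply/at_leftP; exists e => // s st ts; exact: xy.
rewrite /left_val; congr lim; apply/funext => A; apply/propext.
rewrite !nbhs_simpl /=; split; apply: filterS2 E => s /= xys.
  by rewrite xys.
by rewrite -xys.
Qed.

Section one_path.
Variables (X x : R -> Omega -> R) (theta : Omega -> R) (w : Omega).
Hypotheses (cX : control_path T (X ^~ w)) (cx : control_path T (x ^~ w)).
Hypotheses (tT : 0 <= theta w <= T) (x0 : left_val T x (theta w) w = 0).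

Local Notation th := (theta w).
Local Notation a := (left_val T X th w).
Local Notation c := (concat X theta x).

Lemma path_before t : t < th -> path T x w t = 0.
Proof.
move=> tth; apply/eqP; rewrite eq_le -{1}x0 (left_val_ge T0 cx)//=.
by rewrite -lee_fin -(law_path T0 cx).
Qed.

Let a01 : 0 <= a <= 1. Proof. exact: (left_val_itv T0 cX). Qed.

Let a0 : 0 <= 1 - a. Proof. by rewrite subr_ge0; case/andP: a01. Qed.

Lemma concat_before t : t < th -> c t w = X t w.
Proof. by rewrite /concat ltNge => /negbTE ->. Qed.

Lemma concat_after t : th <= t -> c t w = a + (1 - a) * x t w.
Proof. by rewrite /concat => ->. Qed.

Lemma control_path_concat : control_path T (c ^~ w).
Proof.
have th0 : 0 <= th by case/andP: tT.
have thT : th <= T by case/andP: tT.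
have [cXr X0 Xm XT] := cX; have [cxr x00 xm xT] := cx.
have Xa s : 0 <= s -> s < th -> X s w <= a.
  move=> s0 sth; rewrite -(path_itv (T := T)); first exact: (left_val_ge T0 cX).
  by rewrite s0 (le_trans (ltW sth)).
have xpos t : 0 <= t <= T -> 0 <= x t w.
  by move=> tT'; have /andP[] := control_path_itv cx tT'.
split.
- move=> t /andP[t0 t1]; have [tht|tth] := leP th t.
    rewrite concat_after//.
    apply: (@cvg_trans _ ((fun s => a + (1 - a) * x s w) @ t^'+)).
      apply: near_eq_cvg; apply/at_rightP; exists 1 => // s ts _.
      by rewrite concat_after// (le_trans tht)// ltW.
    apply: cvgD; first exact: cvg_cst.
    by apply: cvgMr; apply: cxr; rewrite t0.
  rewrite concat_before//; apply: (@cvg_trans _ (X s w @[s --> t^'+])).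
    apply: near_eq_cvg; apply/at_rightP; exists (th - t); rewrite ?subr_gt0// => s ts.
    by rewrite addrC subrK => sth; rewrite concat_before.
  by apply: cXr; rewrite t0.
- have [th1|th1] := leP th 0; last by rewrite concat_before.
  rewrite concat_after// addr_ge0//; first by case/andP: a01.
  by rewrite mulr_ge0.
- move=> s t s0 st t1; have [tht|tth] := leP th t.
    have tT' : 0 <= t <= T by rewrite t1 (le_trans s0).
    rewrite [leRHS]concat_after//; have [ths|sth] := leP th s.
      by rewrite concat_after// lerD2l ler_wpM2l// xm.
    rewrite concat_before// (le_trans (Xa _ s0 sth))// lerDl mulr_ge0//.
    exact: xpos.
  by rewrite !concat_before//; [exact: Xm|exact: le_lt_trans tth].
- by rewrite concat_after// xT mulr1 addrC subrK.
Qed.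

Lemma left_val_concat : left_val T c th w = a.
Proof.
apply: (@left_val_near _ _ _ _ 1) => // s _ sth; rewrite /path.
case: ifP => // /negbT; rewrite -leNgt => s0.
by rewrite concat_before// (le_lt_trans _ sth)// ge_min lexx.
Qed.

Let cc := control_path_concat.

Lemma law_concat_before A : measurable A -> A `<=` `]-oo, th[%classic ->
  law T0 (c ^~ w) A = law T0 (X ^~ w) A.
Proof.
move=> mA Ath.
rewrite -[RHS]mul1e; apply: scaled_law_unique Ath _ => // t; rewrite mul1e.
rewrite setIC -(setCitvl (BRight t)) -setDE.
rewrite !measureD//= ?(fin_num_measure, ltey_eq)//.
rewrite -!left_valE// left_val_concat; congr (_ - _)%E.
have [tht|tth] := leP th t.
  rewrite setIidl; last first.
    by move=> s; rewrite /= !in_itv/= => /ltW/le_trans; apply.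
  by rewrite -!left_valE// left_val_concat.
rewrite setIidr; last first.
  by move=> s; rewrite /= !in_itv/= => /le_lt_trans; apply.
rewrite !law_path//; congr EFin; rewrite /path; case: ifP => // /negbT; rewrite -leNgt => s0.
by rewrite concat_before// (le_lt_trans _ tth)// ge_min lexx.
Qed.

(** The atom at theta is included: as [x] is 0 at theta-, the concatenation jumps there from a to a
    + (1 - a) x_theta, which is 1 - a times the jump of [x]. *)
Lemma law_concat_after A : measurable A -> A `<=` `[th, +oo[%classic ->
  law T0 (c ^~ w) A = ((1 - a)%:E * law T0 (x ^~ w) A)%E.
Proof.
move=> mA Ath.
apply: scaled_law_unique Ath _ => // t.
rewrite -(setCitvl (BRight t)).
have [tht|tth] := ltP t th.
  rewrite setIidr; last first.
    move=> s; rewrite /= !in_itv/= andbT => ths; apply/negP; rewrite -ltNge.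
    exact: lt_le_trans ths.
  rewrite -(setCitvl (BLeft th)) !probability_setC// -!left_valE// left_val_concat.
  by rewrite x0 sube0 mule1.
rewrite setIidl; last first.
  move=> s; rewrite /= !in_itv/= andbT => /negP; rewrite -ltNge => /ltW.
  exact: le_trans.
rewrite !probability_setC// !law_path// -!EFinB -EFinM; congr EFin.
have t0 : 0 <= t by apply: le_trans tth; case/andP: tT.
have [Tt|tT1] := leP T t; first by rewrite (path_geT T0 cc Tt) (path_geT T0 cx Tt) !subrr mulr0.
by rewrite !path_itv ?t0 ?ltW// concat_after//; ring.
Qed.

Lemma jump_concat_before t : 0 <= t -> t < th -> jump T c t w = jump T X t w.
Proof.
move=> t0 tth; have tT' : 0 <= t <= T.
  by rewrite t0 (le_trans (ltW tth))//; case/andP: tT.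
apply: EFin_inj; rewrite !jumpE//; apply: law_concat_before => //.
by move=> s ->; rewrite /= in_itv.
Qed.

Lemma jump_concat_after t : th <= t -> t <= T ->
  jump T c t w = (1 - a) * jump T x t w.
Proof.
move=> tht tT1; have tT' : 0 <= t <= T.
  by rewrite tT1 (le_trans _ tht)//; case/andP: tT.
apply: EFin_inj; rewrite EFinM !jumpE//; apply: law_concat_after => //.
by move=> s ->; rewrite /= in_itv/= andbT.
Qed.

(** [b] stands for the remaining mass of the opponent: an integrand built on the opponent's
    concatenated control equals, from theta on, [b] times the one built on the control after theta.
    With the factor 1 - a of the law this gives the product of masses in [payoff_concat]. *)
Lemma Rintegral_law_concat (k k1 k2 : R -> R) (b M : R) (E : set R) :
  measurable E -> E `<=` `[th, +oo[%classic -> E `<=` `[0, T]%classic ->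
  measurable_fun `[0, T]%classic k ->
  measurable_fun `[0, T]%classic k1 -> measurable_fun `[0, T]%classic k2 ->
  (forall t, 0 <= t <= T -> `|k t| <= M) ->
  (forall t, 0 <= t <= T -> `|k2 t| <= M) ->
  (forall t, 0 <= t < th -> k t = k1 t) -> (forall t, E t -> k t = b * k2 t) ->
  \int[law T0 (c ^~ w)]_(t in `[0, th[%classic `|` E) k t =
  \int[law T0 (X ^~ w)]_(t in `[0, th[%classic) k1 t +
  (1 - a) * b * \int[law T0 (x ^~ w)]_(t in E) k2 t.
Proof.
move=> mE Eth ET mk mk1 mk2 kM k2M k1E k2E.
have thT : th <= T by case/andP: tT.
have D0 : `[0, th[%classic `<=` `[0, T]%classic.
  by move=> t; rewrite /= !in_itv/= => /andP[-> /ltW/le_trans->].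
have DET : `[0, th[%classic `|` E `<=` `[0, T]%classic by move=> t [/D0|/ET].
have kM' A t : A `<=` `[0, T]%classic -> A t -> `|k t| <= M.
  by move=> AT /AT/=; rewrite in_itv/=; exact: kM.
rewrite Rintegral_setU//; last 2 first.
- apply: (@integrable_bounded _ _ _ _ M) => [||t].
  + exact: measurableU.
  + exact: measurable_funS mk.
  + exact: kM'.
- apply/disj_setPS => t [/=]; rewrite in_itv/= => /andP[_ tth] /Eth/=.
  by rewrite in_itv/= andbT leNgt tth.
congr (_ + _).
  rewrite /Rintegral (eq_measure_integral (law T0 (X ^~ w))).
    by congr fine; apply: eq_integral => t; rewrite inE/= in_itv/= => tth; rewrite k1E.
  move=> A mA AD; apply: law_concat_before => // t /AD/=.
  by rewrite !in_itv/= => /andP[].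
have ik2 : (law T0 (x ^~ w)).-integrable E (EFin \o k2).
  apply: (@integrable_bounded _ _ _ _ M) => // [|t /ET/=].
    exact: measurable_funS mk2.
  by rewrite in_itv/=; exact: k2M.
transitivity (\int[mscale (NngNum a0) (law T0 (x ^~ w))]_(t in E) (b * k2 t)).
  rewrite /Rintegral; congr fine.
  rewrite (eq_measure_integral (mscale (NngNum a0) (law T0 (x ^~ w)))).
    by apply: eq_integral => t; rewrite inE => Et; rewrite k2E.
  by move=> A mA AE; exact: (law_concat_after mA (subset_trans AE Eth)).
have mb : measurable_fun E (fun t => (b * k2 t)%:E).
  apply/measurable_EFinP; apply: measurable_funM => //; exact: measurable_funS mk2.
have ib : (law T0 (x ^~ w)).-integrable E (fun t => (b * k2 t)%:E).
  rewrite (_ : (fun t => _) = (fun t => b%:E * (EFin \o k2) t)%E); first exact: integrableZl.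
  by apply/funext => t; rewrite EFinM.
rewrite /Rintegral integralE !ge0_integral_mscale//; last 2 first.
- exact: (measurable_funeneg mb).
- exact: (measurable_funepos mb).
rewrite -muleBr//; last first.
  by apply: fin_num_adde_defr; exact: integrable_pos_fin_num.
rewrite -integralE/= fineM//; last exact: integrable_fin_num.
rewrite -mulrA; congr (_ * _).
have : \int[law T0 (x ^~ w)]_(t in E) (b * k2 t) =
    b * \int[law T0 (x ^~ w)]_(t in E) k2 t by rewrite RintegralZl.
exact.
Qed.

End one_path.

Lemma payoff_concat (f g h : R -> Omega -> R) X Z x z theta w (M : R) :
  control_path T (X ^~ w) -> control_path T (x ^~ w) ->
  control_path T (Z ^~ w) -> control_path T (z ^~ w) ->
  0 <= theta w <= T ->
  left_val T x (theta w) w = 0 -> left_val T z (theta w) w = 0 ->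
  measurable_fun `[0, T]%classic (f ^~ w) ->
  measurable_fun `[0, T]%classic (g ^~ w) ->
  measurable_fun `[0, T]%classic (h ^~ w) ->
  (forall t, 0 <= t <= T -> `|f t w| <= M) ->
  (forall t, 0 <= t <= T -> `|g t w| <= M) ->
  (forall t, 0 <= t <= T -> `|h t w| <= M) ->
  payoff_functional T f g h (concat X theta x) (concat Z theta z)
    (fun=> `[0, T[%classic) (fun=> `[0, T]%classic) w =
  payoff_functional T f g h X Z
    (fun w => `[0, theta w[%classic) (fun w => `[0, theta w[%classic) w +
  (1 - left_val T X (theta w) w) * (1 - left_val T Z (theta w) w) *
  payoff_functional T f g h x z
    (fun w => `[theta w, T[%classic) (fun w => `[theta w, T]%classic) w.
Proof.
move=> cX cx cZ cz tT x0 z0 mf mg mh fM gM hM.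
have cX' := control_path_concat cX cx tT; have cZ' := control_path_concat cZ cz tT.
have /andP[t0 t1] := tT.
have sub0 : `[0, theta w[%classic `<=` `[0, T]%classic.
  by move=> t; rewrite /= !in_itv/= => /andP[-> /ltW/le_trans->].
have subo : `[theta w, T[%classic `<=` `[0, T]%classic.
  by move=> t; rewrite /= !in_itv/= => /andP[/(le_trans t0) -> /ltW].
have subc : `[theta w, T]%classic `<=` `[0, T]%classic.
  by move=> t; rewrite /= !in_itv/= => /andP[/(le_trans t0) ->].
have sub1 : `[0, T[%classic `<=` `[0, T]%classic.
  by move=> t; rewrite /= !in_itv/= => /andP[-> /ltW].
rewrite !(@payoff_functional_law _ _ _ _ T0 _ _ _ _ _ _ _ _ M)//.
have splito : `[0, T[%classic = `[0, theta w[%classic `|` `[theta w, T[%classic.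
  by rewrite -itv_bndbnd_setU// bnd_simp.
have splitc : `[0, T]%classic = `[0, theta w[%classic `|` `[theta w, T]%classic.
  by rewrite -itv_bndbnd_setU// bnd_simp.
have m1 (k : R -> R) y : measurable_fun `[0, T]%classic k ->
    control_path T (y ^~ w) ->
    measurable_fun `[0, T]%classic (fun t => k t * (1 - y t w)).
  move=> mk cy; apply: measurable_funM => //; apply: measurable_funB => //.
  exact: measurable_path.
have b1 (k : R -> R) y : (forall t, 0 <= t <= T -> `|k t| <= M) ->
    control_path T (y ^~ w) ->
    forall t, 0 <= t <= T -> `|k t * (1 - y t w)| <= M.
  move=> kM cy t tT'; rewrite normrM (le_trans _ (kM t tT'))// ler_piMr//.
  have /andP[y0 y1] := control_path_itv cy tT'.
  by rewrite ger0_norm ?subr_ge0// gerBl.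
have b2 (k : R -> R) y : (forall t, 0 <= t <= T -> `|k t| <= M) ->
    control_path T (y ^~ w) ->
    forall t, 0 <= t <= T -> `|k t * jump T y t w| <= M.
  move=> kM cy t tT'; rewrite normrM (le_trans _ (kM t tT'))// ler_piMr//.
  have /andP[y0 y1] := jump_itv T0 cy tT'.
  by rewrite ger0_norm.
have m2 (k : R -> R) y : measurable_fun `[0, T]%classic k ->
    control_path T (y ^~ w) ->
    measurable_fun `[0, T]%classic (fun t => k t * jump T y t w).
  by move=> mk cy; apply: measurable_funM => //; exact: measurable_jump.
have itvo : `[theta w, T[%classic `<=` `[theta w, +oo[%classic.
  by move=> t; rewrite /= !in_itv/= andbT => /andP[].
have itvc : `[theta w, T]%classic `<=` `[theta w, +oo[%classic.
  by move=> t; rewrite /= !in_itv/= andbT => /andP[].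
have term1 (Y y V v : R -> Omega -> R) (k : R -> R) :
    control_path T (Y ^~ w) -> control_path T (y ^~ w) ->
    control_path T (V ^~ w) -> control_path T (v ^~ w) ->
    left_val T y (theta w) w = 0 ->
    measurable_fun `[0, T]%classic k -> (forall t, 0 <= t <= T -> `|k t| <= M) ->
    \int[law T0 (concat Y theta y ^~ w)]_(t in `[0, T[%classic)
      (k t * (1 - concat V theta v t w)) =
    \int[law T0 (Y ^~ w)]_(t in `[0, theta w[%classic) (k t * (1 - V t w)) +
    (1 - left_val T Y (theta w) w) * (1 - left_val T V (theta w) w) *
    \int[law T0 (y ^~ w)]_(t in `[theta w, T[%classic) (k t * (1 - v t w)).
  move=> cY cy cV cv y0 mk kM; rewrite splito.
  apply: (@Rintegral_law_concat _ _ _ _ cY cy tT y0 _ _ _ _ M) => //.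
  - by apply: m1 => //; exact: control_path_concat.
  - exact: m1.
  - exact: m1.
  - by apply: b1 => //; exact: control_path_concat.
  - exact: b1.
  - by move=> t /andP[_ tt]; rewrite concat_before.
  - move=> t /=; rewrite in_itv/= => /andP[tt _]; rewrite concat_after//; ring.
have term2 : \int[law T0 (concat X theta x ^~ w)]_(t in `[0, T]%classic)
      (h t w * jump T (concat Z theta z) t w) =
    \int[law T0 (X ^~ w)]_(t in `[0, theta w[%classic) (h t w * jump T Z t w) +
    (1 - left_val T X (theta w) w) * (1 - left_val T Z (theta w) w) *
    \int[law T0 (x ^~ w)]_(t in `[theta w, T]%classic) (h t w * jump T z t w).
  rewrite splitc.
  apply: (@Rintegral_law_concat _ _ _ _ cX cx tT x0 _ _ _ _ M) => //.
  - exact: m2.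
  - exact: m2.
  - exact: m2.
  - exact: b2.
  - exact: b2.
  - by move=> t /andP[tt0 tt]; rewrite jump_concat_before.
  - move=> t /=; rewrite in_itv/= => /andP[tt tt1].
    by rewrite jump_concat_after//; ring.
rewrite !term1// term2 [in X in _ + X + _ = _]mulrAC; ring.
Qed.

End concatenation.

Lemma measurable_wrt_le {d} {Omega : measurableType d} {R : realType}
    (G : set (set Omega)) (X : Omega -> R) : sigma_algebra setT G ->
  (forall c, G [set w | X w <= c]) -> measurable_wrt G X.
Proof.
move=> sG GX; apply/(measurable_wrtP sG) => mT.
apply: (measurability _ (RGenOInfty.measurableE R)) => // _ [_ [c ->] <-].
rewrite setTI (_ : _ @^-1` _ = ~` [set w | X w <= c]).
  by apply: measurableC; rewrite (measurable_subsigmaE sG).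
by apply/seteqP; split => w/=; rewrite in_itv/= andbT ltNge => /negP.
Qed.

Lemma sigma_algebra_bigcap_count {d} {Omega : measurableType d} {I : countType}
    (G : set (set Omega)) (A : I -> set Omega) : sigma_algebra setT G ->
  (forall i, G (A i)) -> G (\bigcap_i A i).
Proof.
move=> sG GA; pose A' n := if unpickle n is Some i then A i else setT.
rewrite (_ : \bigcap_i A i = \bigcap_n A' n).
  apply: (sigma_algebra_bigcap sG) => n; rewrite /A'; case: unpickle => [i|].
    exact: GA.
  exact: (sigma_algebra_setT sG).
apply/seteqP; split => w h.
  by move=> n _; rewrite /A'; case: unpickle => [i|//]; exact: h.
by move=> i _; have := h (pickle i) Logic.I; rewrite /A' pickleK.
Qed.

Lemma measurable_funV_ge0 {d} {Omega : measurableType d} {R : realType}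
    (Y : Omega -> R) : (forall w, 0 <= Y w) -> measurable_fun setT Y ->
  measurable_fun setT (fun w => (Y w)^-1).
Proof.
move=> Y0 mY mT; apply: (measurability _ (RGenOInfty.measurableE R)) => //.
move=> _ [_ [c ->] <-]; rewrite setTI.
rewrite (_ : _ @^-1` _ = ~` [set w | (Y w)^-1 <= c]); last first.
  by apply/seteqP; split => w/=; rewrite in_itv/= andbT ltNge => /negP.
apply: measurableC; have [c0|c0] := ltP c 0.
  rewrite (_ : mkset _ = set0)//; apply/seteqP; split => w //= /le_lt_trans/(_ c0).
  by rewrite invr_lt0 ltNge Y0.
rewrite (_ : mkset _ = [set w | Y w <= 0] `|` [set w | 1 <= c * Y w]).
  apply: measurableU; apply: measurable_set_ler => //.
  exact: measurable_funM.
apply/seteqP; split => w /=.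
  have [Yw|Yw] := leP (Y w) 0; first by left.
  by rewrite -div1r ler_pdivrMr//; right.
have [Yw _|Yw [|]] := leP (Y w) 0.
- have -> : Y w = 0 by apply/eqP; rewrite eq_le Yw Y0.
  by rewrite invr0.
- by [].
- by rewrite -div1r ler_pdivrMr.
Qed.

Lemma measurable_funV {d} {Omega : measurableType d} {R : realType}
    (Y : Omega -> R) : measurable_fun setT Y ->
  measurable_fun setT (fun w => (Y w)^-1).
Proof.
move=> mY; rewrite (_ : (fun w => _) =
    (fun w => (Num.max (Y w) 0)^-1 - (Num.max (- Y w) 0)^-1)).
  apply: measurable_funB; apply: measurable_funV_ge0.
  - by move=> w; rewrite le_max lexx orbT.
  - exact: measurable_maxr.
  - by move=> w; rewrite le_max lexx orbT.
  - by apply: measurable_maxr => //; exact: measurableT_comp.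
apply/funext => w; have [Y0|Y0] := leP (Y w) 0.
  by rewrite max_l ?oppr_ge0// invr0 sub0r invrN opprK.
by rewrite max_r ?oppr_le0 ?ltW// invr0 subr0.
Qed.

(** * Controls under concatenation, truncation and pasting at a stopping time *)

Section controls.
Context {R : realType} {d : measure_display} {Omega : measurableType d}.
Variables (P : probability Omega R) (T : R).
Hypothesis T0 : 0 < T.
Implicit Types (X x y : R -> Omega -> R) (theta : Omega -> R) (w : Omega).
Implicit Types (s t : R).

(** Monotonicity and the left limit let the rational times before [th] decide. The bound 0 <= c
    accounts for th = 0, where no earlier time is left and the left value is 0. *)
Lemma left_val_leP X w th (c : R) : control_path T (X ^~ w) -> 0 <= th <= T ->
  0 <= c -> left_val T X th w <= c <->
  (forall q : rat, 0 <= (ratr q : R) -> ratr q < th -> X (ratr q) w <= c).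
Proof.
move=> cX /andP[th0 thT] c0; split.
  move=> lc q q0 qth; apply: le_trans lc; rewrite -(path_itv (T := T)).
    exact: (left_val_ge T0 cX).
  by rewrite q0 (le_trans (ltW qth)).
move=> Xq; rewrite leNgt; apply/negP => cl.
have := @cvg_left_val _ _ T0 _ _ X w cX th => /cvgr_gt/(_ _ cl)/at_leftP[e e0 eP].
have [q] : exists q : rat, ratr q \in `]th - e, th[.
  by apply: rat_in_itvoo; rewrite ltrBlDr ltrDl.
rewrite in_itv/= => /andP[eq qth]; have := eP _ qth eq.
have [q0|q0] := ltP (ratr q : R) 0; first by rewrite path_lt0// ltNge c0.
rewrite path_itv; last by rewrite q0 (le_trans (ltW qth)).
by rewrite ltNge Xq.
Qed.

Lemma left_val_cst0 x t w : (forall s, 0 <= s -> s < t -> x s w = 0) -> t <= T ->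
  left_val T x t w = 0.
Proof.
move=> xt tT; apply: cvg_lim => //; apply: cvg_near_cst.
apply/at_leftP; exists 1 => // s st _; rewrite /path; case: ifP => // /negbT.
rewrite -leNgt => s0; rewrite xt//; last by rewrite (le_lt_trans _ st)// ge_min lexx.
by rewrite le_min s0 ltW.
Qed.

Lemma left_val_eq x y t w : (forall s, x s w = y s w) ->
  left_val T x t w = left_val T y t w.
Proof.
move=> xy; rewrite /left_val (_ : path T x w = path T y w)//.
by apply/funext => s; rewrite /path xy.
Qed.

Section adaptedness.
Variable G : R -> set (set Omega).
Hypothesis fG : filtration P T G.
Variable theta : Omega -> R.
Hypothesis st : stopping_time T G theta.

Let thetaT w : 0 <= theta w <= T. Proof. by case: st. Qed.

Let sG t : 0 <= t <= T -> sigma_algebra setT (G t).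
Proof. exact: (filtration_sigma_algebra fG). Qed.

(** On {theta <= t} and for c >= 0, the left value is at most c exactly when, for every rational q
    in [0, t], theta <= q or X_q <= c; each of these countably many conditions is known at time
    q. *)
Lemma left_val_sigma_at X : adapted T G X -> (forall w, control_path T (X ^~ w)) ->
  measurable_wrt (sigma_at T G theta) (fun w => left_val T X (theta w) w).
Proof.
move=> aX cX; apply: measurable_wrt_le => [|c t tT].
  exact: (sigma_at_sigma_algebra fG st).
have /andP[t0 t1] := tT.
have [c0|c0] := ltP c 0.
  rewrite (_ : _ `&` _ = set0); first exact: sigma_algebra_set0 (sG tT).
  apply/seteqP; split => w //= [/le_lt_trans/(_ c0)].
  by rewrite ltNge; have /andP[->] := left_val_itv T0 (cX w) (theta w).
pose A (q : rat) := if 0 <= (ratr q : R) <= t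
  then [set w | theta w <= ratr q] `|` [set w | X (ratr q) w <= c] else setT.
rewrite (_ : _ `&` _ = [set w | theta w <= t] `&` \bigcap_q A q).
  apply: (sigma_algebraI (sG tT)); first exact: (stopping_time_le st).
  apply: sigma_algebra_bigcap_count => [|q]; first exact: sG.
  rewrite /A; case: ifPn => [/andP[q0 qt]|_]; last exact: (sigma_algebra_setT (sG tT)).
  apply: (filtration_le fG q0 qt t1).
  have qT : 0 <= (ratr q : R) <= T by rewrite q0 (le_trans qt).
  apply: (sigma_algebraU (sG qT)).
    by apply: (stopping_time_le st) => //; case/andP: qT.
  rewrite (_ : [set w | _] = X (ratr q) @^-1` `]-oo, c]%classic).
    by apply: aX => //; exact: measurable_itv.
  by apply/seteqP; split => w; rewrite /= in_itv.
apply/seteqP; split => w /=.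
  move=> [lc tt]; split => // q _; rewrite /A; case: ifP => // /andP[q0 qt].
  have [tq|qth] := leP (theta w) (ratr q); [by left|right].
  exact: (iffLR (left_val_leP (cX w) (thetaT w) c0)).
move=> [tt h]; split => //; apply/(left_val_leP (cX w) (thetaT w) c0) => q q0 qth.
have := h q Logic.I; rewrite /A q0 (le_trans (ltW qth))//= => -[/=|//].
by rewrite leNgt qth.
Qed.

Lemma stopped_wrt (Y : Omega -> R) t : 0 <= t <= T ->
  measurable_wrt (sigma_at T G theta) Y ->
  measurable_wrt (G t) (fun w => if theta w <= t then Y w else 0).
Proof.
move=> tT mY B mB; have /andP[t0 t1] := tT.
have Gt : G t [set w | theta w <= t] by exact: (stopping_time_le st).
rewrite (_ : _ @^-1` B = (Y @^-1` B `&` [set w | theta w <= t]) `|`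
   (~` [set w | theta w <= t] `&` (cst 0 : Omega -> R) @^-1` B)).
  apply: (sigma_algebraU (sG tT)); first exact: mY.
  apply: (sigma_algebraI (sG tT)); first exact: (sigma_algebraC (sG tT)).
  rewrite preimage_cst; case: ifPn => _; first exact: (sigma_algebra_setT (sG tT)).
  exact: (sigma_algebra_set0 (sG tT)).
apply/seteqP; split => w /=.
  by case: ifPn => [tt YB|/negP]; [left|right].
by move=> [[YB ->]//|[/negP/negbTE->]].
Qed.

Lemma measurable_wrt_indic t A : 0 <= t <= T -> G t A ->
  measurable_fun setT (\1_A : g_sigma_algebraType (G t) -> R).
Proof.
move=> tT GA; apply: measurable_indic; rewrite (measurable_subsigmaE (sG tT))//.
Qed.

Lemma concat_control X x : control T G (cst 0) X -> control T G theta x ->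
  control T G (cst 0) (concat T X theta x).
Proof.
move=> cX cx; have pX := control_control_path cX; have px := control_control_path cx.
have x0 w : left_val T x (theta w) w = 0 by case: cx.
have pc w : control_path T (concat T X theta x ^~ w) by exact: control_path_concat.
split.
- move=> t tT; have [aX _ _ _ _] := cX; have [ax _ _ _ _] := cx.
  have lv := stopped_wrt tT (left_val_sigma_at aX pX).
  pose D := [set w | theta w <= t].
  have GD : G t D by case/andP: (tT) => t0 t1; exact: (stopping_time_le st).
  pose V w := if theta w <= t then left_val T X (theta w) w else 0.
  rewrite (_ : concat T X theta x t = fun w => \1_D w * (V w + (1 - V w) * x t w) +
      (1 - \1_D w) * X t w).
    apply/(measurable_wrtP (sG tT)); apply: measurable_funD.
      apply: measurable_funM; first exact: measurable_wrt_indic.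
      apply: measurable_funD; first exact/(measurable_wrtP (sG tT)).
      apply: measurable_funM; last exact/(measurable_wrtP (sG tT))/ax.
      by apply: measurable_funB => //; exact/(measurable_wrtP (sG tT)).
    apply: measurable_funM; last exact/(measurable_wrtP (sG tT))/aX.
    by apply: measurable_funB => //; exact: measurable_wrt_indic.
  apply/funext => w; rewrite /concat /V indicE /D.
  case: ifPn => tt; first by rewrite mem_set// mul1r subrr mul0r addr0.
  by rewrite memNset ?mul0r ?subr0 ?mul1r ?add0r//; exact/negP.
- exact: cadlag_control_path.
- by move=> w; case: (pc w).
- by move=> w; apply: left_val_cst0; [move=> s s0 /lt_geF; rewrite s0|exact: ltW].
- by move=> w; case: (pc w).
Qed.

(** One form for both cases of the quotient: [k] = 0 and [r] = 1 when no mass remains at theta-, the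
    usual normalisation otherwise. Monotonicity, right-continuity and nonnegativity of the
    truncation are then read off from those of [X]. *)
Lemma truncated_affine X w : control_path T (X ^~ w) ->
  let a := left_val T X (theta w) w in
  exists k r : R, [/\ 0 <= k, 0 <= k * a + r, k + r = 1 &
    forall t, theta w <= t -> t <= T -> truncated T X theta t w = k * X t w + r].
Proof.
move=> cX a; have /andP[a0 a1] := left_val_itv T0 cX (theta w).
have [a1E|a1N] := eqVneq (1 - a) 0.
  exists 0, 1; split; rewrite ?mul0r ?add0r// => t tt _.
  by rewrite /truncated tt /ratio -/a a1E eqxx mul0r add0r.
have a1' : 0 < 1 - a by rewrite lt_neqAle eq_sym a1N subr_ge0.
exists (1 - a)^-1, (- a / (1 - a)); split.
- by rewrite invr_ge0 ltW.
- by rewrite mulrC mulNr subrr.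
- by rewrite mulNr -[X in X - _]mul1r -mulrBl divff.
- move=> t tt _; rewrite /truncated tt /ratio -/a (negbTE a1N) mulrBl mulNr.
  by rewrite [X t w / _]mulrC.
Qed.

Lemma truncated_control X : control T G (cst 0) X ->
  control T G theta (truncated T X theta).
Proof.
move=> cX; have pX := control_control_path cX.
have before t w : t < theta w -> truncated T X theta t w = 0.
  by rewrite /truncated ltNge => /negbTE->.
have pc w : control_path T (truncated T X theta ^~ w).
  have [k [r [k0 ka kr tE]]] := truncated_affine (pX w).
  have [Xr X0 Xm XT] := pX w; have /andP[th0 thT] := thetaT w.
  have Xa t : theta w <= t -> t <= T -> left_val T X (theta w) w <= X t w.
    move=> tt t1; rewrite (le_trans (left_val_le T0 (pX w) _))// path_itv//.
    exact: Xm.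
  have pos t : theta w <= t -> t <= T -> 0 <= truncated T X theta t w.
    move=> tt t1; rewrite tE// (le_trans ka)// lerD2r ler_wpM2l//; exact: Xa.
  split.
  - move=> t /andP[t0 t1]; have [tht|tth] := leP (theta w) t.
      rewrite (tE t tht (ltW t1)).
      apply: (@cvg_trans _ ((fun s => k * X s w + r) @ t^'+)).
        apply: near_eq_cvg; apply/at_rightP; exists (T - t); rewrite ?subr_gt0// => s ts.
        rewrite addrC subrK => sT; rewrite tE//; last exact: ltW.
        by rewrite (le_trans tht)// ltW.
      apply: cvgD; last exact: cvg_cst.
      by apply: cvgMr; apply: Xr; rewrite t0.
    rewrite before//; apply: cvg_near_cst.
    apply/at_rightP; exists (theta w - t); rewrite ?subr_gt0// => s ts.
    by rewrite addrC subrK => sth; rewrite before.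
  - by have [tht|tth] := leP (theta w) 0; [apply: pos => //; exact: ltW|rewrite before].
  - move=> s t s0 s_t t1; have [ths|sth] := leP (theta w) s.
      rewrite !tE//; [|exact: le_trans s_t|exact: le_trans t1].
      by rewrite lerD2r ler_wpM2l// Xm.
    rewrite before//; have [tht|tth] := leP (theta w) t; first exact: pos.
    by rewrite before.
  - by rewrite tE// XT mulr1.
split.
- move=> t tT; have [aX _ _ _ _] := cX.
  have lv := stopped_wrt tT (left_val_sigma_at aX pX).
  pose D := [set w | theta w <= t].
  have GD : G t D by case/andP: (tT) => t0 t1; exact: (stopping_time_le st).
  pose V w := if theta w <= t then left_val T X (theta w) w else 0.
  have mV : measurable_fun setT (fun w : g_sigma_algebraType (G t) => 1 - V w).
    by apply: measurable_funB => //; exact/(measurable_wrtP (sG tT)).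
  rewrite (_ : truncated T X theta t = fun w => \1_D w *
      ((X t w - V w) * (1 - V w)^-1 + \1_[set w | 1 - V w = 0] w)).
    apply/(measurable_wrtP (sG tT)); apply: measurable_funM.
      exact: measurable_wrt_indic.
    apply: measurable_funD.
      apply: measurable_funM.
        apply: measurable_funB; first exact/(measurable_wrtP (sG tT))/aX.
        exact/(measurable_wrtP (sG tT)).
      apply: measurable_funV_ge0 => // w; rewrite /V; case: ifP => _.
        by rewrite subr_ge0; case/andP: (left_val_itv T0 (pX w) (theta w)).
      by rewrite subr0.
    apply: measurable_indic; rewrite -[X in measurable X]setTI.
    exact: (mV measurableT [set 0]).
  apply/funext => w; rewrite /truncated /V !indicE /D.
  case: ifPn => tt; last by rewrite memNset ?mul0r//; exact/negP.
  rewrite mem_set// mul1r /ratio; case: eqVneq => e.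
    by rewrite e invr0 mulr0 add0r mem_set//= tt.
  by rewrite memNset ?addr0//= tt; exact/eqP.
- exact: cadlag_control_path.
- by move=> w; case: (pc w).
- move=> w; apply: left_val_cst0; last by case/andP: (thetaT w).
  by move=> s _; exact: before.
- by move=> w; case: (pc w).
Qed.

(** When no mass remains at theta-, monotonicity and X_T = 1 force X = 1 from theta on, which is the
    value of the concatenation. *)
Lemma concat_truncated X w t : control_path T (X ^~ w) -> 0 <= t <= T ->
  concat T X theta (truncated T X theta) t w = X t w.
Proof.
move=> cX /andP[t0 t1]; rewrite /concat; case: ifPn => // tt.
rewrite /truncated tt /ratio; set a := left_val _ _ _ _.
case: eqVneq => e; last by rewrite mulrC divfK// addrC subrK.
have a1 : a = 1 by apply/eqP; rewrite eq_sym -subr_eq0; apply/eqP.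
rewrite a1 subrr mul0r addr0; have [_ _ Xm XT] := cX; have /andP[th0 thT] := thetaT w.
apply/eqP; rewrite eq_le -{2}XT Xm// -a1 (le_trans (left_val_le T0 cX _))//.
by rewrite path_itv// Xm.
Qed.

Definition paste (A : set Omega) x y : R -> Omega -> R :=
  fun t w => if w \in A then x t w else y t w.

(** [A] is only known at theta, but both controls vanish before theta, so at time t the choice
    matters only on [A] intersected with {theta <= t}, an event of [G t]. *)
Lemma paste_control A x y : sigma_at T G theta A ->
  control T G theta x -> control T G theta y -> control T G theta (paste A x y).
Proof.
move=> GA cx cy.
have px := control_control_path cx; have py := control_control_path cy.
have [ax _ _ x0 _] := cx; have [ay _ _ y0 _] := cy.
have pc w : control_path T (paste A x y ^~ w).
  have pE : paste A x y ^~ w = if w \in A then x ^~ w else y ^~ w.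
    by apply/funext => t; rewrite /paste; case: ifP.
  by rewrite pE; case: ifP => _; [exact: px|exact: py].
have x_before t w : 0 <= t -> t < theta w -> x t w = 0.
  move=> t0 tth; have /andP[_ thT] := thetaT w.
  rewrite -(path_itv (T := T)); first exact: (path_before T0 (px w) (x0 w)).
  by rewrite t0 (le_trans (ltW tth)).
have y_before t w : 0 <= t -> t < theta w -> y t w = 0.
  move=> t0 tth; have /andP[_ thT] := thetaT w.
  rewrite -(path_itv (T := T)); first exact: (path_before T0 (py w) (y0 w)).
  by rewrite t0 (le_trans (ltW tth)).
split.
- move=> t tT; pose D := A `&` [set w | theta w <= t].
  have GD : G t D by exact: GA.
  rewrite (_ : paste A x y t = fun w => \1_D w * x t w + (1 - \1_D w) * y t w).
    apply/(measurable_wrtP (sG tT)); apply: measurable_funD; apply: measurable_funM.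
    + exact: measurable_wrt_indic.
    + exact/(measurable_wrtP (sG tT))/ax.
    + by apply: measurable_funB => //; exact: measurable_wrt_indic.
    + exact/(measurable_wrtP (sG tT))/ay.
  apply/funext => w; rewrite /paste indicE /D in_setI.
  case: (w \in A); last by rewrite mul0r subr0 mul1r add0r.
  have [tt|tt] := leP (theta w) t.
    by rewrite mem_set//= mul1r subrr mul0r addr0.
  have t0 : 0 <= t by case/andP: tT.
  by rewrite x_before// y_before// !mulr0 addr0.
- exact: cadlag_control_path.
- by move=> w; case: (pc w).
- move=> w; rewrite -[RHS](_ : left_val T (if w \in A then x else y) (theta w) w = 0).
    by apply: left_val_eq => s; rewrite /paste; case: ifP.
  by case: ifP.
- by move=> w; case: (pc w).
Qed.

End adaptedness.

Lemma payoff_functional_eq (f g h x y x' y' : R -> Omega -> R) A B w :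
  A w `<=` `[0, T]%classic -> B w `<=` `[0, T]%classic ->
  (forall t, 0 <= t <= T -> x t w = x' t w) ->
  (forall t, 0 <= t <= T -> y t w = y' t w) ->
  payoff_functional T f g h x y A B w = payoff_functional T f g h x' y' A B w.
Proof.
move=> AT BT xx yy.
have pathE (u v : R -> Omega -> R) : (forall t, 0 <= t <= T -> u t w = v t w) ->
    path T u w = path T v w.
  move=> uv; apply/funext => s; rewrite /path; case: ifP => // /negbT.
  by rewrite -leNgt => s0; rewrite uv// le_min s0 ltW//= ge_min lexx orbT.
have px := pathE _ _ xx; have py := pathE _ _ yy.
have AT' t : A w t -> 0 <= t <= T by move=> /AT/=; rewrite in_itv.
have BT' t : B w t -> 0 <= t <= T by move=> /BT/=; rewrite in_itv.
rewrite /payoff_functional /dpath px py; congr (_ + _ + _).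
- by apply: eq_Rintegral => t; rewrite inE => /AT' tT; rewrite yy.
- by apply: eq_Rintegral => t; rewrite inE => /AT' tT; rewrite xx.
- have jE t : B w t -> h t w * jump T y t w * jump T x t w =
      h t w * jump T y' t w * jump T x' t w.
    by move=> /BT' tT; rewrite /jump /left_val px py xx// yy.
  rewrite /real_sum; congr (fine _ - fine _); apply: eq_esum => t Bt.
    by rewrite !funeposE/= jE.
  by rewrite !funenegE/= jE.
Qed.

Lemma payoff_functionalC (f g h x y : R -> Omega -> R) A B w :
  payoff_functional T f g h x y A B w = payoff_functional T g f h y x A B w.
Proof.
rewrite /payoff_functional.
have -> : (fun t => h t w * jump T y t w * jump T x t w) =
    (fun t => h t w * jump T x t w * jump T y t w).
  by apply/funext => t; rewrite mulrAC.
by rewrite [X in X + _ = _]addrC.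
Qed.

End controls.

Definition unif2 {R : realType} : probability (R * R)%type R :=
  (@unif01 R \x @unif01 R)%E.

(** * Expected payoffs of randomised stopping times *)

Section joint_measurability.
Context {R : realType} {d : measure_display} {Omega : measurableType d}.
Variable T : R.
Hypothesis T0 : 0 < T.
Implicit Types (x y phi : R -> Omega -> R) (w : Omega) (t : R).

Definition jointly_measurable phi :=
  measurable_fun ([set: Omega] `*` `[0, T]%classic) (fun z => phi z.2 z.1).

Let cadlag_gnext phi w t : cadlag T phi -> 0 <= t <= T ->
  (fun n => phi (gnext T n t) w) @ \oo --> phi t w.
Proof.
move=> cphi /andP[t0]; rewrite le_eqVlt => /predU1P[->|tT].
  under eq_fun do rewrite gnextT//.
  exact: cvg_cst.
have t0T : 0 <= t < T by rewrite t0.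
have [/(_ t t0T) pt _] := cphi w; apply: cvg_comp pt.
by apply: cvg_trans (cvg_gnext T0 t0T) _; exact: cvg_within.
Qed.

(** By right-continuity [phi] is the limit of its values at [gnext T n t], which are step functions
    of t with measurable coefficients. *)
Lemma cadlag_jointly_measurable phi : cadlag T phi ->
  (forall t, 0 <= t <= T -> measurable_fun setT (phi t)) -> jointly_measurable phi.
Proof.
move=> cphi mphi.
have mD : measurable ([set: Omega] `*` `[0, T]%classic) by exact: measurableX.
apply: (measurable_fun_cvg (h := fun n z => phi (gnext T n z.2) z.1)); last first.
  by move=> z [_ /=]; rewrite in_itv/= => tT; exact: cadlag_gnext.
move=> n; pose I k := `[T * k%:R / 2 ^+ n, T * k.+1%:R / 2 ^+ n[%classic.
have mI k : measurable [set z : Omega * R | I k z.2].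
  rewrite -[X in measurable X]setTI.
  exact: (@measurable_snd _ _ Omega R measurableT (I k) (measurable_itv _)).
apply: (eq_measurable_fun (fun z => \sum_(k < (2 ^ n).+1)
    \1_[set z | I k z.2] z * phi (grid T n k.+1) z.1)).
  move=> z; rewrite inE => -[_ /=]; rewrite in_itv/= => /andP[t0 tT].
  have kn : (gidx T n z.2 < (2 ^ n).+1)%N.
    rewrite ltnS /gidx -(@natrK R (2 ^ n)); apply: le_truncn.
    by rewrite ler_pdivrMr// natrX mulrC ler_pM2l// exprn_gt0.
  pose k0 := Ordinal kn; have /= Ik := gidxP T0 n t0.
  rewrite (bigD1 k0)//= big1 ?addr0 => [|k kk0].
    by rewrite indicE mem_set ?mul1r//= /I/= in_itv.
  rewrite indicE memNset ?mul0r//= /I/= in_itv/=.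
  apply: contraNnot kk0 => /andP[h1 h2]; apply/eqP/val_inj => /=.
  apply/esym/truncn_def.
  rewrite ler_pdivlMr// ltr_pdivrMr// ![_ * T]mulrC.
  by rewrite -ler_pdivrMr ?exprn_gt0// -ltr_pdivlMr ?exprn_gt0// h1 h2.
apply: measurable_funTS; apply: measurable_sum => k; apply: measurable_funM.
  exact: measurable_indic.
exact: (measurableT_comp (mphi _ (grid_itv T0 n k.+1)) (@measurable_fst _ _ Omega R)).
Qed.

(** Right-continuity reduces the supremum to the countably many grid times; indices that decode to
    nothing contribute 0, below any absolute value. *)
Lemma sup_abs_grid phi w : cadlag T phi -> sup_abs T phi w =
  ereal_sup (range (fun m : nat => if unpickle m is Some ni
    then `|phi (grid T ni.1 ni.2) w|%:E else 0%E)).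
Proof.
move=> cphi; apply/eqP; rewrite eq_le; apply/andP; split.
  apply: ge_ereal_sup => _ [t /= + <-]; rewrite in_itv/= => tT.
  have tc := cadlag_gnext (w := w) cphi tT.
  have : (fun n => `|phi (gnext T n t) w|%:E) @ \oo --> `|phi t w|%:E.
    apply: cvg_EFin; first exact: nearW.
    exact: cvg_norm.
  move=> h; rewrite -(cvg_lim _ h)//; apply: lime_le; first by apply/cvg_ex; eexists; exact: h.
  apply: nearW => n; apply: ereal_sup_ubound.
  by exists (pickle (n, (gidx T n t).+1)) => //; rewrite pickleK.
apply: ge_ereal_sup => _ [m _ <-].
have s0 : (0 <= sup_abs T phi w)%E.
  apply: (@le_trans _ _ `|phi 0 w|%:E); first by rewrite lee_fin.
  by apply: ereal_sup_ubound; exists 0 => //=; rewrite in_itv/= lexx ltW.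
case: unpickle => // -[n i] /=; apply: ereal_sup_ubound.
by exists (grid T n i) => //=; rewrite in_itv/=; exact: grid_itv.
Qed.

Lemma measurable_sup_abs phi : cadlag T phi ->
  (forall t, 0 <= t <= T -> measurable_fun setT (phi t)) ->
  measurable_fun setT (sup_abs T phi).
Proof.
move=> cphi mphi; rewrite (_ : sup_abs T phi = (fun w => ereal_sup (range (fun m : nat =>
    if unpickle m is Some ni then `|phi (grid T ni.1 ni.2) w|%:E else 0%E)))); last first.
  by apply/funext => w; exact: sup_abs_grid.
pose h m w : \bar R :=
  if unpickle m is Some ni then `|phi (grid T ni.1 ni.2) w|%:E else 0%E.
have mh m : measurable_fun setT (h m).
  rewrite /h; case: unpickle => [[n i]|//] /=.
  by apply/measurable_EFinP/measurableT_comp => //; apply: mphi; exact: grid_itv.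
have := @measurable_fun_esups _ _ _ setT h mh 0%N.
congr measurable_fun; apply/funext => w; rewrite /esups; congr ereal_sup.
by apply/seteqP; split => [_ [n _ <-]|_ [n _ <-]]; exists n.
Qed.

Section pair_integral.
Variables (x y : R -> Omega -> R).
Hypotheses (mx : forall t, 0 <= t <= T -> measurable_fun setT (x t))
  (my : forall t, 0 <= t <= T -> measurable_fun setT (y t))
  (cx : forall w, control_path T (x ^~ w)) (cy : forall w, control_path T (y ^~ w)).
Variable D : set (R * R).
Hypothesis mD : measurable D.

Local Notation hx w u := (hitting T (x ^~ w) u).
Local Notation hy w v := (hitting T (y ^~ w) v).

(** The mean, given [w], of phi at tau over the event that (tau, sigma) falls in [D], for
    independent times tau and sigma with the laws of [x] and [y]. The half plane z.1 < z.2 yields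
    the terms in f and g, the diagonal the term in h. *)
Definition pair_integral phi w : \bar R :=
  (\int[law T0 (x ^~ w)]_(t in `[0%R, T]%classic)
    ((phi t w)%:E * law T0 (y ^~ w) (xsection D t)))%E.

(** The same quantity before integration over the two uniform levels [z.2]; its joint measurability
    lets Tonelli apply. *)
Definition pair_kernel phi (z : Omega * (R * R)) : \bar R :=
  (phi (hx z.1 z.2.1) z.1 * \1_D (hx z.1 z.2.1, hy z.1 z.2.2))%:E.

Let mhx : measurable_fun setT (fun z : Omega * (R * R) => hx z.1 z.2.1).
Proof.
apply: (measurableT_comp (measurable_hitting T0 mx cx)
  (g := fun z : Omega * (R * R) => (z.1, z.2.1))).
apply: measurable_fun_pair => //.
exact: (measurableT_comp measurable_fst measurable_snd).
Qed.

Let mhy : measurable_fun setT (fun z : Omega * (R * R) => hy z.1 z.2.2).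
Proof.
apply: (measurableT_comp (measurable_hitting T0 my cy)
  (g := fun z : Omega * (R * R) => (z.1, z.2.2))).
apply: measurable_fun_pair => //.
exact: (measurableT_comp measurable_snd measurable_snd).
Qed.

Lemma measurable_pair_kernel phi : jointly_measurable phi ->
  measurable_fun setT (pair_kernel phi).
Proof.
move=> mphi; apply/measurable_EFinP; apply: measurable_funM.
  apply: (@measurable_comp _ _ _ _ _ _ ([set: Omega] `*` `[0, T]%classic)
    (fun z => phi z.2 z.1) _ (fun z : Omega * (R * R) => (z.1, hx z.1 z.2.1))) => //.
  - exact: measurableX.
  - by move=> _ [z _ <-]; split => //=; rewrite in_itv/= hitting_itv.
  - by apply: measurable_fun_pair.
apply: (@measurableT_comp _ _ _ _ _ _ (\1_D : R * R -> R) _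
  (fun z : Omega * (R * R) => (hx z.1 z.2.1, hy z.1 z.2.2))).
  exact: measurable_indic.
by apply: measurable_fun_pair.
Qed.

Lemma jointly_measurable_section phi w : jointly_measurable phi ->
  measurable_fun `[0, T]%classic (phi ^~ w).
Proof.
move=> mphi; apply: (@measurable_comp _ _ _ _ _ _ ([set: Omega] `*` `[0, T]%classic)
    (fun z => phi z.2 z.1) _ (fun t => (w, t))) => //.
- exact: measurableX.
- by move=> _ [t tT <-].
- by apply: measurable_funTS; exact: pair1_measurable.
Qed.

Lemma pair_integralE phi w : jointly_measurable phi -> (forall t w, 0 <= phi t w) ->
  pair_integral phi w = (\int[unif2]_z pair_kernel phi (w, z))%E.
Proof.
move=> mphi phi0.
have mk : measurable_fun setT (fun z => pair_kernel phi (w, z)).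
  by apply: (measurableT_comp (measurable_pair_kernel mphi)); exact: pair1_measurable.
transitivity (\int[(unif01 \x unif01)%E]_z pair_kernel phi (w, z))%E; last by [].
rewrite fubini_tonelli1//; last first.
  by move=> z; rewrite lee_fin mulr_ge0.
have mhw : measurable_fun setT (hitting T (y ^~ w)) by exact: measurable_hitting_path.
have mxs t : measurable (hitting T (y ^~ w) @^-1` xsection D t).
  by rewrite -[X in measurable X]setTI; apply: mhw => //; exact: measurable_xsection.
rewrite /fubini_F/= /pair_kernel/=.
transitivity (\int[unif01]_u ((phi (hx w u) w)%:E *
    law T0 (y ^~ w) (xsection D (hx w u))))%E; last first.
  apply: eq_integral => u _.
  rewrite (_ : (fun v => _) = (fun v => (phi (hx w u) w)%:E *
      (\1_(hitting T (y ^~ w) @^-1` xsection D (hx w u)) v)%:E)%E); last first.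
    apply/funext => v; rewrite EFinM; congr (_ * _%:E)%E.
    by rewrite !indicE; congr ((_ : bool)%:R); apply/idP/idP; rewrite !inE /xsection/= inE.
  have mI : measurable_fun setT (fun v : R =>
      (\1_(hitting T (y ^~ w) @^-1` xsection D (hx w u)) v)%:E : \bar R).
    by apply/measurable_EFinP; exact: measurable_indic.
  have p0 : (0 <= (phi (hx w u) w)%:E)%E by rewrite lee_fin.
  rewrite ge0_integralZl//.
  by rewrite integral_indic// setIT lawE.
rewrite /pair_integral ge0_integral_law//.
- rewrite (_ : _ @^-1` _ = setT)//.
  by apply/seteqP; split => u //= _; rewrite in_itv/= hitting_itv.
- apply: emeasurable_funM.
    by apply/measurable_EFinP; exact: jointly_measurable_section.
  by apply: measurable_funTS; exact: measurable_fun_xsection.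
- by move=> t _; rewrite mule_ge0// lee_fin.
Qed.

Lemma measurable_pair_integral phi : jointly_measurable phi -> (forall t w, 0 <= phi t w) ->
  measurable_fun setT (pair_integral phi).
Proof.
move=> mphi phi0; rewrite (_ : pair_integral phi =
  (fun w => \int[unif2]_z pair_kernel phi (w, z))%E); last first.
  by apply/funext => w; exact: pair_integralE.
have k0 z : (0 <= pair_kernel phi z)%E by rewrite lee_fin mulr_ge0.
exact: (@measurable_fun_fubini_tonelli_F _ _ Omega _ R unif2 (pair_kernel phi)
  (measurable_pair_kernel mphi) k0).
Qed.

Lemma pair_integral_le phi w (c : \bar R) : jointly_measurable phi ->
  (forall t, 0 <= t <= T -> ((phi t w)%:E <= c)%E) -> (0 <= c)%E ->
  (forall t w, 0 <= phi t w) -> (pair_integral phi w <= c)%E.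
Proof.
move=> mphi phic c0 phi0.
apply: (@le_trans _ _ (\int[law T0 (x ^~ w)]_(t in `[0%R, T]%classic) c)%E); last first.
  rewrite integral_cst//; rewrite -[leRHS]mule1; apply: lee_wpmul2l => //.
  exact: probability_le1.
apply: ge0_le_integral => //.
- by move=> t _; rewrite mule_ge0// lee_fin.
- apply: emeasurable_funM.
    by apply/measurable_EFinP; exact: jointly_measurable_section.
  by apply: measurable_funTS; exact: measurable_fun_xsection.
- move=> t /=; rewrite in_itv/= => /phic pc; apply: le_trans pc.
  rewrite -[leRHS]mule1 lee_wpmul2l ?lee_fin//; apply: probability_le1.
  exact: measurable_xsection.
Qed.

End pair_integral.

End joint_measurability.

Lemma finite_measure_rectangles_unique {d1 d2} {T1 : measurableType d1}
    {T2 : measurableType d2} {R : realType}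
    (m1 m2 : {measure set (T1 * T2) -> \bar R}) : (m1 setT < +oo)%E ->
  (forall A B, measurable A -> measurable B -> m1 (A `*` B) = m2 (A `*` B)) ->
  forall C, measurable C -> m1 C = m2 C.
Proof.
move=> m1T m12 C mC.
apply: (@measure_unique _ _ _
  [set A `*` B | A in [set A | measurable A] & B in [set B | measurable B]]
  (fun=> setT)) => //.
- by rewrite measurable_prod_measurableType.
- move=> _ _ [A1 mA1 [B1 mB1 <-]] [A2 mA2 [B2 mB2 <-]].
  rewrite -setXI; exists (A1 `&` A2); first exact: measurableI.
  by exists (B1 `&` B2) => //; exact: measurableI.
- move=> _; exists setT; first exact: measurableT.
  by exists setT; [exact: measurableT|exact: setXTT].
- by rewrite bigcup_const//; exists 0%N.
- by move=> _ [A mA [B mB <-]]; exact: m12.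
Qed.

Section pair_Rintegral.
Context {R : realType} {d : measure_display} {Omega : measurableType d}.
Variable T : R.
Hypothesis T0 : 0 < T.
Variables (x y : R -> Omega -> R).
Hypotheses (mx : forall t, 0 <= t <= T -> measurable_fun setT (x t))
  (my : forall t, 0 <= t <= T -> measurable_fun setT (y t))
  (cx : forall w, control_path T (x ^~ w)) (cy : forall w, control_path T (y ^~ w)).
Variable D : set (R * R).
Hypothesis mD : measurable D.
Variable phi : R -> Omega -> R.
Hypothesis mphi : jointly_measurable T phi.
Implicit Types (w : Omega) (t : R).

(** As [fine] sends infinite values to 0, this is the difference of the integrals of the two parts
    where both are finite, which domination by an integrable [S] gives almost surely. *)
Definition pair_Rintegral w : R := \int[law T0 (x ^~ w)]_(t in `[0, T]%classic)
  (phi t w * fine (law T0 (y ^~ w) (xsection D t))).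

Definition pos_part t w : R := Num.max (phi t w) 0.
Definition neg_part t w : R := Num.max (- phi t w) 0.

Lemma jointly_measurable_pos_part : jointly_measurable T pos_part.
Proof. by apply: measurable_maxr => //; exact: measurableX. Qed.

Lemma jointly_measurable_neg_part : jointly_measurable T neg_part.
Proof.
have mX : measurable ([set: Omega] `*` `[0, T]%classic) by exact: measurableX.
by apply: measurable_maxr => //; exact: measurableT_comp.
Qed.

Lemma pos_part_ge0 t w : 0 <= pos_part t w.
Proof. by rewrite le_max lexx orbT. Qed.

Lemma neg_part_ge0 t w : 0 <= neg_part t w.
Proof. by rewrite le_max lexx orbT. Qed.

Local Notation et := (pair_integral T0 x y D).

Lemma pair_integral_split w : (\int[law T0 (x ^~ w)]_(t in `[0%R, T]%classic)
  (phi t w * fine (law T0 (y ^~ w) (xsection D t)))%:E = et pos_part w - et neg_part w)%E.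
Proof.
have q t : exists2 r : R, 0 <= r & law T0 (y ^~ w) (xsection D t) = r%:E.
  exists (fine (law T0 (y ^~ w) (xsection D t))); first by rewrite fine_ge0.
  by rewrite fineK// fin_num_measure//; exact: measurable_xsection.
rewrite integralE; congr (_ - _)%E; apply: eq_integral => t _.
  rewrite funeposE; have [r r0 ->] := q t; rewrite -EFinM/= -EFin_max.
  by congr EFin; rewrite /pos_part maxr_pMl// mul0r.
rewrite funenegE; have [r r0 ->] := q t; rewrite -EFinM/= -EFin_max.
by congr EFin; rewrite /neg_part maxr_pMl// mul0r mulNr.
Qed.

Lemma measurable_pair_Rintegral : measurable_fun setT pair_Rintegral.
Proof.
apply: (measurableT_comp (fine_measurable _)) => //.
rewrite (_ : (fun w => _) = (fun w => et pos_part w - et neg_part w)%E).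
  apply: emeasurable_funB; apply: measurable_pair_integral => //.
  - exact: jointly_measurable_pos_part.
  - exact: pos_part_ge0.
  - exact: jointly_measurable_neg_part.
  - exact: neg_part_ge0.
by apply/funext => w; exact: pair_integral_split.
Qed.

Variable P : probability Omega R.
Variable S : Omega -> \bar R.
Hypotheses (mS : measurable_fun setT S) (iS : (\int[P]_w S w < +oo)%E)
  (phiS : forall w t, 0 <= t <= T -> (`|phi t w|%:E <= S w)%E).

Let S0 w : (0 <= S w)%E.
Proof.
apply: (@le_trans _ _ `|phi 0 w|%:E); rewrite ?lee_fin//.
by apply: phiS; rewrite lexx ltW.
Qed.

Let pair_integral_bounded psi : jointly_measurable T psi -> (forall t w, 0 <= psi t w) ->
  (forall t w, psi t w <= `|phi t w|) -> P.-integrable setT (et psi).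
Proof.
move=> mpsi psi0 psiphi; apply/integrableP; split; first exact: measurable_pair_integral.
apply: le_lt_trans iS; apply: ge0_le_integral => //.
- by apply: measurableT_comp => //; exact: measurable_pair_integral.
- move=> w _; rewrite gee0_abs.
    apply: pair_integral_le => // [t tT].
    by apply: le_trans (phiS w tT); rewrite lee_fin.
  by apply: integral_ge0 => t _; rewrite mule_ge0// lee_fin.
Qed.

Lemma integrable_pair_integral_pos : P.-integrable setT (et pos_part).
Proof.
apply: pair_integral_bounded; [exact: jointly_measurable_pos_part|exact: pos_part_ge0|].
by move=> t w; rewrite ge_max ler_norm normr_ge0.
Qed.

Lemma integrable_pair_integral_neg : P.-integrable setT (et neg_part).
Proof.
apply: pair_integral_bounded; [exact: jointly_measurable_neg_part|exact: neg_part_ge0|].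
by move=> t w; rewrite ge_max -normrN ler_norm normr_ge0.
Qed.

Lemma ae_pair_RintegralE : {ae P, forall w,
  (pair_Rintegral w)%:E = (et pos_part w - et neg_part w)%E}.
Proof.
have hp := integrable_ae measurableT integrable_pair_integral_pos.
have hn := integrable_ae measurableT integrable_pair_integral_neg.
apply: filterS2 hp hn => w /(_ Logic.I) hp /(_ Logic.I) hn.
by rewrite /pair_Rintegral /Rintegral pair_integral_split fineK// fin_numB hp hn.
Qed.

Lemma integrable_pair_Rintegral : P.-integrable setT (EFin \o pair_Rintegral).
Proof.
have iB := integrableB measurableT integrable_pair_integral_pos integrable_pair_integral_neg.
have mB := measurable_int _ iB.
have mt : measurable_fun setT (EFin \o pair_Rintegral).
  by apply/measurable_EFinP; exact: measurable_pair_Rintegral.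
have [_ iB'] := integrableP _ _ _ iB; apply/integrableP; split => //.
rewrite (ae_eq_integral (abse \o (et pos_part \- et neg_part)%E))//.
- exact: measurableT_comp.
- exact: measurableT_comp.
- by apply: filterS ae_pair_RintegralE => w h _; exact: (congr1 abse h).
Qed.

Lemma integral_pair_Rintegral : (\int[P]_w (pair_Rintegral w)%:E =
  \int[P]_w et pos_part w - \int[P]_w et neg_part w)%E.
Proof.
rewrite -integralB//; [|exact: integrable_pair_integral_pos|exact: integrable_pair_integral_neg].
apply: ae_eq_integral => //.
- by apply/measurable_EFinP; exact: measurable_pair_Rintegral.
- by apply: measurable_int (integrableB measurableT integrable_pair_integral_pos
    integrable_pair_integral_neg).
- by apply: filterS ae_pair_RintegralE => w h _.
Qed.

End pair_Rintegral.

Section randomised_expectation.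
Context {R : realType} {d : measure_display} {Omega : measurableType d}.
Variables (P : probability Omega R) (T : R).
Hypothesis T0 : 0 < T.
Variable F : R -> set (set Omega).
Hypothesis fF : filtration P T F.
Implicit Types (w : Omega) (t : R).

Let TT : 0 <= T <= T. Proof. by rewrite lexx ltW. Qed.

Let sH : sigma_algebra setT (F T). Proof. exact: (filtration_sigma_algebra fF). Qed.

Let HP : F T `<=` measurable. Proof. exact: (filtration_measurable fF). Qed.

Local Notation OH := (g_sigma_algebraType (F T)).
Local Notation PH := (trace_prob P sH HP).

Lemma adapted_top x t : adapted T F x -> 0 <= t <= T ->
  measurable_fun setT (x t : OH -> R).
Proof.
move=> ax /andP[t0 tT]; apply/(measurable_wrtP sH) => B mB.
by apply: (filtration_le fF t0 tT (lexx T)); apply: ax => //; rewrite t0.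
Qed.

Variables Z1 Z2 : {RV P >-> R}.
Hypothesis Z12 : randomisation_devices T F Z1 Z2.

(** The first component is seen only through [F T], the sigma-algebra of which the devices are
    independent. *)
Definition with_devices (w : Omega) : OH * (R * R) := (w, (Z1 w, Z2 w)).

Lemma measurable_with_devices : measurable_fun setT with_devices.
Proof.
apply: measurable_fun_pair; first exact: measurable_subsigma_inj.
exact: measurable_fun_pair.
Qed.

Let mZZ : measurable_fun setT (fun w => (Z1 w, Z2 w)).
Proof. exact: measurable_fun_pair. Qed.

(** Independence gives the product form on triple rectangles. Uniqueness from rectangles is used
    twice: with [A] fixed, to reach every measurable [B] in the plane, and then for the products of
    [A] and [B]. *)
Lemma distribution_with_devices C : measurable C ->
  (PH \x unif2)%E C = distribution P (mfun_Sub (mem_set measurable_with_devices)) C.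
Proof.
have e1 : (PH \x unif2)%E setT = 1%E by exact: probability_setT.
apply: finite_measure_rectangles_unique.
  by change ((PH \x unif2)%E setT < +oo)%E; rewrite e1 ltry.
move=> A B; rewrite (measurable_subsigmaE sH) => HA mB.
transitivity (PH A * unif2 B)%E.
  by apply: product_measure1E; rewrite ?(measurable_subsigmaE sH).
have mA := HP HA.
have PA0 : 0 <= fine (P A) by rewrite fine_ge0.
transitivity (mscale (NngNum PA0) unif2 B).
  by rewrite /mscale/= fineK// fin_num_measure.
transitivity (pushforward (mrestr P mA) (mfun_Sub (mem_set mZZ)) B); last first.
  congr (P _); apply/seteqP; split => w /=.
    by move=> [].
  by move=> [].
apply: finite_measure_rectangles_unique mB.
  change ((fine (P A))%:E * unif2 setT < +oo)%E.
  by rewrite probability_setT mule1 ltry.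
move=> B1 B2 mB1 mB2; have [U1 U2 Z12E] := Z12.
change ((fine (P A))%:E * unif2 (B1 `*` B2) =
  P ((fun w => (Z1 w, Z2 w)) @^-1` (B1 `*` B2) `&` A))%E.
rewrite fineK ?fin_num_measure//.
transitivity (P A * (P (Z1 @^-1` B1) * P (Z2 @^-1` B2)))%E.
  congr (_ * _)%E; transitivity (unif01 B1 * unif01 B2)%E.
    exact: product_measure1E.
  by congr (_ * _)%E; apply/esym; [exact: U1|exact: U2].
rewrite muleA -Z12E//; congr (P _); apply/seteqP.
by split => w /= [[]].
Qed.

Variables (x y : R -> Omega -> R).
Hypotheses (ax : adapted T F x) (ay : adapted T F y).
Hypotheses (cx : forall w, control_path T (x ^~ w)) (cy : forall w, control_path T (y ^~ w)).
Variable D : set (R * R).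
Hypothesis mD : measurable D.

Local Notation tau := (generated_time T x Z1).
Local Notation sigma := (generated_time T y Z2).

Let mx t : 0 <= t <= T -> measurable_fun setT (x t : OH -> R).
Proof. exact: adapted_top. Qed.

Let my t : 0 <= t <= T -> measurable_fun setT (y t : OH -> R).
Proof. exact: adapted_top. Qed.

(** The law of [with_devices] is a product, so the two devices can be integrated out first, which
    leaves [pair_integral]. The remaining integral is over the restriction of [P] to [F T] and is
    carried back to [P] at the end. *)
Lemma randomised_expectation_ge0 (phi : R -> Omega -> R) :
  jointly_measurable (Omega := OH) T phi -> (forall t w, 0 <= phi t w) ->
  (\int[P]_w (phi (tau w) w * \1_D (tau w, sigma w))%:E =
   \int[P]_w pair_integral T0 x y D phi w)%E.
Proof.
move=> mphi phi0.
have k0 z : (0 <= pair_kernel (Omega := OH) T x y D phi z)%E.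
  by rewrite lee_fin mulr_ge0.
have mk := @measurable_pair_kernel _ _ OH T T0 x y mx my cx cy D mD phi mphi.
transitivity (\int[P]_w pair_kernel (Omega := OH) T x y D phi (with_devices w))%E => //.
transitivity (\int[distribution P (mfun_Sub (mem_set measurable_with_devices))]_z
    pair_kernel (Omega := OH) T x y D phi z)%E.
  by rewrite ge0_integral_pushforward.
transitivity (\int[(PH \x unif2)%E]_z pair_kernel (Omega := OH) T x y D phi z)%E.
  by apply: eq_measure_integral => C mC _; apply/esym; exact: distribution_with_devices.
rewrite fubini_tonelli1// /fubini_F.
transitivity (\int[PH]_w pair_integral (Omega := OH) T0 x y D phi w)%E.
  apply: eq_integral => w _.
  by rewrite (@pair_integralE _ _ OH T T0 x y mx my cx cy D mD phi w mphi phi0).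
apply: integral_trace_ge0.
- exact: sigma_algebra_setT sH.
- apply/(measurable_wrtP sH).
  exact: (@measurable_pair_integral _ _ OH T T0 x y mx my cx cy D mD phi mphi phi0).
- by move=> w; apply: integral_ge0 => t _; rewrite mule_ge0// lee_fin.
Qed.

End randomised_expectation.

Lemma randomisation_devicesC {d} {Omega : measurableType d} {R : realType}
    (P : probability Omega R) (T : R) (F : R -> set (set Omega)) (Z1 Z2 : {RV P >-> R}) :
  randomisation_devices T F Z1 Z2 -> randomisation_devices T F Z2 Z1.
Proof.
move=> [U1 U2 Z12]; split => // A B1 B2 FA mB1 mB2.
by rewrite -setIA [X in _ `&` X]setIC setIA Z12// muleAC.
Qed.

Lemma measurable_lt_set {R : realType} : measurable [set z : R * R | z.1 < z.2].
Proof. exact: measurable_set_ltr. Qed.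

Lemma measurable_eq_set {R : realType} : measurable [set z : R * R | z.1 = z.2].
Proof.
rewrite (_ : [set _ | _] = [set z : R * R | z.1 <= z.2] `&` [set z | z.2 <= z.1]).
  by apply: measurableI; exact: measurable_set_ler.
apply/seteqP; split => z /=; first by move=> ->; rewrite lexx.
move=> [zz1 zz2]; by apply/eqP; rewrite eq_le zz1.
Qed.

(** Random domains of integration are absorbed in the integrand, so that all integrals run over
    [0, T] as in [pair_Rintegral]. *)
Definition cut {R : realType} {Omega : Type} (A : Omega -> set R)
  (phi : R -> Omega -> R) : R -> Omega -> R := fun t w => phi t w * \1_(A w) t.

(** * Measurability and integrability of the payoff functional *)

Section expected_payoff.
Context {R : realType} {d : measure_display} {Omega : measurableType d}.
Variables (P : probability Omega R) (T : R).
Hypothesis T0 : 0 < T.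
Implicit Types (w : Omega) (t : R) (A B : Omega -> set R) (x y phi : R -> Omega -> R).

Lemma jointly_measurable_cut A phi : measurable [set z : Omega * R | A z.1 z.2] ->
  jointly_measurable T phi -> jointly_measurable T (cut A phi).
Proof.
move=> mA mphi; apply: measurable_funM => //; apply: measurable_funTS.
rewrite (_ : (fun z => _) = \1_[set z : Omega * R | A z.1 z.2]).
  exact: measurable_indic.
by apply/funext => z; rewrite !indicE; congr ((_ : bool)%:R); apply/idP/idP; rewrite !inE.
Qed.

Lemma cut_le A phi t w : `|cut A phi t w| <= `|phi t w|.
Proof.
rewrite /cut normrM ler_piMr//; rewrite indicE ger0_norm//.
by case: (_ \in _).
Qed.

(** Under the law of a control u, the mass of ]t, +oo[ is 1 - u_t and the mass of {t} is the jump at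
    t: these are the sections at t of the half plane and of the diagonal. *)
Lemma payoff_functional_terms (f g h : R -> Omega -> R) x y A B w :
  (forall w, control_path T (x ^~ w)) -> (forall w, control_path T (y ^~ w)) ->
  measurable (A w) -> A w `<=` `[0, T]%classic ->
  measurable (B w) -> B w `<=` `[0, T]%classic ->
  measurable_fun `[0, T]%classic (f ^~ w) ->
  measurable_fun `[0, T]%classic (g ^~ w) ->
  measurable_fun `[0, T]%classic (h ^~ w) ->
  (sup_abs T h w < +oo)%E ->
  payoff_functional T f g h x y A B w =
  pair_Rintegral T0 x y [set z | z.1 < z.2] (cut A f) w +
  pair_Rintegral T0 y x [set z | z.1 < z.2] (cut A g) w +
  pair_Rintegral T0 x y [set z | z.1 = z.2] (cut B h) w.
Proof.
move=> cx cy mA AT mB BT mf mg mh hS.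
have hM t : 0 <= t <= T -> `|h t w| <= fine (sup_abs T h w).
  move=> tT; have ht : (`|h t w|%:E <= sup_abs T h w)%E.
    by apply: ereal_sup_ubound; exists t => //=; rewrite in_itv.
  rewrite -lee_fin fineK// fin_numE -ltey hS andbT -ltNye.
  by rewrite (lt_le_trans _ ht)// ltNyr.
rewrite (@payoff_functional_law _ _ _ _ T0 _ _ _ _ _ _ _ _ (fine (sup_abs T h w)))//.
have cutE (k : R -> Omega -> R) (C : Omega -> set R) (q q' : R -> R) (m : probability R R) :
    C w `<=` `[0, T]%classic -> (forall t, 0 <= t <= T -> q t = q' t) ->
    \int[m]_(t in C w) (k t w * q t) =
    \int[m]_(t in `[0, T]%classic) (cut C k t w * q' t).
  move=> CT qq; rewrite -(setIidr CT) Rintegral_mkcondr.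
  apply: eq_Rintegral => t; rewrite inE/= in_itv/= => tT.
  rewrite patchE /cut indicE qq//; case: (t \in C w); rewrite ?mulr1//.
  by rewrite mulr0 mul0r.
have gtE u t : control_path T (u ^~ w) -> 0 <= t <= T ->
    1 - u t w = fine (law T0 (u ^~ w) (xsection [set z : R * R | z.1 < z.2] t)).
  move=> cu tT; rewrite -[LHS]/(fine (1 - u t w)%:E) -(law_gt T0 cu tT).
  congr (fine (law _ _ _)); apply/seteqP; split => s;
    by rewrite /xsection/= in_itv/= andbT inE.
have eqE u t : control_path T (u ^~ w) -> 0 <= t <= T ->
    jump T u t w = fine (law T0 (u ^~ w) (xsection [set z : R * R | z.1 = z.2] t)).
  move=> cu tT; rewrite -[LHS]/(fine (jump T u t w)%:E) (jumpE T0 cu tT).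
  congr (fine (law _ _ _)); apply/seteqP; split => s;
    by rewrite /xsection/= inE.
by congr (_ + _ + _); apply: cutE => // t tT; [exact: gtE|exact: gtE|exact: eqE].
Qed.

Section domination.
Variable phi : R -> Omega -> R.
Hypotheses (cphi : cadlag T phi) (mphi : forall t, 0 <= t <= T -> measurable_fun setT (phi t))
  (Sphi : (\int[P]_w sup_abs T phi w < +oo)%E).

Lemma cut_sup_abs A w t : 0 <= t <= T -> (`|cut A phi t w|%:E <= sup_abs T phi w)%E.
Proof.
move=> tT; apply: (@le_trans _ _ `|phi t w|%:E); first by rewrite lee_fin cut_le.
by apply: ereal_sup_ubound; exists t => //=; rewrite in_itv.
Qed.

Lemma ae_sup_abs_lty : {ae P, forall w, (sup_abs T phi w < +oo)%E}.
Proof.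
have S0 w : (0 <= sup_abs T phi w)%E.
  apply: (@le_trans _ _ `|phi 0 w|%:E); first by rewrite lee_fin.
  by apply: ereal_sup_ubound; exists 0 => //=; rewrite in_itv/= lexx ltW.
have i : P.-integrable setT (sup_abs T phi).
  apply/integrableP; split; first exact: measurable_sup_abs.
  by under eq_integral do rewrite gee0_abs//.
have := integrable_ae measurableT i; apply: filterS => w /(_ Logic.I).
by rewrite fin_numE -ltey => /andP[].
Qed.

End domination.

Lemma integrable_cut_pair_Rintegral (u v : R -> Omega -> R) D C phi :
  (forall t, 0 <= t <= T -> measurable_fun setT (u t)) ->
  (forall t, 0 <= t <= T -> measurable_fun setT (v t)) ->
  (forall w, control_path T (u ^~ w)) -> (forall w, control_path T (v ^~ w)) ->
  measurable D -> cadlag T phi ->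
  (forall t, 0 <= t <= T -> measurable_fun setT (phi t)) ->
  (\int[P]_w sup_abs T phi w < +oo)%E ->
  measurable [set z : Omega * R | C z.1 z.2] ->
  P.-integrable setT (EFin \o pair_Rintegral T0 u v D (cut C phi)).
Proof.
move=> mu mv cu cv mD cphi mphi Sphi mC.
apply: (@integrable_pair_Rintegral _ _ _ _ T0 _ _ mu mv cu cv D mD (cut C phi) _ P
  (sup_abs T phi)) => //.
- by apply: jointly_measurable_cut => //; exact: cadlag_jointly_measurable.
- exact: measurable_sup_abs.
- by move=> w t; exact: cut_sup_abs.
Qed.

Section payoffs.
Variables f g h : R -> Omega -> R.
Hypotheses (cf : cadlag T f) (cg : cadlag T g) (ch : cadlag T h).
Hypotheses (mf : forall t, 0 <= t <= T -> measurable_fun setT (f t))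
  (mg : forall t, 0 <= t <= T -> measurable_fun setT (g t))
  (mh : forall t, 0 <= t <= T -> measurable_fun setT (h t)).
Hypotheses (Sf : (\int[P]_w sup_abs T f w < +oo)%E)
  (Sg : (\int[P]_w sup_abs T g w < +oo)%E) (Sh : (\int[P]_w sup_abs T h w < +oo)%E).
Variables x y : R -> Omega -> R.
Hypotheses (mx : forall t, 0 <= t <= T -> measurable_fun setT (x t))
  (my : forall t, 0 <= t <= T -> measurable_fun setT (y t))
  (cx : forall w, control_path T (x ^~ w)) (cy : forall w, control_path T (y ^~ w)).
Variables A B : Omega -> set R.
Hypotheses (mA : measurable [set z : Omega * R | A z.1 z.2])
  (AT : forall w, A w `<=` `[0, T]%classic)
  (mB : measurable [set z : Omega * R | B z.1 z.2])
  (BT : forall w, B w `<=` `[0, T]%classic).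

Local Notation pf := (payoff_functional T f g h x y A B).
Local Notation ltz := [set z : R * R | z.1 < z.2].
Local Notation eqz := [set z : R * R | z.1 = z.2].

(** A visibly measurable substitute for the payoff functional; the two agree where the supremum of
    |h| is finite, hence almost surely. *)
Definition payoff_terms w : R := pair_Rintegral T0 x y ltz (cut A f) w +
  pair_Rintegral T0 y x ltz (cut A g) w + pair_Rintegral T0 x y eqz (cut B h) w.

Lemma payoff_functional_ae : {ae P, forall w, payoff_terms w = pf w}.
Proof.
have sec (C : Omega -> set R) w : measurable [set z : Omega * R | C z.1 z.2] -> measurable (C w).
  move=> mC; rewrite (_ : C w = xsection [set z : Omega * R | C z.1 z.2] w).
    exact: measurable_xsection.
  by apply/seteqP; split => t; rewrite /xsection/= inE.
apply: filterS (ae_sup_abs_lty ch mh Sh) => w hw.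
rewrite (payoff_functional_terms cx cy)//; do ?[exact: sec];
  by apply: jointly_measurable_section; exact: cadlag_jointly_measurable.
Qed.

Lemma integrable_payoff_terms : P.-integrable setT (EFin \o payoff_terms).
Proof.
have i1 : P.-integrable setT (EFin \o pair_Rintegral T0 x y ltz (cut A f)).
  by apply: integrable_cut_pair_Rintegral => //; exact: measurable_lt_set.
have i2 : P.-integrable setT (EFin \o pair_Rintegral T0 y x ltz (cut A g)).
  by apply: integrable_cut_pair_Rintegral => //; exact: measurable_lt_set.
have i3 : P.-integrable setT (EFin \o pair_Rintegral T0 x y eqz (cut B h)).
  by apply: integrable_cut_pair_Rintegral => //; exact: measurable_eq_set.
rewrite (_ : EFin \o payoff_terms = (EFin \o pair_Rintegral T0 x y ltz (cut A f)) \+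
  (EFin \o pair_Rintegral T0 y x ltz (cut A g)) \+ (EFin \o pair_Rintegral T0 x y eqz (cut B h)))%E.
  by apply: integrableD => //; exact: integrableD.
by apply/funext => w; rewrite /= /payoff_terms !EFinD.
Qed.

Hypothesis Pc : measure_is_complete P.

Lemma measurable_payoff_functional : measurable_fun setT pf.
Proof.
move=> _ C mC; rewrite setTI.
apply: (@measurable_wrt_ae _ _ _ _ _ P (d.-measurable) payoff_terms pf) => //.
- exact: sigma_algebra_measurable.
- move=> D mD; rewrite -[X in measurable X]setTI.
  have /measurable_EFinP mpt := measurable_int _ integrable_payoff_terms.
  exact: mpt.
- exact: payoff_functional_ae.
Qed.

Lemma integrable_payoff_functional : P.-integrable setT (EFin \o pf).
Proof.
have mpf : measurable_fun setT (EFin \o pf).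
  by apply/measurable_EFinP; exact: measurable_payoff_functional.
have [mt it'] := integrableP _ _ _ integrable_payoff_terms.
apply/integrableP; split => //.
rewrite (ae_eq_integral (abse \o (EFin \o payoff_terms)))//.
- exact: measurableT_comp.
- exact: measurableT_comp.
- by apply: filterS payoff_functional_ae => w h' _; rewrite /= h'.
Qed.

End payoffs.

End expected_payoff.

(** * Expected payoffs of generated times *)

Section expected_payoff_functional.
Context {R : realType} {d : measure_display} {Omega : measurableType d}.
Variables (P : probability Omega R) (T : R).
Hypothesis T0 : 0 < T.
Variable F : R -> set (set Omega).
Hypothesis fF : filtration P T F.
Implicit Types (w : Omega) (t : R) (x y phi : R -> Omega -> R).

Local Notation OH := (g_sigma_algebraType (F T)).

Let sT : sigma_algebra setT (F T).
Proof. by apply: (filtration_sigma_algebra fF); rewrite lexx ltW. Qed.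

Lemma adapted_measurable x t : adapted T F x -> 0 <= t <= T ->
  measurable_fun setT (x t).
Proof.
by move=> ax tT; apply: (measurable_wrt_fun (filtration_measurable fF tT)); exact: ax.
Qed.

Section one_term.
Variables Z1 Z2 : {RV P >-> R}.
Hypothesis Z12 : randomisation_devices T F Z1 Z2.
Variables (x y : R -> Omega -> R).
Hypotheses (ax : adapted T F x) (ay : adapted T F y).
Hypotheses (cx : forall w, control_path T (x ^~ w)) (cy : forall w, control_path T (y ^~ w)).
Variable D : set (R * R).
Hypothesis mD : measurable D.
Variables (phi : R -> Omega -> R).
Hypotheses (cphi : cadlag T phi) (aphi : adapted T F phi)
  (Sphi : (\int[P]_w sup_abs T phi w < +oo)%E).
Variable I : set R.
Hypothesis mI : measurable I.

Local Notation tau := (generated_time T x Z1).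
Local Notation sigma := (generated_time T y Z2).
Local Notation psi := (cut (fun _ : Omega => I) phi).

Let mx t : 0 <= t <= T -> measurable_fun setT (x t).
Proof. exact: adapted_measurable. Qed.

Let my t : 0 <= t <= T -> measurable_fun setT (y t).
Proof. exact: adapted_measurable. Qed.

Let mphi t : 0 <= t <= T -> measurable_fun setT (phi t).
Proof. exact: adapted_measurable. Qed.

Let mphiH t : 0 <= t <= T -> measurable_fun setT (phi t : OH -> R).
Proof. by move=> tT; exact: (adapted_top T0 fF aphi tT). Qed.

Let mpsi : jointly_measurable T psi.
Proof.
apply: jointly_measurable_cut; last exact: cadlag_jointly_measurable.
rewrite -[X in measurable X]setTI.
exact: (@measurable_snd _ _ Omega R measurableT I mI).
Qed.

Let mpsiH : jointly_measurable (Omega := OH) T psi.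
Proof.
apply: (@jointly_measurable_cut _ _ OH T (fun=> I) phi).
  rewrite -[X in measurable X]setTI.
  exact: (@measurable_snd _ _ OH R measurableT I mI).
exact: (@cadlag_jointly_measurable _ _ OH).
Qed.

Definition stopped_term w : R := psi (tau w) w * \1_D (tau w, sigma w).

Lemma measurable_stopped_term : measurable_fun setT stopped_term.
Proof.
apply/measurable_EFinP.
apply: (measurableT_comp (measurable_pair_kernel T0 mx my cx cy mD mpsi)
  (g := fun w => (w, (Z1 w, Z2 w)))).
by apply: measurable_fun_pair => //; exact: measurable_fun_pair.
Qed.

Let ge0 (k : R -> Omega -> R) :=
  @randomised_expectation_ge0 _ _ _ P T T0 F fF Z1 Z2 Z12 x y ax ay cx cy D mD k.

Lemma stopped_term_integrable_integral : P.-integrable setT (EFin \o stopped_term) /\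
  (\int[P]_w (stopped_term w)%:E = \int[P]_w (pair_Rintegral T0 x y D psi w)%:E)%E.
Proof.
have psiS := @cut_sup_abs _ _ _ T phi (fun=> I).
have mS := measurable_sup_abs T0 cphi mphi.
have pe := ge0 (@jointly_measurable_pos_part _ _ OH T psi mpsiH) (@pos_part_ge0 _ _ _ psi).
have ne := ge0 (@jointly_measurable_neg_part _ _ OH T psi mpsiH) (@neg_part_ge0 _ _ _ psi).
have i01 w : 0 <= \1_D (tau w, sigma w) :> R by rewrite indicE; case: (_ \in _).
have i1 w : \1_D (tau w, sigma w) <= 1 :> R by rewrite indicE; case: (_ \in _); rewrite ?ler01.
have pE w : (EFin \o stopped_term)^\+%E w =
    (pos_part psi (tau w) w * \1_D (tau w, sigma w))%:E.
  by rewrite funeposE/= -EFin_max; congr EFin; rewrite /pos_part maxr_pMl// mul0r.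
have nE w : (EFin \o stopped_term)^\-%E w =
    (neg_part psi (tau w) w * \1_D (tau w, sigma w))%:E.
  by rewrite funenegE/= -EFin_max; congr EFin; rewrite /neg_part maxr_pMl// mul0r mulNr.
have ip := @integrable_pair_integral_pos _ _ _ T T0 x y mx my cx cy D mD psi mpsi P _ mS Sphi psiS.
have iN := @integrable_pair_integral_neg _ _ _ T T0 x y mx my cx cy D mD psi mpsi P _ mS Sphi psiS.
split.
  apply/integrableP; split; first by apply/measurable_EFinP; exact: measurable_stopped_term.
  have mt : measurable_fun setT (EFin \o stopped_term).
    by apply/measurable_EFinP; exact: measurable_stopped_term.
  apply: le_lt_trans Sphi; apply: ge0_le_integral => //.
  - exact: measurableT_comp.
  - move=> w _; apply: le_trans (psiS w (tau w) (hitting_itv T0 _ _)).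
    rewrite lee_fin /stopped_term normrM ler_piMr// ger0_norm//.
rewrite integralE (integral_pair_Rintegral T0 mx my cx cy mD mpsi mS Sphi psiS).
by congr (_ - _)%E; [rewrite -pe|rewrite -ne]; apply: eq_integral => w _.
Qed.

End one_term.

Section payoff.
Variables f g h : R -> Omega -> R.
Hypotheses (cf : cadlag T f) (cg : cadlag T g) (ch : cadlag T h).
Hypotheses (af : adapted T F f) (ag : adapted T F g) (ah : adapted T F h).
Hypotheses (Sf : (\int[P]_w sup_abs T f w < +oo)%E)
  (Sg : (\int[P]_w sup_abs T g w < +oo)%E) (Sh : (\int[P]_w sup_abs T h w < +oo)%E).

Lemma expected_payoff (Z1 Z2 : {RV P >-> R}) x y : randomisation_devices T F Z1 Z2 ->
  adapted T F x -> adapted T F y ->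
  (forall w, control_path T (x ^~ w)) -> (forall w, control_path T (y ^~ w)) ->
  measure_is_complete P ->
  ('E_P[payoff f g h (generated_time T x Z1) (generated_time T y Z2)])%E =
  (\int[P]_w (payoff_functional T f g h x y
     (fun=> `[0%R, T[%classic) (fun=> `[0%R, T]%classic) w)%:E)%E.
Proof.
move=> Z12 ax ay cx cy Pc.
pose tau := generated_time T x Z1; pose sigma := generated_time T y Z2.
have tauT w : 0 <= tau w <= T by exact: (hitting_itv T0 (x ^~ w) (Z1 w)).
have sigmaT w : 0 <= sigma w <= T by exact: (hitting_itv T0 (y ^~ w) (Z2 w)).
pose ltz := [set z : R * R | z.1 < z.2]; pose eqz := [set z : R * R | z.1 = z.2].
pose Io := `[0, T[%classic : set R; pose Ic := `[0, T]%classic : set R.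
have mIo : measurable Io by exact: measurable_itv.
have mIc : measurable Ic by exact: measurable_itv.
pose s1 := stopped_term Z1 Z2 x y ltz f Io.
pose s2 := stopped_term Z2 Z1 y x ltz g Io.
pose s3 := stopped_term Z1 Z2 x y eqz h Ic.
have [i1 e1] := stopped_term_integrable_integral Z12 ax ay cx cy measurable_lt_set cf af Sf mIo.
have [i2 e2] := stopped_term_integrable_integral (randomisation_devicesC Z12)
  ay ax cy cx measurable_lt_set cg ag Sg mIo.
have [i3 e3] := stopped_term_integrable_integral Z12 ax ay cx cy measurable_eq_set ch ah Sh mIc.
(* A strict inequality forces the smaller time below [T], so the cut to [0, T[ in the terms in f and
   g changes nothing; a tie can occur at [T], which the closed interval of the term in h
   includes. *)
have payE w : payoff f g h tau sigma w = s1 w + s2 w + s3 w.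
  rewrite /payoff /s1 /s2 /s3 /stopped_term -/tau -/sigma /cut !indicE.
  have /andP[t0 tT] := tauT w; have /andP[r0 rT] := sigmaT w.
  have -> : ((tau w, sigma w) \in ltz) = (tau w < sigma w).
    by apply/idP/idP; rewrite inE.
  have -> : ((sigma w, tau w) \in ltz) = (sigma w < tau w).
    by apply/idP/idP; rewrite inE.
  have -> : ((tau w, sigma w) \in eqz) = (tau w == sigma w).
    by apply/idP/idP; rewrite inE => /eqP.
  have -> : (tau w \in Ic) = true by rewrite mem_set// /Ic/= in_itv/= t0.
  have [ts|st|ts] := ltgtP (tau w) (sigma w).
  - rewrite (mem_set (A := Io)); last by rewrite /Io/= in_itv/= t0 (lt_le_trans ts).
    by rewrite !mulr0 !mulr1 !addr0.
  - rewrite (mem_set (A := Io) (u := sigma w)).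
      by rewrite !mulr0 !mulr1 addr0 add0r.
    by rewrite /Io/= in_itv/= r0 (lt_le_trans st).
  - by rewrite !mulr0 !mulr1 !add0r.
rewrite unlock.
have mconst (C : set R) : measurable C -> measurable [set z : Omega * R | C z.2].
  move=> mC; rewrite -[X in measurable X]setTI.
  exact: (@measurable_snd _ _ Omega R measurableT C mC).
have am (k : R -> Omega -> R) (ak : adapted T F k) t := adapted_measurable ak (t := t).
have IoT : Io `<=` Ic by move=> t; rewrite /Io /Ic /= !in_itv/= => /andP[-> /ltW].
have IcT : Ic `<=` `[0, T]%classic by [].
have pfae := payoff_functional_ae (A := fun=> Io) (B := fun=> Ic)
  T0 cf cg ch (am _ af) (am _ ag) (am _ ah) Sh cx cy
  (mconst _ mIo) (fun=> IoT) (mconst _ mIc) (fun=> IcT).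
have mpf := integrable_payoff_functional (A := fun=> Io) (B := fun=> Ic)
  T0 cf cg ch (am _ af) (am _ ag) (am _ ah)
  Sf Sg Sh (am _ ax) (am _ ay) cx cy (mconst _ mIo) (fun=> IoT) (mconst _ mIc)
  (fun=> IcT) Pc.
have ipt := integrable_payoff_terms (A := fun=> Io) (B := fun=> Ic)
  T0 cf cg ch (am _ af) (am _ ag) (am _ ah)
  Sf Sg Sh (am _ ax) (am _ ay) cx cy (mconst _ mIo) (mconst _ mIc).
transitivity (\int[P]_w (payoff_terms T0 f g h x y (fun=> Io) (fun=> Ic) w)%:E)%E; last first.
  apply: ae_eq_integral => //.
  - exact: measurable_int ipt.
  - exact: measurable_int mpf.
  - by apply: filterS pfae => w -> _.
transitivity (\int[P]_w ((s1 w)%:E + (s2 w)%:E + (s3 w)%:E))%E.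
  by apply: eq_integral => w _; rewrite payE !EFinD.
rewrite integralD//=; last exact: integrableD.
rewrite integralD//= e1 e2 e3.
have it1 := integrable_cut_pair_Rintegral (D := ltz) (C := fun=> Io) T0 (am _ ax) (am _ ay) cx cy
  measurable_lt_set cf (am _ af) Sf (mconst _ mIo).
have it2 := integrable_cut_pair_Rintegral (D := ltz) (C := fun=> Io) T0 (am _ ay) (am _ ax) cy cx
  measurable_lt_set cg (am _ ag) Sg (mconst _ mIo).
have it3 := integrable_cut_pair_Rintegral (D := eqz) (C := fun=> Ic) T0 (am _ ax) (am _ ay) cx cy
  measurable_eq_set ch (am _ ah) Sh (mconst _ mIc).
rewrite /payoff_terms; under [RHS]eq_integral do rewrite !EFinD.
rewrite [RHS]integralD//=; last exact: integrableD.
by rewrite integralD.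
Qed.

End payoff.

End expected_payoff_functional.

(** Infinite [u] and [v] are included, since the generalised conditional expectations of both parts
    may be infinite; for k = 0 both sides are 0 by convention. *)
Lemma ge0_muleBr {R : realType} (k : R) (u v : \bar R) : 0 <= k ->
  (k%:E * (u - v) = k%:E * u - k%:E * v)%E.
Proof.
rewrite le_eqVlt => /predU1P[<-|k0]; first by rewrite !mul0e subee.
case: u v => [u||] [v||] //=; rewrite ?(gt0_muley, gt0_muleNy, lte_fin)//=;
  rewrite ?(gt0_muley, gt0_muleNy, lte_fin)//.
by rewrite -EFinB -!EFinM -EFinB mulrBr.
Qed.

Lemma lee_exchange {R : realType} (u v p q : \bar R) :
  (u + p = v + q -> v <= u -> v \is a fin_num -> p <= q)%E.
Proof. by move=> e vu fv; rewrite -(leeD2lE _ _ fv) -e leeD2r. Qed.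

(** * Equilibrium values *)

Section control_monotone.
Context {R : realType} {d : measure_display} {Omega : measurableType d}.
Variable T : R.
Variables (G F : R -> set (set Omega)).
Hypothesis GF : forall t, 0 <= t <= T -> G t `<=` F t.

Lemma control_sub theta x : control T G theta x -> control T F theta x.
Proof.
by case=> ax cx mx x0 xT; split => // t tT B mB; apply: GF => //; exact: ax.
Qed.

Lemma stopping_time_sub theta : stopping_time T G theta -> stopping_time T F theta.
Proof. by case=> tT Gt; split => // t tT'; exact/GF/Gt. Qed.

End control_monotone.

(** * One player, with filtration [G] and control [X], against a fixed [F]-adapted opponent [Y] *)

Section player.
Context {R : realType} {d : measure_display} {Omega : measurableType d}.
Variables (P : probability Omega R) (T : R).
Hypotheses (Pc : measure_is_complete P) (T0 : 0 < T).
Variables (F G : R -> set (set Omega)).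
Hypotheses (fF : filtration P T F) (fG : filtration P T G).
Hypothesis GF : forall t, 0 <= t <= T -> G t `<=` F t.
Variables f g h : R -> Omega -> R.
Hypotheses (cf : cadlag T f) (cg : cadlag T g) (ch : cadlag T h).
Hypotheses (af : adapted T F f) (ag : adapted T F g) (ah : adapted T F h).
Hypotheses (Sf : (\int[P]_w sup_abs T f w < +oo)%E)
  (Sg : (\int[P]_w sup_abs T g w < +oo)%E) (Sh : (\int[P]_w sup_abs T h w < +oo)%E).
Variables X Y : R -> Omega -> R.
Hypotheses (cX : control T G (cst 0) X) (cY : control T F (cst 0) Y).
Variable theta : Omega -> R.
Hypothesis st : stopping_time T G theta.
Implicit Types (w : Omega) (t : R) (x z : R -> Omega -> R).

Let stF : stopping_time T F theta. Proof. exact: stopping_time_sub st. Qed.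
Let thetaT w : 0 <= theta w <= T. Proof. by case: st. Qed.

Local Notation Gth := (sigma_at T G theta).
Let sS : sigma_algebra setT Gth. Proof. exact: (sigma_at_sigma_algebra fG st). Qed.
Let mS : Gth `<=` measurable. Proof. exact: (sigma_at_measurable fG st (ltW T0)). Qed.

Local Notation trX := (truncated T X theta).
Local Notation trY := (truncated T Y theta).

Let pX w : control_path T (X ^~ w). Proof. exact: (control_control_path cX). Qed.
Let pY w : control_path T (Y ^~ w). Proof. exact: (control_control_path cY). Qed.
Let cXF : control T F (cst 0) X. Proof. exact: control_sub cX. Qed.

Let ctrX : control T G theta trX. Proof. exact: (truncated_control T0 fG st cX). Qed.
Let ctrY : control T F theta trY. Proof. exact: (truncated_control T0 fF stF cY). Qed.
Let ptrY w : control_path T (trY ^~ w). Proof. exact: (control_control_path ctrY). Qed.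

Let am k t : adapted T F k -> 0 <= t <= T -> measurable_fun setT (k t).
Proof. exact: (adapted_measurable fF). Qed.

Let mctrl theta' x t : control T F theta' x -> 0 <= t <= T -> measurable_fun setT (x t).
Proof. by case=> ax _ _ _ _; exact: am. Qed.

Let mtheta : measurable_fun setT theta.
Proof. exact: (measurable_stopping_time fG st). Qed.

Let mtheta1 : measurable_fun setT (fun z : Omega * R => theta z.1).
Proof. exact: (measurableT_comp mtheta measurable_fst). Qed.

Local Notation Afut := (fun w => `[theta w, T[%classic).
Local Notation Bfut := (fun w => `[theta w, T]%classic).
Local Notation Apast := (fun w => `[0, theta w[%classic).
Local Notation Awhole := (fun=> `[0, T[%classic).
Local Notation Bwhole := (fun=> `[0, T]%classic).

Let mAfut : measurable [set z : Omega * R | (Afut z.1 : set R) z.2].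
Proof.
rewrite (_ : [set _ | _] = [set z | theta z.1 <= z.2] `&` [set z | z.2 < T]).
  by apply: measurableI; [exact: measurable_set_ler|exact: measurable_set_ltr].
by apply/seteqP; split => z /=; rewrite in_itv/= => /andP.
Qed.

Let mBfut : measurable [set z : Omega * R | (Bfut z.1 : set R) z.2].
Proof.
rewrite (_ : [set _ | _] = [set z | theta z.1 <= z.2] `&` [set z | z.2 <= T]).
  by apply: measurableI; exact: measurable_set_ler.
by apply/seteqP; split => z /=; rewrite in_itv/= => /andP.
Qed.

Let mApast : measurable [set z : Omega * R | (Apast z.1 : set R) z.2].
Proof.
rewrite (_ : [set _ | _] = [set z | 0 <= z.2] `&` [set z | z.2 < theta z.1]).
  by apply: measurableI; [exact: measurable_set_ler|exact: measurable_set_ltr].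
by apply/seteqP; split => z /=; rewrite in_itv/= => /andP.
Qed.

Let mconst (C : set R) : measurable C -> measurable [set z : Omega * R | C z.2].
Proof.
move=> mC; rewrite -[X in measurable X]setTI.
exact: (@measurable_snd _ _ Omega R measurableT C mC).
Qed.

Let AfutT w : Afut w `<=` `[0, T]%classic.
Proof.
by move=> t; rewrite /= !in_itv/= => /andP[tt /ltW ->]; rewrite (le_trans _ tt)//;
  case/andP: (thetaT w).
Qed.

Let BfutT w : Bfut w `<=` `[0, T]%classic.
Proof.
by move=> t; rewrite /= !in_itv/= => /andP[tt ->]; rewrite (le_trans _ tt)//;
  case/andP: (thetaT w).
Qed.

Let ApastT w : Apast w `<=` `[0, T]%classic.
Proof.
move=> t; rewrite /= !in_itv/= => /andP[-> /ltW tt]; rewrite (le_trans tt)//.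
by case/andP: (thetaT w).
Qed.

Let AwholeT w : Awhole w `<=` `[0, T]%classic.
Proof. by move=> t; rewrite /= !in_itv/= => /andP[-> /ltW]. Qed.

Definition past := payoff_functional T f g h X Y Apast Apast.
Definition future z := payoff_functional T f g h z trY Afut Bfut.
Definition whole x := payoff_functional T f g h x Y Awhole Bwhole.
Definition own_survival w : R := 1 - left_val T X (theta w) w.
Definition opponent_survival w : R := 1 - left_val T Y (theta w) w.
Local Notation a := own_survival.
Local Notation b := opponent_survival.

Let integrable_pf x y A B : control T F (cst 0) X ->
  (forall t, 0 <= t <= T -> measurable_fun setT (x t)) ->
  (forall t, 0 <= t <= T -> measurable_fun setT (y t)) ->
  (forall w, control_path T (x ^~ w)) -> (forall w, control_path T (y ^~ w)) ->
  measurable [set z : Omega * R | A z.1 z.2] -> (forall w, A w `<=` `[0, T]%classic) ->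
  measurable [set z : Omega * R | B z.1 z.2] -> (forall w, B w `<=` `[0, T]%classic) ->
  P.-integrable setT (EFin \o payoff_functional T f g h x y A B).
Proof.
move=> _ mx my px py mA AT mB BT.
exact: (integrable_payoff_functional T0 cf cg ch (fun t => am (t := t) af)
  (fun t => am (t := t) ag) (fun t => am (t := t) ah) Sf Sg Sh mx my px py mA AT mB BT Pc).
Qed.

Lemma integrable_past : P.-integrable setT (EFin \o past).
Proof. by apply: integrable_pf => // t; [exact: mctrl cXF|exact: mctrl cY]. Qed.

Lemma integrable_future z : control T G theta z ->
  P.-integrable setT (EFin \o future z).
Proof.
move=> cz; apply: integrable_pf => // [t|t|w].
- exact: mctrl (control_sub GF cz).
- exact: mctrl ctrY.
- exact: (control_control_path cz).
Qed.

Lemma integrable_whole x : control T F (cst 0) x -> P.-integrable setT (EFin \o whole x).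
Proof.
move=> cx; apply: integrable_pf => // [t|t|w|||].
- exact: mctrl cx.
- exact: mctrl cY.
- exact: (control_control_path cx).
- exact: (mconst (measurable_itv _)).
- exact: (mconst (measurable_itv _)).
- by move=> w.
Qed.

Lemma a_itv w : 0 <= a w <= 1.
Proof. by have /andP[l0 l1] := left_val_itv T0 (pX w) (theta w); rewrite subr_ge0 l1 gerBl. Qed.

Lemma b_itv w : 0 <= b w <= 1.
Proof. by have /andP[l0 l1] := left_val_itv T0 (pY w) (theta w); rewrite subr_ge0 l1 gerBl. Qed.

Lemma a_wrt : measurable_wrt Gth a.
Proof.
apply/(measurable_wrtP sS); apply: measurable_funB => //.
by apply/(measurable_wrtP sS); apply: (left_val_sigma_at T0 fG st) => //; case: cX.
Qed.

Lemma measurable_b : measurable_fun setT b.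
Proof.
apply: measurable_funB => //.
apply: (measurable_wrt_fun (sigma_at_measurable fF stF (ltW T0))).
by apply: (left_val_sigma_at T0 fF stF) => //; case: cY.
Qed.

(** [Y] is the concatenation of itself with its own truncation, so the payoff splits at theta for
    both players. The split uses a bound on f, g and h along the path, available almost surely. *)
Lemma whole_concat z : control T G theta z ->
  {ae P, forall w, whole (concat T X theta z) w = past w + a w * b w * future z w}.
Proof.
move=> cz; have pz := control_control_path cz.
have bounded k w : (sup_abs T k w < +oo)%E -> forall t, 0 <= t <= T ->
    `|k t w| <= fine (sup_abs T k w).
  move=> kS t tT; have kt : (`|k t w|%:E <= sup_abs T k w)%E.
    by apply: ereal_sup_ubound; exists t => //=; rewrite in_itv.
  rewrite -lee_fin fineK// fin_numE -ltey kS andbT -ltNye.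
  by rewrite (lt_le_trans _ kt)// ltNyr.
have jm k w : cadlag T k -> adapted T F k -> measurable_fun `[0, T]%classic (k ^~ w).
  move=> ck ak; apply: jointly_measurable_section.
  by apply: cadlag_jointly_measurable => // t; exact: am.
apply: filterS3 (ae_sup_abs_lty T0 cf (fun t => am (t := t) af) Sf)
  (ae_sup_abs_lty T0 cg (fun t => am (t := t) ag) Sg)
  (ae_sup_abs_lty T0 ch (fun t => am (t := t) ah) Sh) => w fS gS hS.
pose M := Num.max (fine (sup_abs T f w))
  (Num.max (fine (sup_abs T g w)) (fine (sup_abs T h w))).
have wE := @payoff_functional_eq _ _ _ T T0 f g h (concat T X theta z) Y
  (concat T X theta z) (concat T Y theta trY) Awhole Bwhole w (AwholeT (w := w))
  (fun t tT => tT) (fun t _ => erefl).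
rewrite /whole wE; last by move=> t tT; rewrite (concat_truncated T0 stF (pY w) tT).
rewrite (payoff_concat (M := M) T0)//.
- by case: cz.
- by case: ctrY.
- exact: jm.
- exact: jm.
- exact: jm.
- by move=> t tT; rewrite le_max bounded.
- by move=> t tT; rewrite !le_max bounded// orbT.
- by move=> t tT; rewrite !le_max bounded// !orbT.
Qed.

Lemma past_truncated : {ae P, forall w, whole X w = past w + a w * b w * future trX w}.
Proof.
apply: filterS (whole_concat ctrX) => w <-.
apply: payoff_functional_eq => //; first exact: AwholeT.
by move=> t tT; rewrite (concat_truncated T0 stF (pX w) tT).
Qed.

(** Future payoff weighted by both remaining masses. These are at most 1, so it is always
    integrable; comparisons are made here and then transferred to [J]. *)
Definition joint z w := a w * b w * future z w.

Lemma measurable_a : measurable_fun setT a.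
Proof. exact: (measurable_wrt_fun mS a_wrt). Qed.

Lemma integrable_joint z : control T G theta z ->
  P.-integrable setT (EFin \o joint z).
Proof.
move=> cz; have iz := integrable_future cz.
apply: (le_integrable measurableT _ _ iz).
  apply/measurable_EFinP; apply: measurable_funM.
    by apply: measurable_funM; [exact: measurable_a|exact: measurable_b].
  by apply/measurable_EFinP; exact: measurable_int iz.
move=> w _; rewrite /= lee_fin /joint normrM ler_piMl//.
have /andP[a0 a1] := a_itv w; have /andP[b0 b1] := b_itv w.
by rewrite normrM !ger0_norm// mulr_ile1.
Qed.

Lemma future_paste A z z' w :
  future (paste A z z') w = if w \in A then future z w else future z' w.
Proof.
by case: ifPn => wA; apply: payoff_functional_eq => // t _;
  rewrite /paste ?wA// (negbTE wA).
Qed.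

(** The deviation shares the past of [X], and its future outside [A], so the total payoffs differ by
    the future contributions on [A]. The identity is written with sums to avoid subtracting extended
    reals. *)
Lemma joint_deviation A z : Gth A -> control T G theta z ->
  (\int[P]_w (whole (concat T X theta (paste A z trX)) w)%:E
     + \int[P]_(w in A) (joint trX w)%:E =
   \int[P]_w (whole X w)%:E + \int[P]_(w in A) (joint z w)%:E)%E.
Proof.
move=> GA cz; have mA := mS GA.
have cp : control T G theta (paste A z trX) by exact: (paste_control T0 fG st).
have cc : control T G (cst 0) (concat T X theta (paste A z trX)).
  exact: (concat_control T0 fG st).
have iA u : control T G theta u ->
    P.-integrable setT (fun w => ((EFin \o joint u) \_ A) w).
  move=> cu; have iu := integrable_joint cu.
  exact: (proj1 (integrable_mkcond _ mA) (integrableS measurableT mA (@subsetT _ _) iu)).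
have ic := integrable_whole (control_sub GF cc); have iX := integrable_whole cXF.
rewrite ![(\int[P]_(w in A) _)%E]integral_mkcond.
have e1 := integralD measurableT ic (iA _ ctrX).
have e2 := integralD measurableT iX (iA _ cz).
apply: etrans (esym e1) _; apply: etrans e2.
apply: ae_eq_integral => //.
- exact: (measurable_int _ (integrableD measurableT ic (iA _ ctrX))).
- exact: (measurable_int _ (integrableD measurableT iX (iA _ cz))).
apply: filterS2 (whole_concat cp) past_truncated => w wc wX _ /=.
rewrite wc wX !patchE future_paste /joint/=; case: ifP => _ /=;
  rewrite -?EFinD ?adde0//; congr EFin; ring.
Qed.

Local Notation S := (survival P T G Y theta).
Local Notation weightY := (weight P T G Y theta).

Lemma integrable_b : P.-integrable setT (EFin \o b).
Proof.
apply: (le_integrable measurableT _ _ (finite_measure_integrable_cst P 1 measurableT)) => //.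
  by apply/measurable_EFinP; exact: measurable_b.
by move=> w _; rewrite /= lee_fin normr1; have /andP[? ?] := b_itv w; rewrite ger0_norm.
Qed.

Lemma survival_condexp : is_condexp P Gth (EFin \o b) S.
Proof. exact: (condexpP sS mS integrable_b). Qed.

(** A version of the conditional survival with values in [0, 1] everywhere: the pull-out lemma
    bounds its factor at every point, not just almost surely. *)
Definition clamped_survival w : R := Num.max 0 (Num.min 1 (fine (S w))).
Local Notation S' := clamped_survival.

Lemma clamped_survival_itv w : 0 <= S' w <= 1.
Proof. by rewrite /S' le_max lexx/= ge_max ler01 ge_min lexx. Qed.

Lemma clamped_survival_wrt : measurable_wrt Gth S'.
Proof.
have [mS' _ _] := survival_condexp.
apply/(measurable_wrtP sS); apply: measurable_maxr => //; apply: measurable_minr => //.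
by apply: measurableT_comp => //; exact/(measurable_wrtP sS).
Qed.

Lemma ae_survivalE : {ae P, forall w, S w = (S' w)%:E}.
Proof.
have cS := survival_condexp.
have cc (k : R) : is_condexp P Gth (cst k%:E) (cst k%:E).
  split => //; last exact: finite_measure_integrable_cst.
  by apply/(measurable_wrtP sS).
have S0 : {ae P, forall w, (0%:E <= S w)%E}.
  apply: (is_condexp_le sS mS (cc 0) cS) => A GA; rewrite integral0 integral_ge0//.
  by move=> w _; rewrite lee_fin; case/andP: (b_itv w).
have S1 : {ae P, forall w, (S w <= 1%:E)%E}.
  apply: (is_condexp_le sS mS cS (cc 1)) => A GA; apply: ge0_le_integral => //.
  - exact: mS.
  - by move=> w _; rewrite lee_fin; case/andP: (b_itv w).
  - by apply: measurable_funTS; apply/measurable_EFinP; exact: measurable_b.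
  - by move=> w _; rewrite lee_fin; case/andP: (b_itv w).
apply: filterS2 S0 S1 => w; rewrite /S'; case: (S w) => [r||]//.
by rewrite !lee_fin /= => r0 r1; rewrite min_r// max_r.
Qed.

(** On {S' = 0}, a conditioning event, the nonnegative [b] has integral 0, so it vanishes almost
    surely and the conventional value 1 of the quotient does no harm. Elsewhere the denominator
    cancels. *)
Lemma ae_weightE : {ae P, forall w, S' w * weightY w = b w}.
Proof.
have [mSw _ SE] := survival_condexp.
pose A := [set w | S' w = 0].
have GA : Gth A.
  rewrite (_ : A = S' @^-1` [set 0]); last by apply/seteqP; split.
  by apply: clamped_survival_wrt; exact: measurable_set1.
have bA : ae_eq P A (EFin \o b) (cst 0%E).
  apply/(ae_eq_integral_abs _ (mS GA)).
    by apply: measurable_funTS; apply/measurable_EFinP; exact: measurable_b.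
  transitivity (\int[P]_(w in A) (EFin \o b) w)%E.
    by apply: eq_integral => w _; rewrite gee0_abs// lee_fin; case/andP: (b_itv w).
  rewrite -SE// (ae_eq_integral (cst 0%E)) ?integral0//.
  - exact: mS.
  - exact/measurable_funTS/(measurable_wrt_fun mS).
  - by apply: filterS ae_survivalE => w -> /= ->.
apply: filterS2 bA ae_survivalE => w bA SE'; rewrite /weight SE'/= /ratio.
case: eqVneq => S0; last by rewrite mulrC divfK.
by rewrite S0 mul0r; have [->] := bA S0.
Qed.

Lemma measurable_weight : measurable_fun setT weightY.
Proof.
have [mSw _ _] := survival_condexp.
have mf : measurable_fun setT (fun w => fine (S w)).
  by apply: measurableT_comp => //; exact: (measurable_wrt_fun mS).
apply: measurable_fun_ifT => //.
  by apply: measurable_fun_eqr.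
by apply: measurable_funM; [exact: measurable_b|exact: measurable_funV].
Qed.

Definition scale w := a w * S' w.
Local Notation K := scale.

Lemma scale_itv w : 0 <= K w <= 1.
Proof.
have /andP[a0 a1] := a_itv w; have /andP[s0 s1] := clamped_survival_itv w.
by rewrite mulr_ge0//= mulr_ile1.
Qed.

Lemma scale_wrt : measurable_wrt Gth K.
Proof.
apply/(measurable_wrtP sS); apply: measurable_funM; apply/(measurable_wrtP sS).
  exact: a_wrt.
exact: clamped_survival_wrt.
Qed.

Local Notation Jth z := (J P T f g h weightY theta z trY Gth).

(** Almost surely [joint z] is K times the weighted payoff, the denominator of the weight being
    cancelled. The weighted payoff may fail to be integrable, so K is pulled out of its positive and
    negative parts separately; each product with K is integrable, and the difference is formed
    afterwards. *)
Lemma joint_condexp z : control T G theta z ->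
  is_condexp P Gth (EFin \o joint z) (fun w => (K w)%:E * Jth z w)%E.
Proof.
move=> cz; pose Q w := (weightY w * future z w)%:E.
have mQ : measurable_fun setT Q.
  apply/measurable_EFinP; apply: measurable_funM; first exact: measurable_weight.
  by apply/measurable_EFinP; exact: measurable_int (integrable_future cz).
have K0 w : 0 <= K w by case/andP: (scale_itv w).
have KQ : {ae P, forall w, joint z w = K w * weightY w * future z w}.
  by apply: filterS ae_weightE => w e; rewrite /joint -e /scale !mulrA.
have mK : measurable_fun setT K by exact: (measurable_wrt_fun mS scale_wrt).
have mKQ : measurable_fun setT (fun w => (K w)%:E * Q w)%E.
  by apply: emeasurable_funM => //; exact/measurable_EFinP.
have ij : P.-integrable setT (EFin \o joint z) := integrable_joint cz.
have iKQ : P.-integrable setT (fun w => (K w)%:E * Q w)%E.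
  have [mj fj] := integrableP _ _ _ ij; apply/integrableP; split => //.
  rewrite (ae_eq_integral (abse \o (EFin \o joint z)))//.
  - exact: measurableT_comp.
  - exact: measurableT_comp.
  - by apply: filterS KQ => w KQw _; rewrite /= KQw -mulrA.
have pE w : ((K w)%:E * Q^\+ w = (fun w => (K w)%:E * Q w)^\+ w)%E.
  by rewrite !funeposE maxe_pMr ?mule0// lee_fin.
have nE w : ((K w)%:E * Q^\- w = (fun w => (K w)%:E * Q w)^\- w)%E.
  by rewrite !funenegE maxe_pMr ?mule0 ?muleN// lee_fin.
have fQp w : (Q^\+ w)%E \is a fin_num by rewrite funeposE /Q /maxe; case: ifP.
have fQn w : (Q^\- w)%E \is a fin_num by rewrite funenegE /Q -EFinN /maxe; case: ifP.
have part (U : Omega -> \bar R) : measurable_fun setT U -> (forall w, 0 <= U w)%E ->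
    (forall w, U w \is a fin_num) -> P.-integrable setT (fun w => (K w)%:E * U w)%E ->
    is_condexp P Gth (fun w => (K w)%:E * U w)%E
      (fun w => (K w)%:E * condexp_ge0 P Gth U w)%E.
  move=> mU U0 fU iU.
  have := is_condexp_ge0Z sS mS mU U0 scale_wrt scale_itv
    (condexp_ge0_fin_numP P sS mS mU U0 fU).
  move=> cU; have [m1 _ e1] := cU; split => //.
  apply: (is_condexp_ge0_integrable sS mS iU _ cU) => w.
  by rewrite mule_ge0// lee_fin.
have ip : P.-integrable setT (fun w => (K w)%:E * Q^\+ w)%E.
  by rewrite (_ : (fun w => _) = (fun w => (K w)%:E * Q w)^\+)%E;
    [exact: integrable_funepos|exact/funext].
have im : P.-integrable setT (fun w => (K w)%:E * Q^\- w)%E.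
  by rewrite (_ : (fun w => _) = (fun w => (K w)%:E * Q w)^\-)%E;
    [exact: integrable_funeneg|exact/funext].
have cp := part _ (measurable_funepos mQ) (funepos_ge0 Q) fQp ip.
have cm := part _ (measurable_funeneg mQ) (funeneg_ge0 Q) fQn im.
have cB := is_condexpB sS mS ip im cp cm.
have lE : (fun w => (K w)%:E * Q^\+ w - (K w)%:E * Q^\- w)%E = (fun w => (K w)%:E * Q w)%E.
  by apply/funext => w; rewrite -ge0_muleBr// [in RHS](funeposneg Q).
have rE : (fun w => (K w)%:E * condexp_ge0 P Gth Q^\+ w
    - (K w)%:E * condexp_ge0 P Gth Q^\- w)%E = (fun w => (K w)%:E * Jth z w)%E.
  by apply/funext => w; rewrite -ge0_muleBr.
move: cB; rewrite lE rE.
apply: (is_condexp_ael mS mKQ); first exact: measurable_int ij.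
by apply: filterS KQ => w KQw; rewrite /= KQw -mulrA.
Qed.

Lemma measurable_J z : control T G theta z -> measurable_fun setT (Jth z).
Proof.
move=> cz; pose Q w := (weightY w * future z w)%:E.
have mQ : measurable_fun setT Q.
  apply/measurable_EFinP; apply: measurable_funM; first exact: measurable_weight.
  by apply/measurable_EFinP; exact: measurable_int (integrable_future cz).
have fQp w : (Q^\+ w)%E \is a fin_num by rewrite funeposE /Q /maxe; case: ifP.
have fQn w : (Q^\- w)%E \is a fin_num by rewrite funenegE /Q -EFinN /maxe; case: ifP.
have [m1 _ _] := condexp_ge0_fin_numP P sS mS (measurable_funepos mQ) (funepos_ge0 Q) fQp.
have [m2 _ _] := condexp_ge0_fin_numP P sS mS (measurable_funeneg mQ) (funeneg_ge0 Q) fQn.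
by apply: emeasurable_funB; exact: (measurable_wrt_fun mS).
Qed.

Lemma scaled_J_le z z' : control T G theta z -> control T G theta z' ->
  (forall A, Gth A -> (\int[P]_(w in A) (joint z w)%:E <= \int[P]_(w in A) (joint z' w)%:E)%E) ->
  {ae P, forall w, 0 < K w -> (Jth z w <= Jth z' w)%E}.
Proof.
move=> cz cz' le; have := is_condexp_le sS mS (joint_condexp cz) (joint_condexp cz') le.
by apply: filterS => w + K0; rewrite lee_pmul2l.
Qed.

Let fin_whole x : control T G (cst 0) x -> (\int[P]_w (whole x w)%:E)%E \is a fin_num.
Proof.
by move=> cx; apply: integrable_fin_num => //; exact: integrable_whole (control_sub GF cx).
Qed.

Let concat_paste A z : Gth A -> control T G theta z ->
  control T G (cst 0) (concat T X theta (paste A z trX)).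
Proof.
move=> GA cz; apply: (concat_control T0 fG st) => //.
exact: (paste_control T0 fG st).
Qed.

(** [Jth trX] belongs to the family and, on {K > 0}, lies almost surely below each [Jth z]. Extended
    by [-oo] outside {K > 0} it is an essential lower bound, hence lies below the essential
    infimum. *)
Lemma ess_infimum_optimal :
  (forall x, control T G (cst 0) x ->
    (\int[P]_w (whole X w)%:E <= \int[P]_w (whole x w)%:E)%E) ->
  {ae P, forall w, 0 < K w ->
    ess_infimum P [set Jth z | z in control T G theta] w = Jth trX w}.
Proof.
move=> opt.
have mJ V : [set Jth z | z in control T G theta] V -> measurable_fun setT V.
  by move=> [z cz <-]; exact: measurable_J.
have [_ lb glb] := ess_infimumP P mJ.
have mK : measurable_fun setT K by exact: (measurable_wrt_fun mS scale_wrt).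
have mZ : measurable_fun setT (fun w => if 0 < K w then Jth trX w else -oo%E).
  apply: measurable_fun_ifT => //; first exact: measurable_fun_ltr.
  exact: measurable_J.
have le z : control T G theta z -> {ae P, forall w, 0 < K w -> (Jth trX w <= Jth z w)%E}.
  move=> cz; apply: (scaled_J_le ctrX cz) => A GA.
  exact: (lee_exchange (joint_deviation GA cz) (opt _ (concat_paste GA cz)) (fin_whole cX)).
have Zle := glb _ mZ; have Vle := lb _ (ex_intro2 _ _ _ ctrX (erefl (Jth trX))).
apply: filterS2 (Zle _) Vle => [w Zw Vw K0|V [z cz <-]]; last first.
  by apply: filterS (le _ cz) => w; case: ifPn => [K0 ->|_ _]//; rewrite leNye.
by apply/eqP; rewrite eq_le Vw; move: Zw; rewrite K0.
Qed.

(** The mirror image, with [+oo] outside {K > 0}; the finite quantity that is cancelled is now the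
    payoff of the deviation. *)
Lemma ess_supremum_optimal :
  (forall x, control T G (cst 0) x ->
    (\int[P]_w (whole x w)%:E <= \int[P]_w (whole X w)%:E)%E) ->
  {ae P, forall w, 0 < K w ->
    ess_supremum P [set Jth z | z in control T G theta] w = Jth trX w}.
Proof.
move=> opt.
have mJ V : [set Jth z | z in control T G theta] V -> measurable_fun setT V.
  by move=> [z cz <-]; exact: measurable_J.
have [_ ub lub] := ess_supremumP P mJ.
have mK : measurable_fun setT K by exact: (measurable_wrt_fun mS scale_wrt).
have mZ : measurable_fun setT (fun w => if 0 < K w then Jth trX w else +oo%E).
  apply: measurable_fun_ifT => //; first exact: measurable_fun_ltr.
  exact: measurable_J.
have le z : control T G theta z -> {ae P, forall w, 0 < K w -> (Jth z w <= Jth trX w)%E}.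
  move=> cz; apply: (scaled_J_le cz ctrX) => A GA.
  exact: (lee_exchange (esym (joint_deviation GA cz)) (opt _ (concat_paste GA cz))
    (fin_whole (concat_paste GA cz))).
have Zle := lub _ mZ; have Vle := ub _ (ex_intro2 _ _ _ ctrX (erefl (Jth trX))).
apply: filterS2 (Zle _) Vle => [w Zw Vw K0|V [z cz <-]]; last first.
  by apply: filterS (le _ cz) => w; case: ifPn => [K0 ->|_ _]//; rewrite leey.
by apply/eqP; rewrite eq_le Vw andbT; move: Zw; rewrite K0.
Qed.

Lemma survival_event : Gth [set w | (0 < (a w)%:E * S w)%E].
Proof.
have [mSw _ _] := survival_condexp.
rewrite (_ : [set w | _] = (fun w => (a w)%:E * S w)%E @^-1` `]0%E, +oo[%classic); last first.
  by apply/seteqP; split => w /=; rewrite in_itv/= andbT.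
have : measurable_wrt Gth (fun w => (a w)%:E * S w)%E.
  apply/(measurable_wrtP sS); apply: emeasurable_funM; last exact/(measurable_wrtP sS).
  by apply/measurable_EFinP; apply/(measurable_wrtP sS); exact: a_wrt.
by apply; exact: emeasurable_itv.
Qed.

(** Stands for the essential infimum of one player or the essential supremum of the other, so that
    the conclusions serve both. *)
Variable V : Omega -> \bar R.
Hypothesis VE : {ae P, forall w, 0 < K w -> V w = Jth trX w}.

Lemma equilibrium_value : {ae P, forall w,
  ((\1_[set w | (0 < (a w)%:E * S w)%E] w)%:E * V w =
   (\1_[set w | (0 < (a w)%:E * S w)%E] w)%:E * Jth trX w)%E}.
Proof.
apply: filterS2 VE ae_survivalE => w Vw Sw; rewrite indicE.
case: (boolP (w \in _)); last by rewrite !mul0e.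
by rewrite inE/= Sw -EFinM lte_fin => K0; rewrite Vw.
Qed.

(** Where K = 0, the products with [V] and with J both vanish, even at infinite values; where K > 0,
    [V] is J of the truncated control. The identity is then the conditional form of the split of the
    payoff at theta. *)
Lemma equilibrium_condexp : {ae P, forall w,
  (condexp P Gth (EFin \o past) w + (a w)%:E * S w * V w)%E =
  condexp P Gth (EFin \o whole X) w}.
Proof.
have ip := integrable_past; have ij := integrable_joint ctrX.
have iX := integrable_whole cXF.
have cD := is_condexpD sS mS ip ij (condexpP sS mS ip) (joint_condexp ctrX).
have cX' := condexpP sS mS iX.
have cW : is_condexp P Gth (EFin \o whole X)
    (condexp P Gth (EFin \o past) \+ (fun w => (K w)%:E * Jth trX w))%E.
  apply: (is_condexp_ael mS _ _ _ cD); last 1 first.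
  - by apply: filterS past_truncated => w /= ->; rewrite EFinD.
  - exact: measurable_int (integrableD measurableT ip ij).
  - exact: measurable_int iX.
apply: filterS3 VE ae_survivalE (is_condexp_unique sS mS cW cX') => w Vw Sw <-.
rewrite Sw -EFinM -/(K w); congr (_ + _)%E.
have /andP[] := scale_itv w; rewrite le_eqVlt => /predU1P[<- _|K0 _].
  by rewrite !mul0e.
by rewrite Vw.
Qed.

End player.

Lemma J_sym {d : measure_display} {Omega : measurableType d} {R : realType}
    (P : probability Omega R) (T : R) (f g h : R -> Omega -> R) Pi theta x z H :
  J P T f g h Pi theta x z H = J P T g f h Pi theta z x H.
Proof.
by rewrite /J; congr condexp; apply/funext => w; rewrite payoff_functionalC.
Qed.

Theorem proposition3p8 (d : measure_display) (Omega : measurableType d)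
    (R : realType) (P : probability Omega R) (T : R)
    (F F1 F2 : R -> set (set Omega)) (f g h xi zeta : R -> Omega -> R)
    (T_gt0 : 0 < T)
    (P_complete : measure_is_complete P)
    (F_filtration : filtration P T F)
    (F1_filtration : filtration P T F1)
    (F2_filtration : filtration P T F2)
    (FT_proper : F T `<` measurable)
    (F12_F : forall t, 0 <= t <= T -> <<s F1 t `|` F2 t >> `<=` F t)
    (f_Lb : Lb P T f) (g_Lb : Lb P T g) (h_Lb : Lb P T h)
    (f_adapted : adapted T F f) (g_adapted : adapted T F g)
    (h_adapted : adapted T F h)
    (ghf : {ae P, forall w, forall t, 0 <= t <= T ->
      g t w <= h t w /\ h t w <= f t w})
    (opt : optimal_pair P T F F1 F2 f g h xi zeta) :
  [/\ martingale_system P T F1 (Mstar P T F1 f g h xi zeta),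
      martingale_system P T F2 (Nstar P T F2 f g h xi zeta),
      class_D P T F1 (Mstar P T F1 f g h xi zeta)
    & class_D P T F2 (Nstar P T F2 f g h xi zeta)] /\
  (uniquely_aggregated_cadlag_martingale P T F1 (Mstar P T F1 f g h xi zeta) /\
   uniquely_aggregated_cadlag_martingale P T F2 (Nstar P T F2 f g h xi zeta)) /\
  (forall theta, stopping_time T F1 theta ->
    sigma_at T F1 theta (Gamma1 P T F1 xi zeta theta) /\
    {ae P, forall w,
      ((\1_(Gamma1 P T F1 xi zeta theta) w)%:E
         * V1 P T F1 f g h zeta theta w =
       (\1_(Gamma1 P T F1 xi zeta theta) w)%:E
         * J1 P T F1 f g h zeta theta (truncated T xi theta) w)%E}) /\
  (forall gamma, stopping_time T F2 gamma ->
    sigma_at T F2 gamma (Gamma2 P T F2 xi zeta gamma) /\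
    {ae P, forall w,
      ((\1_(Gamma2 P T F2 xi zeta gamma) w)%:E
         * V2 P T F2 f g h xi gamma w =
       (\1_(Gamma2 P T F2 xi zeta gamma) w)%:E
         * J2 P T F2 f g h xi gamma (truncated T zeta gamma) w)%E}).
Proof.
have [cf _ Sf] := f_Lb; have [cg _ Sg] := g_Lb; have [ch _ Sh] := h_Lb.
have F1F t : 0 <= t <= T -> F1 t `<=` F t.
  by move=> tT A FA; apply: (F12_F _ tT); apply: sub_gen_smallest; left.
have F2F t : 0 <= t <= T -> F2 t `<=` F t.
  by move=> tT A FA; apply: (F12_F _ tT); apply: sub_gen_smallest; right.
have [cxi czeta [Z1 [Z2 [dev maxi mini]]]] := opt.
have cxiF := control_sub F1F cxi; have czetaF := control_sub F2F czeta.
have value x z : control T F (cst 0) x -> control T F (cst 0) z ->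
    ('E_P[payoff f g h (generated_time T x Z1) (generated_time T z Z2)] =
     \int[P]_w (whole T f g h z x w)%:E)%E.
  move=> cx cz; have [ax _ _ _ _] := cx; have [az _ _ _ _] := cz.
  exact: (expected_payoff T_gt0 F_filtration cf cg ch f_adapted g_adapted h_adapted
    Sf Sg Sh dev ax az (control_control_path cx) (control_control_path cz) P_complete).
have wholeC x z : whole T g f h x z = whole T f g h z x.
  by apply/funext => w; rewrite /whole payoff_functionalC.
have opt1 x : control T F1 (cst 0) x ->
    (\int[P]_w (whole T f g h zeta xi w)%:E <= \int[P]_w (whole T f g h zeta x w)%:E)%E.
  move=> cx; rewrite -(value xi zeta cxiF czetaF) -(value x zeta (control_sub F1F cx) czetaF).
  (* The deviation reuses the device of the saddle point, for which independence is known. *)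
  by apply: (mini Z1) => //; exists x.
have opt2 z : control T F2 (cst 0) z ->
    (\int[P]_w (whole T g f h xi z w)%:E <= \int[P]_w (whole T g f h xi zeta w)%:E)%E.
  move=> cz; rewrite !wholeC.
  rewrite -(value xi zeta cxiF czetaF) -(value xi z cxiF (control_sub F2F cz)).
  by apply: (maxi Z2) => //; exists z.
have V1E theta : stopping_time T F1 theta -> {ae P, forall w,
    0 < scale P T F1 xi zeta theta w ->
    V1 P T F1 f g h zeta theta w =
    J P T f g h (weight P T F1 zeta theta) theta (truncated T xi theta)
      (truncated T zeta theta) (sigma_at T F1 theta) w}.
  move=> st; exact: (ess_infimum_optimal P_complete T_gt0 F_filtration F1_filtration F1F
    cf cg ch f_adapted g_adapted h_adapted Sf Sg Sh cxi czetaF st opt1).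
have V2E gamma : stopping_time T F2 gamma -> {ae P, forall w,
    0 < scale P T F2 zeta xi gamma w ->
    V2 P T F2 f g h xi gamma w =
    J P T g f h (weight P T F2 xi gamma) gamma (truncated T zeta gamma)
      (truncated T xi gamma) (sigma_at T F2 gamma) w}.
  move=> st.
  (* Exchanging f and g brings the second player's functional to the form in which the player's own
     control is the first argument. *)
  have -> : V2 P T F2 f g h xi gamma = ess_supremum P
      [set J P T g f h (weight P T F2 xi gamma) gamma z (truncated T xi gamma)
        (sigma_at T F2 gamma) | z in control T F2 gamma].
    rewrite /V2; have -> : J2 P T F2 f g h xi gamma = fun z => J P T g f h
        (weight P T F2 xi gamma) gamma z (truncated T xi gamma) (sigma_at T F2 gamma).
      by apply/funext => z; exact: J_sym.
    by [].
  exact: (ess_supremum_optimal P_complete T_gt0 F_filtration F2_filtration F2F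
    cg cf ch g_adapted f_adapted h_adapted Sg Sf Sh czeta cxiF st opt2).
have iX := integrable_whole P_complete T_gt0 F_filtration F1F cf cg ch
  f_adapted g_adapted h_adapted Sf Sg Sh cxi czetaF cxiF.
have M1 theta : stopping_time T F1 theta -> {ae P, forall w,
    Mstar P T F1 f g h xi zeta theta w =
    condexp P (sigma_at T F1 theta) (EFin \o whole T f g h zeta xi) w}.
  move=> st; exact: (equilibrium_condexp P_complete T_gt0 F_filtration F1_filtration F1F
    cf cg ch f_adapted g_adapted h_adapted Sf Sg Sh cxi czetaF st (V1E _ st)).
have M2 gamma : stopping_time T F2 gamma -> {ae P, forall w,
    Nstar P T F2 f g h xi zeta gamma w =
    condexp P (sigma_at T F2 gamma) (EFin \o whole T f g h zeta xi) w}.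
  move=> st; have := equilibrium_condexp P_complete T_gt0 F_filtration F2_filtration F2F
    cg cf ch g_adapted f_adapted h_adapted Sg Sf Sh czeta cxiF st (V2E _ st).
  apply: filterS => w; rewrite wholeC => <-; rewrite /Nstar /past_payoff.
  have -> : EFin \o past T g f h zeta xi gamma = fun w => (payoff_functional T f g h xi zeta
      (fun w => `[0, gamma w[%classic) (fun w => `[0, gamma w[%classic) w)%:E.
    by apply/funext => v; rewrite /= /past payoff_functionalC.
  by [].
split; first split.
- exact: (closed_family_martingale_system T_gt0 F1_filtration iX M1).
- exact: (closed_family_martingale_system T_gt0 F2_filtration iX M2).
- exact: (closed_family_class_D T_gt0 F1_filtration iX M1).
- exact: (closed_family_class_D T_gt0 F2_filtration iX M2).
split; first split.
- exact: (closed_family_aggregated T_gt0 F1_filtration iX M1).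
- exact: (closed_family_aggregated T_gt0 F2_filtration iX M2).
split=> [theta st|gamma st]; split.
- exact: (survival_event T_gt0 F_filtration F1_filtration F1F cxi czetaF st).
- exact: (equilibrium_value T_gt0 F_filtration F1_filtration F1F czetaF st (V1E _ st)).
- exact: (survival_event T_gt0 F_filtration F2_filtration F2F czeta cxiF st).
- have := equilibrium_value T_gt0 F_filtration F2_filtration F2F cxiF st (V2E _ st).
  by rewrite J_sym.
Qed.
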